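(* Let $D=D_{\varepsilon_1}^2\times D_{\varepsilon_2}^2$, where $$D_{\varepsilon_1}^2=\Big\{f:\tfrac1{2\pi}\int_{-\infty}^\infty|f(\lambda)-f_1(\lambda)|^2d\lambda\le\varepsilon_1\Big\},\qquad D_{\varepsilon_2}^2=\Big\{g:\tfrac1{2\pi}\int_{-\infty}^\infty|g(\lambda)-g_1(\lambda)|^2d\lambda\le\varepsilon_2\Big\}$$ are sets of spectral densities and $f_1,g_1$ are fixed spectral densities. Suppose that $f_0\in D_{\varepsilon_1}^2$, $g_0\in D_{\varepsilon_2}^2$ satisfy the minimality condition $\int_{-\infty}^\infty\frac{|\gamma(\lambda)|^2}{f_0(\lambda)+g_0(\lambda)}d\lambda<\infty$ for some nontrivial function of exponential type $\gamma(\lambda)=\int_0^\infty\alpha(t)e^{it\lambda}dt$, and that the functions $$h_f(f_0,g_0)=\frac{|A(e^{i\lambda})g_0(\lambda)+C^0(e^{i\lambda})|^2}{(f_0(\lambda)+g_0(\lambda))^2},\qquad h_g(f_0,g_0)=\frac{|A(e^{i\lambda})f_0(\lambda)-C^0(e^{i\lambda})|^2}{(f_0(\lambda)+g_0(\lambda))^2}$$ are bounded. Suppose that for some constants $\alpha_1\ge0$, $\alpha_2\ge0$ $$|A(e^{i\lambda})g_0(\lambda)+C^0(e^{i\lambda})|^2=(f_0(\lambda)+g_0(\lambda))^2(f_0(\lambda)-f_1(\lambda))\alpha_1,$$ $$|A(e^{i\lambda})f_0(\lambda)-C^0(e^{i\lambda})|^2=(f_0(\lambda)+g_0(\lambda))^2(g_0(\lambda)-g_1(\lambda))\alpha_2,$$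 that $$\frac1{2\pi}\int_{-\infty}^\infty|f_0(\lambda)-f_1(\lambda)|^2d\lambda=\varepsilon_1,\qquad\frac1{2\pi}\int_{-\infty}^\infty|g_0(\lambda)-g_1(\lambda)|^2d\lambda=\varepsilon_2,$$ and that $(f_0,g_0)$ determines a solution of the optimization problem $$\max_{(f,g)\in D}\Big(\langle\mathbf R\mathbf a,\mathbf B^{-1}\mathbf R\mathbf a\rangle+\langle\mathbf Q\mathbf a,\mathbf a\rangle\Big)=\langle\mathbf R^0\mathbf a,(\mathbf B^0)^{-1}\mathbf R^0\mathbf a\rangle+\langle\mathbf Q^0\mathbf a,\mathbf a\rangle .$$ Then $f_0,g_0$ are the least favorable spectral densities in the class $D_{\varepsilon_1}^2\times D_{\varepsilon_2}^2$ for the optimal linear filtering of the functional $A\xi$, and the function $$h(f_0,g_0)=\frac{A(e^{i\lambda})f_0(\lambda)-C^0(e^{i\lambda})}{f_0(\lambda)+g_0(\lambda)}$$ is the minimax-robust spectral characteristic of the estimate of $A\xi$.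
   Context: Index sets. Let $s\ge1$, $N_0=K_0=0$, let $N_1,\dots,N_s,K_1,\dots,K_s$ be nonnegative reals and $M_l=\sum_{k=0}^l(N_k+K_k)$. Put $\mathbb R^-=(-\infty,0)$, $S=\bigcup_{l=1}^s[-M_l-N_l,-M_l]$, $S^+=\bigcup_{l=1}^s[M_l,M_l+N_l]$, $R^s=[0,\infty)\setminus S^+$, $T=S\cup[0,\infty)$. Processes and functional. $\xi,\eta$ are zero-mean, mutually uncorrelated stationary processes on $\mathbb R$ with spectral densities $f,g$ (nonnegative integrable functions, $E\xi(t)\overline{\xi(u)}=\frac1{2\pi}\int e^{i(t-u)\lambda}f(\lambda)d\lambda$, similarly for $\eta,g$). The functional is $A\xi=\int_{R^s}a(t)\xi(-t)dt$, estimated from observations of $\xi(t)+\eta(t)$, $t\in\mathbb R^-\setminus S$, where $\int_{R^s}|a|dt<\infty$, $\int_{R^s}t|a(t)|^2dt<\infty$. $\mathbf a$ is the function on $T$ equal to $a$ on $R^s$ and $0$ on $S\cup S^+$, regarded as an element of $L_2(T)$. $A(e^{i\lambda})=\int_{R^s}a(t)e^{-it\lambda}dt$. Estimates. $L_2^s(f+g)$ is the closed linear span of $\{e^{it\lambda}:t\in\mathbb R^-\setminus S\}$ in $L_2(\mathbb R,(f+g)d\lambda)$. For a linear estimate with spectral characteristic $h\in L_2^s(f+g)$ the mean-square error is $\Delta(h;f,g)=\frac1{2\pi}\int|A(e^{i\lambda})-h(e^{i\lambda})|^2f(\lambda)d\lambda+\frac1{2\pi}\int|h(e^{i\lambda})|^2g(\lambda)d\lambda$.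 $h(f,g)$ denotes the spectral characteristic of the optimal estimate, i.e. the minimizer of $\Delta(\cdot;f,g)$ over $L_2^s(f+g)$, and $\Delta(f,g)=\Delta(h(f,g);f,g)$. Operators in $L_2(T)$ for a pair $(f,g)$, $t\in T$: $(\mathbf B\mathbf x)(t)=\frac1{2\pi}\int_{-\infty}^\infty\frac{e^{-it\lambda}}{f+g}\big(\int_T\mathbf x(u)e^{iu\lambda}du\big)d\lambda$ (on those $\mathbf x$ for which $\frac1{f+g}\int_T\mathbf x(u)e^{iu\lambda}du\in L_2(\mathbb R)$), $(\mathbf R\mathbf x)(t)=\frac1{2\pi}\int_{-\infty}^\infty\frac{fe^{-it\lambda}}{f+g}\big(\int_T\mathbf x(u)e^{-iu\lambda}du\big)d\lambda$, $(\mathbf Q\mathbf x)(t)=\frac1{2\pi}\int_{-\infty}^\infty\frac{fg\,e^{it\lambda}}{f+g}\big(\int_T\mathbf x(u)e^{-iu\lambda}du\big)d\lambda$, as Fourier integrals in the $L_2$ sense or absolutely convergent. $\mathbf B$ is assumed invertible (with $\mathbf B^{-1}$ on $L_2(T)$) for the densities considered. $\langle x,y\rangle=\int_Tx\overline y\,dt$. $\mathbf B^0,\mathbf R^0,\mathbf Q^0$ are these operators for $(f,g)=(f_0,g_0)$, and $C^0(e^{i\lambda})=\int_T((\mathbf B^0)^{-1}\mathbf R^0\mathbf a)(t)e^{it\lambda}dt$. Minimax notions. For $D=D_f\times D_g$: $(f_0,g_0)\in D$ is least favorable in $D$ for the optimal linear filtering of $A\xi$ if $\Delta(f_0,g_0)=\max_{(f,g)\in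 D}\Delta(f,g)$. With $H_D=\bigcap_{(f,g)\in D}L_2^s(f+g)$, a spectral characteristic $h^0$ is minimax-robust if $h^0\in H_D$ and $\min_{h\in H_D}\max_{(f,g)\in D}\Delta(h;f,g)=\max_{(f,g)\in D}\Delta(h^0;f,g)$. *)

(* Defs.v *)
From HB Require Import structures.
From mathcomp Require Import all_boot all_order all_algebra.
From mathcomp Require Import all_classical all_reals all_analysis.
From mathcomp Require Export complex.

Set Implicit Arguments.
Unset Strict Implicit.
Unset Printing Implicit Defensive.

Import Order.TTheory GRing.Theory Num.Theory.
Import numFieldNormedType.Exports.
Export ComplexField.Normc.

Local Open Scope classical_set_scope.
Local Open Scope complex_scope.
Local Open Scope ring_scope.

Section complex_valued_functions.
Context {R : realType}.
Local Notation mu := (@lebesgue_measure R).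

Definition cis (x : R) : R[i] := cos x +i* sin x.

Definition cintegral (D : set R) (x : R -> R[i]) : R[i] :=
  (\int[mu]_(t in D) complex.Re (x t)) +i* (\int[mu]_(t in D) complex.Im (x t)).

Definition cmeasurable (D : set R) (x : R -> R[i]) : Prop :=
  measurable_fun D (fun t => complex.Re (x t)) /\
  measurable_fun D (fun t => complex.Im (x t)).

Definition sqint (D : set R) (x : R -> R[i]) : \bar R :=
  (\int[mu]_(t in D) (normc (x t) ^+ 2)%:E)%E.

Definition inL1 (D : set R) (x : R -> R[i]) : Prop :=
  cmeasurable D x /\ (\int[mu]_(t in D) (normc (x t))%:E < +oo)%E.

Definition inL2 (D : set R) (x : R -> R[i]) : Prop :=
  cmeasurable D x /\ (sqint D x < +oo)%E.

(* Elements of L_2(D) are represented by functions, so that equality is almost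
   everywhere equality on D. *)
Definition ae_eq_on (D : set R) (x y : R -> R[i]) : Prop :=
  {ae mu, forall t, D t -> x t = y t}.

Definition inner (D : set R) (x y : R -> R[i]) : R[i] :=
  cintegral D (fun t => x t * (y t)^*).

Definition kernel_integral (D : set R) (sgn : R) (x : R -> R[i]) (l : R) : R[i] :=
  cintegral D (fun u => x u * cis (sgn * u * l)).

(* X(l) = \int_D x(u) e^{i sgn u l} du, either as an absolutely convergent
   integral or as a limit in L_2 norm of the truncated integrals; when both
   apply, the two meanings agree almost everywhere. *)
Definition fourier (D : set R) (sgn : R) (x X : R -> R[i]) : Prop :=
  (inL1 D x /\ forall l, X l = kernel_integral D sgn x l) \/
  [/\ inL2 D x, inL2 setT X &
    sqint setT (fun l =>
      X l - kernel_integral (D `&` `[- n%:R, n%:R]) sgn x l) @[n --> \oo]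
    --> 0%E].

End complex_valued_functions.

Section index_sets.
Context {R : realType}.
Variables (s : nat) (N K : nat -> R).

Definition M_ (l : nat) : R := \sum_(0 <= k < l.+1) (N k + K k).

Definition missing : set R :=
  [set t | exists l, [/\ (1 <= l)%N, (l <= s)%N & - M_ l - N l <= t <= - M_ l]].

Definition missing_plus : set R :=
  [set t | exists l, [/\ (1 <= l)%N, (l <= s)%N & M_ l <= t <= M_ l + N l]].

Definition Rs : set R := [set t | 0 <= t] `\` missing_plus.

Definition Tset : set R := missing `|` [set t | 0 <= t].

Definition observed : set R := [set t | t < 0] `\` missing.

Definition zero_ext (a : R -> R[i]) : R -> R[i] :=
  fun t => if t \in Rs then a t else 0.

End index_sets.

Section filtering.
Context {R : realType}.
Local Notation mu := (@lebesgue_measure R).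
Variables (s : nat) (N K : nat -> R).
Local Notation T := (Tset s N K).

Definition spectral_density (f : R -> R) : Prop :=
  (forall l, 0 <= f l) /\ mu.-integrable setT (EFin \o f).

Definition A_ (a : R -> R[i]) (l : R) : R[i] :=
  cintegral (Rs s N K) (fun t => a t * cis (- (t * l))).

Definition wsqint (w : R -> R) (h : R -> R[i]) : \bar R :=
  (\int[mu]_l (normc (h l) ^+ 2 * w l)%:E)%E.

(* L_2^s(w): the closure in L_2(w) of the trigonometric polynomials with
   frequencies among the observation times. *)
Definition L2s (w : R -> R) (h : R -> R[i]) : Prop :=
  [/\ cmeasurable setT h, (wsqint w h < +oo)%E &
    forall e : R, 0 < e ->
    exists n (c : 'I_n -> R[i]) (t : 'I_n -> R),
      (forall j, observed s N K (t j)) /\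
      (wsqint w (fun l => (h l - \sum_(j < n) c j * cis (t j * l))%R) < e%:E)%E].

Definition mse (a h : R -> R[i]) (f g : R -> R) : \bar R :=
  (((2 * pi)^-1)%:E * wsqint f (fun l => (A_ a l - h l)%R) +
   ((2 * pi)^-1)%:E * wsqint g h)%E.

(* h is the spectral characteristic h(f,g) of the optimal estimate. *)
Definition optimal (a : R -> R[i]) (f g : R -> R) (h : R -> R[i]) : Prop :=
  L2s (f \+ g) h /\
  forall h', L2s (f \+ g) h' -> (mse a h f g <= mse a h' f g)%E.

(* d = Delta(f,g) = Delta(h(f,g); f,g). *)
Definition optimal_mse (a : R -> R[i]) (f g : R -> R) (d : \bar R) : Prop :=
  exists2 h, optimal a f g h & d = mse a h f g.

Definition least_favorable (a : R -> R[i]) (D : set ((R -> R) * (R -> R)))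
    (f0 g0 : R -> R) : Prop :=
  D (f0, g0) /\
  exists2 d0, optimal_mse a f0 g0 d0 &
    forall f g d, D (f, g) -> optimal_mse a f g d -> (d <= d0)%E.

Definition H_ (D : set ((R -> R) * (R -> R))) : set (R -> R[i]) :=
  [set h | forall f g, D (f, g) -> L2s (f \+ g) h].

Definition worst_mse (a : R -> R[i]) (D : set ((R -> R) * (R -> R)))
    (h : R -> R[i]) : \bar R :=
  ereal_sup [set mse a h p.1 p.2 | p in D].

(* The supremum is required to be attained at h0; for a general h in H_D it
   need not be attained and may be infinite. *)
Definition minimax_robust (a : R -> R[i]) (D : set ((R -> R) * (R -> R)))
    (h0 : R -> R[i]) : Prop :=
  [/\ H_ D h0,
      exists2 p, D p & mse a h0 p.1 p.2 = worst_mse a D h0 &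
      forall h, H_ D h -> (worst_mse a D h0 <= worst_mse a D h)%E].

(* The operators are given by their graphs: opB f g x y means that x is in the
   domain of B and that y is B x.  As 0^-1 = 0 in R, the condition that
   1 / (f + g) makes sense almost everywhere has to be stated. *)
Definition is_image (Y y : R -> R[i]) : Prop :=
  cmeasurable T y /\ ae_eq_on T y (fun t => ((2 * pi)^-1)%:C * Y t).

Definition opB (f g : R -> R) (x y : R -> R[i]) : Prop :=
  [/\ inL2 T x, {ae mu, forall l, f l + g l != 0} &
    exists X Y : R -> R[i],
      [/\ fourier T 1 x X,
          inL2 setT (fun l => ((f l + g l)^-1)%:C * X l),
          fourier setT (-1) (fun l => ((f l + g l)^-1)%:C * X l) Y &
          is_image Y y]].

Definition opR (f g : R -> R) (x y : R -> R[i]) : Prop :=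
  inL2 T x /\
  exists X Y : R -> R[i],
    [/\ fourier T (-1) x X,
        fourier setT (-1) (fun l => (f l / (f l + g l))%:C * X l) Y &
        is_image Y y].

Definition opQ (f g : R -> R) (x y : R -> R[i]) : Prop :=
  inL2 T x /\
  exists X Y : R -> R[i],
    [/\ fourier T (-1) x X,
        fourier setT 1 (fun l => (f l * g l / (f l + g l))%:C * X l) Y &
        is_image Y y].

(* B^{-1} is the inverse of an injective operator in L_2(T), defined on the
   range of B.  Since f + g is integrable, 1 / (f + g) is unbounded, and B is
   not required to map its domain onto L_2(T). *)
Definition invertibleB (f g : R -> R) : Prop :=
  forall x x' y, opB f g x y -> opB f g x' y -> ae_eq_on T x x'.

Definition opBinv (f g : R -> R) (y x : R -> R[i]) : Prop :=
  invertibleB f g /\ opB f g x y.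

(* C(e^{il}) = \int_T (B^{-1} R a)(t) e^{itl} dt *)
Definition is_C (a : R -> R[i]) (f g : R -> R) (C : R -> R[i]) : Prop :=
  exists y x, [/\ opR f g (zero_ext s N K a) y, opBinv f g y x &
    fourier T 1 x C].

(* v = <R a, B^{-1} R a> + <Q a, a>; both inner products are real. *)
Definition objective (a : R -> R[i]) (f g : R -> R) (v : R) : Prop :=
  exists y x q,
    [/\ opR f g (zero_ext s N K a) y, opBinv f g y x,
        opQ f g (zero_ext s N K a) q &
        v = complex.Re (inner T y x + inner T q (zero_ext s N K a))].

Definition solves_extremal (a : R -> R[i]) (D : set ((R -> R) * (R -> R)))
    (f0 g0 : R -> R) : Prop :=
  D (f0, g0) /\
  exists2 v0, objective a f0 g0 v0 &
    forall f g v, D (f, g) -> objective a f g v -> v <= v0.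

End filtering.

Section minimality_and_classes.
Context {R : realType}.
Local Notation mu := (@lebesgue_measure R).

Definition entire_exponential_type (G : R[i] -> R[i]) : Prop :=
  (forall z : R[i], derivable (G : R[i]^o -> R[i]^o) z 1) /\
  exists k sigma : R, forall z, normc (G z) <= k * expR (sigma * normc z).

(* The quotient is taken in \bar R, where 0^-1 = +oo. *)
Definition minimality (f g : R -> R) : Prop :=
  exists (alpha : R -> R[i]) (G : R[i] -> R[i]),
    [/\ inL1 [set t | 0 <= t] alpha,
        entire_exponential_type G,
        forall l : R, G l%:C = kernel_integral [set t | 0 <= t] 1 alpha l,
        exists l : R, G l%:C != 0 &
        (\int[mu]_l ((normc (G l%:C) ^+ 2)%:E / (f l + g l)%:E) < +oo)%E].

Definition L2ball (f1 : R -> R) (eps : R) : set (R -> R) :=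
  [set f | spectral_density f /\
    (((2 * pi)^-1)%:E * \int[mu]_l (`|f l - f1 l| ^+ 2)%:E <= eps%:E)%E].

End minimality_and_classes.

(* Main.v *)
Require Import Defs.
From HB Require Import structures.
From mathcomp Require Import all_boot all_order all_algebra.
From mathcomp Require Import all_classical all_reals all_analysis.
From mathcomp Require Import complex ring lra measurable_realfun.

Set Implicit Arguments.
Unset Strict Implicit.
Unset Printing Implicit Defensive.

Import Order.TTheory GRing.Theory Num.Theory.
Import numFieldNormedType.Exports.

Local Open Scope classical_set_scope.
Local Open Scope complex_scope.
Local Open Scope ring_scope.

(* Let w = f0 + g0 and x = B^-1 R a, so that h0 = (A f0 - C) / w.

   B x = R a says that h0 = A f0 / w - C / w has a Fourier transform vanishing
   on T. As h0 is bounded, it lies in L_2^s for every integrable weight: the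
   box averages of h0 * (Poisson kernel) are Fourier integrals of integrable
   functions carried by the observation times, hence limits of Riemann sums,
   and they converge boundedly to h0 almost everywhere.

   Since x is carried by T, its transform C = A f0 - h0 w is orthogonal to the
   observed exponentials. This is the normal equation, so that h0 is optimal
   for (f0, g0).

   Finally |A - h0|^2 = alpha1 (f0 - f1) and |h0|^2 = alpha2 (g0 - g1): the
   linear functional (f, g) |-> Delta(h0; f, g) has its gradient normal to the
   two balls at (f0, g0), so that it is maximal there over D. Hence h0 and
   (f0, g0) form a saddle point of Delta, which gives all three claims. *)

(** * Complex-valued functions *)

(** Membership in [H_] concerns all pairs of the class at once, so duality in L_2(f0 + g0) alone
    would not give it. Boundedness of h0, that is, of h_g = |h0|^2, makes the weight immaterial:
    bounded convergence almost everywhere is convergence in L_2(w) for every integrable w.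

    The relation B x = R a equates Fourier integrals that may converge only in L_2. Damping by
    e^{-e|l|} makes them absolutely convergent and convolves the other side with 2e / (e^2 + z^2);
    the identities are used in this form before e tends to 0. For small z the supremum of this
    kernel over e is 1/|z|, so the limit e -> 0 has no integrable majorant. A prior average over a
    box of length r supplies one: for fixed r the limit in e is dominated, and the limit r -> 0 is
    Lebesgue's differentiation theorem.

    The normal equation rests on T being closed: an observation time has positive distance from T,
    and away from 0 the Poisson kernel tends to 0 with e. *)

Section complex_algebra.
Context {R : realType}.
Implicit Types z w : R[i].

Lemma ReM z w : complex.Re (z * w) =
  complex.Re z * complex.Re w - complex.Im z * complex.Im w.
Proof. by case: z => a b; case: w. Qed.

Lemma ImM z w : complex.Im (z * w) =
  complex.Re z * complex.Im w + complex.Im z * complex.Re w.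
Proof. by case: z => a b; case: w => c d /=; rewrite addrC. Qed.

Lemma ReD z w : complex.Re (z + w) = complex.Re z + complex.Re w.
Proof. by case: z => a b; case: w. Qed.

Lemma ImD z w : complex.Im (z + w) = complex.Im z + complex.Im w.
Proof. by case: z => a b; case: w. Qed.

Lemma ReN z : complex.Re (- z) = - complex.Re z.
Proof. by case: z. Qed.

Lemma ImN z : complex.Im (- z) = - complex.Im z.
Proof. by case: z. Qed.

Lemma complex_eqP z w :
  complex.Re z = complex.Re w -> complex.Im z = complex.Im w -> z = w.
Proof. by case: z => a b; case: w => c d /= -> ->. Qed.

Lemma sqr_normcE z :
  normc z ^+ 2 = complex.Re z ^+ 2 + complex.Im z ^+ 2.
Proof. by case: z => a b /=; rewrite sqr_sqrtr// addr_ge0// sqr_ge0. Qed.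

Lemma normc_ge0 z : 0 <= normc z.
Proof. by case: z => a b; rewrite sqrtr_ge0. Qed.

Lemma le_Re_normc z : `|complex.Re z| <= normc z.
Proof.
rewrite -ler_sqr ?nnegrE ?normc_ge0// sqr_normcE real_normK ?num_real//.
by rewrite lerDl sqr_ge0.
Qed.

Lemma le_Im_normc z : `|complex.Im z| <= normc z.
Proof.
rewrite -ler_sqr ?nnegrE ?normc_ge0// sqr_normcE real_normK ?num_real//.
by rewrite lerDr sqr_ge0.
Qed.

Lemma normc_le_ReIm z : normc z <= `|complex.Re z| + `|complex.Im z|.
Proof.
rewrite -ler_sqr ?nnegrE ?normc_ge0 ?addr_ge0// sqr_normcE sqrrD.
rewrite !real_normK ?num_real// -addrA lerD2l lerDr.
by rewrite mulrn_wge0// mulr_ge0.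
Qed.

Lemma ler_normcD z w : normc (z + w) <= normc z + normc w.
Proof. exact: le_normcD. Qed.

Lemma normcN z : normc (- z) = normc z.
Proof. exact: normcN. Qed.

Lemma ler_normcB z w : normc (z - w) <= normc z + normc w.
Proof. by rewrite -(normcN w) ler_normcD. Qed.

Lemma normc_conj z : normc z^* = normc z.
Proof. by case: z => a b /=; rewrite sqrrN. Qed.

Lemma normc_real (x : R) : normc x%:C = `|x|.
Proof. by rewrite /= expr0n addr0 sqrtr_sqr. Qed.

Lemma normc_cis (x : R) : normc (cis x) = 1.
Proof. by rewrite /cis /= cos2Dsin2 sqrtr1. Qed.

Lemma cisD (x y : R) : cis (x + y) = cis x * cis y.
Proof.
by apply: complex_eqP; rewrite ?ReM ?ImM /= (sinD, cosD)// addrC.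
Qed.

Lemma cis0 : cis (0 : R) = 1.
Proof. by rewrite /cis sin0 cos0. Qed.

Lemma conj_cis (x : R) : (cis x)^* = cis (- x).
Proof. by rewrite /cis sinN cosN. Qed.

Lemma normc_sub_sqr z w : normc (z - w) ^+ 2 <= 2 * normc z ^+ 2 + 2 * normc w ^+ 2.
Proof.
rewrite (@le_trans _ _ ((normc z + normc w) ^+ 2))//.
  by rewrite ler_sqr ?nnegrE ?addr_ge0 ?normc_ge0 ?ler_normcB.
by have := sqr_ge0 (normc z - normc w); nra.
Qed.

End complex_algebra.

Section complex_measurability.
Context d {T : measurableType d} {R : realType}.
Implicit Types (x y : T -> R[i]) (D : set T).

(* [cmeasurable] on an arbitrary measurable space: Fubini needs [R * R]. *)
Definition cmeas D x : Prop :=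
  measurable_fun D (fun t => complex.Re (x t)) /\
  measurable_fun D (fun t => complex.Im (x t)).

Lemma cmeas_cst D (c : R[i]) : cmeas D (fun=> c).
Proof. by split; exact: measurable_cst. Qed.

Lemma cmeas_real D (f : T -> R) : measurable_fun D f -> cmeas D (fun t => (f t)%:C).
Proof. by move=> mf; split => //=; exact: measurable_cst. Qed.

Lemma cmeasD D x y : cmeas D x -> cmeas D y -> cmeas D (fun t => x t + y t).
Proof.
move=> [rx ix] [ry iy]; split.
  by under eq_fun do rewrite ReD; exact: measurable_funD.
by under eq_fun do rewrite ImD; exact: measurable_funD.
Qed.

Lemma cmeasN D x : cmeas D x -> cmeas D (fun t => - x t).
Proof.
move=> [rx ix]; split.
  by under eq_fun do rewrite ReN; exact: measurable_funN.
by under eq_fun do rewrite ImN; exact: measurable_funN.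
Qed.

Lemma cmeasB D x y : cmeas D x -> cmeas D y -> cmeas D (fun t => x t - y t).
Proof. by move=> mx my; apply: cmeasD => //; exact: cmeasN. Qed.

Lemma cmeasM D x y : cmeas D x -> cmeas D y -> cmeas D (fun t => x t * y t).
Proof.
move=> [rx ix] [ry iy]; split.
  under eq_fun do rewrite ReM.
  by apply: measurable_funB; exact: measurable_funM.
under eq_fun do rewrite ImM.
by apply: measurable_funD; exact: measurable_funM.
Qed.

Lemma cmeas_sum D n (x : 'I_n -> T -> R[i]) :
  (forall j, cmeas D (x j)) -> cmeas D (fun t => \sum_(j < n) x j t).
Proof.
elim: n x => [|n ih] x mx.
  by under eq_fun do rewrite big_ord0; exact: cmeas_cst.
under eq_fun do rewrite big_ord_recr.
by apply: cmeasD => //; exact: ih.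
Qed.

Lemma cmeas_conj D x : cmeas D x -> cmeas D (fun t => (x t)^*).
Proof.
move=> [rx ix]; split; first by move: rx; congr measurable_fun; apply/funext => t; case: (x t).
have -> : (fun t => complex.Im (x t)^*) = (fun t => - complex.Im (x t)).
  by apply/funext => t; case: (x t).
exact: measurable_funN.
Qed.

Lemma cmeas_cis D (f : T -> R) : measurable_fun D f -> cmeas D (fun t => cis (f t)).
Proof.
move=> mf; split => /=.
  apply: measurableT_comp mf; apply: continuous_measurable_fun.
  exact: continuous_cos.
apply: measurableT_comp mf; apply: continuous_measurable_fun.
exact: continuous_sin.
Qed.

Lemma measurable_normc D x : cmeas D x -> measurable_fun D (fun t => normc (x t)).
Proof.
move=> [rx ix].
have -> : (fun t => normc (x t)) =
    (fun t => Num.sqrt (complex.Re (x t) ^+ 2 + complex.Im (x t) ^+ 2)).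
  by apply/funext => t; case: (x t).
apply: (@measurableT_comp _ _ _ _ _ _ (@Num.sqrt R)).
  by apply: continuous_measurable_fun; exact: sqrt_continuous.
by apply: measurable_funD; exact: measurable_funX.
Qed.

Lemma measurable_sqr_normc D x : cmeas D x ->
  measurable_fun D (fun t => normc (x t) ^+ 2).
Proof. by move=> /measurable_normc; exact: measurable_funX. Qed.

(** Extension by zero reduces integrals over [D] to integrals over the whole line, for which the
    calculus below is stated. *)
Definition cres D x : T -> R[i] := fun t => if t \in D then x t else 0.

Lemma Re_cres D x : (fun t => complex.Re (cres D x t)) =
  (fun t => complex.Re (x t)) \_ D.
Proof. by apply/funext => t; rewrite /cres patchE; case: ifP. Qed.

Lemma Im_cres D x : (fun t => complex.Im (cres D x t)) =
  (fun t => complex.Im (x t)) \_ D.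
Proof. by apply/funext => t; rewrite /cres patchE; case: ifP. Qed.

Lemma normc_cres D x : (fun t => normc (cres D x t)) =
  (fun t => normc (x t)) \_ D.
Proof.
by apply/funext => t; rewrite /cres patchE; case: ifP => // _; rewrite normc0.
Qed.

Lemma cmeas_cresP D x : measurable D -> cmeas D x <-> cmeas setT (cres D x).
Proof.
move=> mD; rewrite /cmeas Re_cres Im_cres.
by split=> -[? ?]; split; exact/(measurable_restrictT _ mD).
Qed.

End complex_measurability.

Section complex_integral.
Context {R : realType}.
Local Notation mu := (@lebesgue_measure R).
Implicit Types (x y : R -> R[i]) (D : set R) (g : R -> R).

Lemma ae_impl (P Q : R -> Prop) : (forall t, P t -> Q t) ->
  {ae mu, forall t, P t} -> {ae mu, forall t, Q t}.
Proof. by move=> PQ; apply: filterS; first exact: (ae_filter_ringOfSetsType mu). Qed.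

Lemma ae_impl2 (P Q S : R -> Prop) : (forall t, P t -> Q t -> S t) ->
  {ae mu, forall t, P t} -> {ae mu, forall t, Q t} -> {ae mu, forall t, S t}.
Proof.
by move=> PQ; apply: filterS2 => //; exact: (ae_filter_ringOfSetsType mu).
Qed.

Lemma ae_all (P : R -> Prop) : (forall t, P t) -> {ae mu, forall t, P t}.
Proof. by move=> PT; apply: nearW => //; exact: (ae_filter_ringOfSetsType mu). Qed.

Definition cintegrable x : Prop :=
  cmeas setT x /\ mu.-integrable setT (EFin \o (fun t => normc (x t))).

Lemma integrable_dom (f : R -> R) g : measurable_fun setT f ->
  mu.-integrable setT (EFin \o g) -> {ae mu, forall t, `|f t| <= g t} ->
  mu.-integrable setT (EFin \o f).
Proof.
move=> mf /integrableP[mg ig] fg; apply/integrableP; split.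
  exact/measurable_EFinP.
apply: le_lt_trans ig; apply: ae_ge0_le_integral => //.
- by apply: measurableT_comp => //; exact/measurable_EFinP.
- exact: measurableT_comp.
by apply: ae_impl fg => t /= fg _; rewrite lee_fin (le_trans fg)// ler_norm.
Qed.

Lemma integrable_add (f g : R -> R) : mu.-integrable setT (EFin \o f) ->
  mu.-integrable setT (EFin \o g) ->
  mu.-integrable setT (EFin \o (fun t => f t + g t)).
Proof.
move=> mf mg; have := integrableD measurableT mf mg.
by apply: eq_integrable.
Qed.

Lemma integrable_scale (k : R) (f : R -> R) : mu.-integrable setT (EFin \o f) ->
  mu.-integrable setT (EFin \o (fun t => k * f t)).
Proof.
by move=> mf; have := integrableZl measurableT k mf; apply: eq_integrable.
Qed.

Lemma cintegrable_dom x g : cmeas setT x -> mu.-integrable setT (EFin \o g) ->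
  {ae mu, forall t, normc (x t) <= g t} -> cintegrable x.
Proof.
move=> mx ig xg; split=> //; apply: (integrable_dom _ ig).
  exact: measurable_normc.
by apply: ae_impl xg => t; rewrite ger0_norm ?normc_ge0.
Qed.

Lemma cintegrable_Re x : cintegrable x ->
  mu.-integrable setT (EFin \o (fun t => complex.Re (x t))).
Proof.
move=> [[mr mi] ix]; apply: (integrable_dom mr ix).
by apply: ae_all => t; exact: le_Re_normc.
Qed.

Lemma cintegrable_Im x : cintegrable x ->
  mu.-integrable setT (EFin \o (fun t => complex.Im (x t))).
Proof.
move=> [[mr mi] ix]; apply: (integrable_dom mi ix).
by apply: ae_all => t; exact: le_Im_normc.
Qed.

Lemma cintegrableD x y : cintegrable x -> cintegrable y ->
  cintegrable (fun t => x t + y t).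
Proof.
move=> [mx ix] [my iy]; apply: (cintegrable_dom _ (integrable_add ix iy)).
  exact: cmeasD.
by apply: ae_all => t; exact: ler_normcD.
Qed.

Lemma cintegrableZ (c : R[i]) x : cintegrable x ->
  cintegrable (fun t => c * x t).
Proof.
move=> [mx ix]; apply: (cintegrable_dom _ (integrable_scale (normc c) ix)).
  by apply: cmeasM => //; exact: cmeas_cst.
by apply: ae_all => t; rewrite normcM.
Qed.

Lemma cintegrableM_bounded (M : R) x y : cintegrable x -> cmeas setT y ->
  {ae mu, forall t, normc (y t) <= M} -> cintegrable (fun t => x t * y t).
Proof.
move=> [mx ix] my yM; apply: (cintegrable_dom _ (integrable_scale M ix)).
  exact: cmeasM.
apply: ae_impl yM => t yM.
by rewrite normcM mulrC ler_wpM2r ?normc_ge0.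
Qed.

Lemma cintegralD x y : cintegrable x -> cintegrable y ->
  cintegral setT (fun t => x t + y t) = cintegral setT x + cintegral setT y.
Proof.
move=> ix iy; apply: complex_eqP; rewrite /cintegral /=.
  under eq_Rintegral do rewrite ReD.
  by rewrite RintegralD//; exact: cintegrable_Re.
under eq_Rintegral do rewrite ImD.
by rewrite RintegralD//; exact: cintegrable_Im.
Qed.

Lemma cintegralZ (c : R[i]) x : cintegrable x ->
  cintegral setT (fun t => c * x t) = c * cintegral setT x.
Proof.
move=> ix; have rx := cintegrable_Re ix; have jx := cintegrable_Im ix.
apply: complex_eqP; rewrite ?ReM ?ImM /cintegral /=.
  under eq_Rintegral do rewrite ReM.
  by rewrite RintegralB ?RintegralZl//; exact: integrable_scale.
under eq_Rintegral do rewrite ImM.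
by rewrite RintegralD ?RintegralZl//; exact: integrable_scale.
Qed.

Lemma cintegralB x y : cintegrable x -> cintegrable y ->
  cintegral setT (fun t => x t - y t) = cintegral setT x - cintegral setT y.
Proof.
move=> ix iy; under [in LHS]eq_fun do rewrite -mulN1r.
by rewrite cintegralD ?cintegralZ ?mulN1r//; exact: cintegrableZ.
Qed.

Lemma cintegral_sum n (x : 'I_n -> R -> R[i]) : (forall j, cintegrable (x j)) ->
  cintegrable (fun t => \sum_(j < n) x j t) /\
  cintegral setT (fun t => \sum_(j < n) x j t) = \sum_(j < n) cintegral setT (x j).
Proof.
elim: n x => [|n ih] x ix.
  under eq_fun do rewrite big_ord0.
  rewrite big_ord0; split.
    apply: (@cintegrable_dom _ (cst 0)); first exact: cmeas_cst.
      exact: integrable0.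
    by apply: ae_all => t; rewrite normc0.
  by rewrite /cintegral /Rintegral /= integral0.
under eq_fun do rewrite big_ord_recr.
have [|ihi ihe] := ih (fun j => x (widen_ord (leqnSn n) j)); first by move=> j.
by split; [exact: cintegrableD|rewrite cintegralD// ihe big_ord_recr].
Qed.

(* The factor 2 comes from bounding the real and imaginary parts separately. *)
Lemma normc_cintegral_le x : cintegrable x ->
  normc (cintegral setT x) <= 2 * \int[mu]_t normc (x t).
Proof.
move=> ix; apply: (le_trans (normc_le_ReIm _)); rewrite /cintegral /=.
rewrite mulr_natl mulr2n lerD//.
  apply: (le_trans (le_normr_Rintegral measurableT (cintegrable_Re ix))).
  apply: le_Rintegral => //; last by move=> t _; exact: le_Re_normc.
    exact/integrable_norm/cintegrable_Re.
  by case: ix.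
apply: (le_trans (le_normr_Rintegral measurableT (cintegrable_Im ix))).
apply: le_Rintegral => //; last by move=> t _; exact: le_Im_normc.
  exact/integrable_norm/cintegrable_Im.
by case: ix.
Qed.

Lemma cintegral_ae x y : cmeas setT x -> cmeas setT y ->
  {ae mu, forall t, x t = y t} -> cintegral setT x = cintegral setT y.
Proof.
move=> [rx jx] [ry jy] xy; rewrite /cintegral /Rintegral.
congr (fine _ +i* fine _); apply: ae_eq_integral => //=.
- exact/measurable_EFinP.
- exact/measurable_EFinP.
- by apply: ae_impl xy => t /= ->.
- exact/measurable_EFinP.
- exact/measurable_EFinP.
- by apply: ae_impl xy => t /= ->.
Qed.

Lemma cintegrable_ae x y : cintegrable x -> cmeas setT y ->
  {ae mu, forall t, x t = y t} -> cintegrable y.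
Proof.
move=> [mx ix] my xy; apply: (cintegrable_dom my ix).
by apply: ae_impl xy => t ->.
Qed.

Lemma cintegral_mkcond D x : cintegral D x = cintegral setT (cres D x).
Proof.
by rewrite /cintegral Rintegral_mkcond [in RHS]Re_cres [X in _ +i* X]Rintegral_mkcond [in RHS]Im_cres.
Qed.

Lemma inL1E D x : measurable D -> inL1 D x <-> cintegrable (cres D x).
Proof.
move=> mD; rewrite /inL1 /cintegrable; split => [[mx ix]|[/(cmeas_cresP _ mD) mx ix]].
  split; first exact/(cmeas_cresP _ mD).
  rewrite normc_cres -restrict_EFin.
  have /integrable_mkcond : mu.-integrable D (EFin \o (fun t => normc (x t))).
    apply/integrableP; split; first exact/measurable_EFinP/measurable_normc.
    by under eq_integral do rewrite /= ger0_norm ?normc_ge0//.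
  exact.
split => //; move: ix; rewrite normc_cres -restrict_EFin.
move=> ix; have : mu.-integrable D (EFin \o (fun t => normc (x t))).
  by rewrite integrable_mkcond.
move=> /integrableP[_].
by under eq_integral do rewrite /= ger0_norm ?normc_ge0//.
Qed.

(** Convergence in [R[i]] is expressed by [normc] of the difference, so that only limits of real
    sequences occur. The bound [g] passes to the limit, hence [2 * g] dominates the differences. *)
Lemma cdominated (x_ : nat -> R -> R[i]) x g :
  (forall n, cmeas setT (x_ n)) -> cmeas setT x ->
  {ae mu, forall t, normc (x_ n t - x t) @[n --> \oo] --> 0} ->
  mu.-integrable setT (EFin \o g) ->
  {ae mu, forall t n, normc (x_ n t) <= g t} ->
  cintegrable x /\
  normc (cintegral setT (x_ n) - cintegral setT x) @[n --> \oo] --> 0.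
Proof.
move=> mx_ mx x_x ig x_g.
have xg : {ae mu, forall t, normc (x t) <= g t}.
  move: x_x x_g; apply: ae_impl2 => t x_x x_g.
  apply/ler_addgt0Pr => e e0.
  have /cvgrPdist_lt/(_ e e0)[N _ /(_ N (leqnn N))] := x_x.
  rewrite sub0r normrN ger0_norm ?normc_ge0// => xNx.
  rewrite (_ : x t = x_ N t - (x_ N t - x t)); last by rewrite opprB addrCA subrr addr0.
  by rewrite (le_trans (ler_normcB _ _))// lerD// ltW.
have ix : cintegrable x by exact: cintegrable_dom xg.
have ix_ n : cintegrable (x_ n).
  by apply: (cintegrable_dom _ ig) => //; apply: ae_impl x_g.
split=> //.
have := @dominated_convergence _ _ R mu setT measurableT
  (fun n => EFin \o (fun t => normc (x_ n t - x t))) (cst 0%E)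
  (EFin \o (fun t => 2 * g t)).
case.
- move=> n; apply/measurable_EFinP; apply: measurable_normc.
  exact: (cmeasB (mx_ n) mx).
- exact: measurable_cst.
- by apply: ae_impl x_x => t xt _; apply/fine_cvgP; split => //; exact: nearW.
- exact: integrable_scale.
- move: x_g xg; apply: ae_impl2 => t x_g xg n _ /=.
  rewrite lee_fin ger0_norm ?normc_ge0// (le_trans (ler_normcB _ _))//.
  by rewrite mulr_natl mulr2n lerD.
move=> _ _; rewrite integral0 => /fine_cvgP[_ cv].
apply: (@squeeze_cvgr _ _ _ _ (fun=> 0) (fun n => 2 * \int[mu]_t normc (x_ n t - x t))).
- apply: nearW => n; rewrite normc_ge0 andTb -cintegralB//.
  apply: normc_cintegral_le; rewrite (_ : (fun t => _) = (fun t => x_ n t + (-1) * x t)).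
    by apply: cintegrableD => //; exact: cintegrableZ.
  by apply/funext => t; rewrite mulN1r.
- exact: cvg_cst.
by rewrite -(mulr0 2); apply: cvgM => //; exact: cvg_cst.
Qed.

End complex_integral.

(** * Fubini's theorem for real and complex integrands *)

Section fubini.
Context d1 d2 (T1 : measurableType d1) (T2 : measurableType d2) {R : realType}.
Variables (m1 : {sigma_finite_measure set T1 -> \bar R})
  (m2 : {sigma_finite_measure set T2 -> \bar R}).

(** Tonelli gives measurability for the positive and the negative part separately; applying the
    measurable map [fine] to their difference also covers parameters with an infinite integral. *)
Lemma measurable_Rintegral_param (f : T1 * T2 -> R) : measurable_fun setT f ->
  measurable_fun setT (fun v => \int[m2]_t f (v, t)).
Proof.
move=> mf; have mF : measurable_fun setT (EFin \o f) by exact/measurable_EFinP.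
have -> : (fun v => \int[m2]_t f (v, t)) = fine \o
    (fubini_F m2 (EFin \o f)^\+%E \- fubini_F m2 (EFin \o f)^\-%E)%E.
  apply/funext => v; rewrite /= /Rintegral; congr fine.
  transitivity (\int[m2]_t ((EFin \o f) \o pair v) t)%E; first by [].
  by rewrite integralE funepos_comp funeneg_comp.
apply: (@measurableT_comp _ _ _ _ _ _ fine) => //; apply: emeasurable_funB.
  exact: (measurable_fun_fubini_tonelli_F _ (measurable_funepos mF)).
exact: (measurable_fun_fubini_tonelli_F _ (measurable_funeneg mF)).
Qed.

(** The product bound makes [f] integrable on the product and every section integrable. The latter
    lets [fine] be removed from all inner integrals, not merely from almost all of them. *)
Lemma Rfubini (f : T1 * T2 -> R) (s : T1 -> R) (r : T2 -> R) : measurable_fun setT f ->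
  m1.-integrable setT (EFin \o s) -> m2.-integrable setT (EFin \o r) ->
  (forall v t, `|f (v, t)| <= s v * r t) ->
  \int[m1]_v \int[m2]_t f (v, t) = \int[m2]_t \int[m1]_v f (v, t).
Proof.
move=> mf is_ ir fsr.
have Zl d (T : measurableType d) (mu : {measure set T -> \bar R}) (k : R)
    (h : T -> R) : mu.-integrable setT (EFin \o h) ->
    mu.-integrable setT (EFin \o (fun t => k * h t)).
  by move=> /(integrableZl measurableT k); exact: eq_integrable.
have ifv v : m2.-integrable setT (fun t => (f (v, t))%:E).
  apply: (le_integrable measurableT _ _ (Zl _ _ _ (s v) _ ir)).
    exact/measurable_EFinP/(measurableT_comp mf (measurable_pair1 v)).
  by move=> t _; rewrite /= lee_fin (le_trans (fsr v t))// ler_norm.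
have ift t : m1.-integrable setT (fun v => (f (v, t))%:E).
  apply: (le_integrable measurableT _ _ (Zl _ _ _ (r t) _ is_)).
    exact/measurable_EFinP/(measurableT_comp mf (measurable_pair2 t)).
  by move=> v _; rewrite /= lee_fin (le_trans (fsr v t))// mulrC ler_norm.
have iF : (m1 \x m2)%E.-integrable setT (EFin \o f).
  apply/integrable12ltyP; first exact/measurable_EFinP.
  apply: (@le_lt_trans _ _ (\int[m1]_v (`|s v| * \int[m2]_t `|r t|)%R%:E)%E).
    apply: ge0_le_integral => //.
    - by move=> v _; exact: integral_ge0.
    - apply: (measurable_fun_fubini_tonelli_F (m2 := m2) (abse \o (EFin \o f))).
        by apply: measurableT_comp => //; exact/measurable_EFinP.
      by move=> p; exact: abse_ge0.
    - apply/measurable_EFinP; apply: measurable_funM => //.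
      apply: measurableT_comp => //; apply/measurable_EFinP.
      exact: (measurable_int m1 is_).
    - move=> v _; rewrite EFinM fineK; last first.
        by apply: integrable_fin_num => //; exact: integrable_norm.
      rewrite -ge0_integralZl//; last first.
      + apply/measurable_EFinP; apply: measurableT_comp => //.
        by apply/measurable_EFinP; exact: (measurable_int m2 ir).
      apply: ge0_le_integral => //.
      + apply: measurableT_comp => //; exact: (measurable_int m2 (ifv v)).
      + apply: emeasurable_funM => //; apply/measurable_EFinP.
        apply: measurableT_comp => //.
        by apply/measurable_EFinP; exact: (measurable_int m2 ir).
      + move=> t _ /=; rewrite lee_fin (le_trans (fsr v t))//.
        by rewrite -normrM ler_norm.
  have : m1.-integrable setT (EFin \o (fun v => (\int[m2]_t `|r t|) * `|s v|)).
    by apply: Zl; exact: integrable_norm.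
  move=> /(integrable_lty measurableT); under eq_integral do rewrite /= mulrC.
  exact.
rewrite /Rintegral; congr fine.
transitivity (\int[m1]_v \int[m2]_t (EFin \o f) (v, t))%E.
  by apply: eq_integral => v _; rewrite fineK//; exact: integrable_fin_num (ifv v).
rewrite (Fubini iF); apply: eq_integral => t _; rewrite fineK//.
exact: integrable_fin_num (ift t).
Qed.

End fubini.

Section complex_fubini.
Context {R : realType}.
Local Notation mu := (@lebesgue_measure R).

Lemma cmeas_cintegral_param (F : R * R -> R[i]) : cmeas setT F ->
  cmeas setT (fun v => cintegral setT (fun t => F (v, t))).
Proof.
move=> [rF jF]; split => /=.
  apply: (@measurable_Rintegral_param _ _ _ _ R mu (fun p => complex.Re (F p))).
  exact: rF.
apply: (@measurable_Rintegral_param _ _ _ _ R mu (fun p => complex.Im (F p))).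
exact: jF.
Qed.

(** The form fits the applications, where [k] is either an exponential of modulus one or a Poisson
    kernel rescaled to be bounded. *)
Lemma cFubini (rho sig : R -> R[i]) (k : R * R -> R[i]) (M : R) :
  cintegrable rho -> cintegrable sig -> cmeas setT k ->
  (forall v t, normc (k (v, t)) <= M) ->
  cintegral setT (fun v => sig v * cintegral setT (fun t => rho t * k (v, t))) =
  cintegral setT (fun t => rho t * cintegral setT (fun v => sig v * k (v, t))).
Proof.
move=> irho isig mk kM.
have kv v : cmeas setT (fun t => k (v, t)).
  by case: mk => rk jk; split; [exact: (measurableT_comp rk (measurable_pair1 v))|
    exact: (measurableT_comp jk (measurable_pair1 v))].
have kt t : cmeas setT (fun v => k (v, t)).
  by case: mk => rk jk; split; [exact: (measurableT_comp rk (measurable_pair2 t))|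
    exact: (measurableT_comp jk (measurable_pair2 t))].
pose F p := sig p.1 * (rho p.2 * k p).
have mF : cmeas setT F.
  case: irho => -[rr jr] _; case: isig => -[rs js] _.
  apply: cmeasM; last apply: cmeasM => //.
    by split; [exact: (measurableT_comp rs measurable_fst)|
      exact: (measurableT_comp js measurable_fst)].
  by split; [exact: (measurableT_comp rr measurable_snd)|
    exact: (measurableT_comp jr measurable_snd)].
have FM v t : normc (F (v, t)) <= normc (sig v) * (M * normc (rho t)).
  rewrite /F !normcM /= [M * _]mulrC.
  by rewrite ler_wpM2l ?normc_ge0// ler_wpM2l ?normc_ge0.
have E1 v : sig v * cintegral setT (fun t => rho t * k (v, t)) =
    cintegral setT (fun t => F (v, t)).
  by rewrite -cintegralZ//; apply: (cintegrableM_bounded irho (kv v)); exact: ae_all.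
have E2 t : rho t * cintegral setT (fun v => sig v * k (v, t)) =
    cintegral setT (fun v => F (v, t)).
  rewrite -cintegralZ; first by congr cintegral; apply/funext => v; rewrite /F mulrCA.
  by apply: (cintegrableM_bounded isig (kt t)); exact: ae_all.
under eq_fun do rewrite E1; under [in RHS]eq_fun do rewrite E2.
have [rF jF] := mF.
have fub (f : R * R -> R) : measurable_fun setT f -> (forall p, `|f p| <= normc (F p)) ->
    \int[mu]_v \int[mu]_t f (v, t) = \int[mu]_t \int[mu]_v f (v, t).
  move=> mf fF; apply: (@Rfubini _ _ _ _ R mu mu f
    (fun v => normc (sig v)) (fun t => M * normc (rho t)) mf).
  - by case: isig.
  - by apply: integrable_scale; case: irho.
  - by move=> v t; rewrite (le_trans (fF _))// FM.
have rE := fub _ rF (fun p => le_Re_normc _).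
have jE := fub _ jF (fun p => le_Im_normc _).
apply: complex_eqP; [exact: rE|exact: jE].
Qed.

End complex_fubini.

(** * Fourier inversion with damping *)

Section poisson.
Context {R : realType}.
Local Notation mu := (@lebesgue_measure R).

(** This is 2 pi times the Poisson kernel of the half-plane, that is, the Fourier transform of
    e^{-e|l|}. *)
Definition pkernel (e z : R) : R := 2 * e / (e ^+ 2 + z ^+ 2).

Definition expabs (e l : R) : R := expR (- (e * `|l|)).

Lemma continuous_expabs e : continuous (expabs e).
Proof.
move=> x; apply: (@continuous_comp _ _ _ (fun l => - (e * `|l|)) expR).
  apply: continuousN; apply: continuousM; first exact: cvg_cst.
  exact: norm_continuous.
exact: continuous_expR.
Qed.

Lemma continuous_scale (z : R) : continuous (fun l => z * l).
Proof. by move=> x; apply: continuousM; [exact: cvg_cst|exact: cvg_id]. Qed.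

Lemma continuous_cosM (z : R) : continuous (fun l => cos (z * l)).
Proof.
move=> x; apply: (@continuous_comp _ _ _ (fun l => z * l) cos).
  exact: continuous_scale.
exact: continuous_cos.
Qed.

Lemma cvg_expRN (e : R) : 0 < e -> expR (- (e * x)) @[x --> +oo] --> 0.
Proof.
move=> e0; apply: (@cvg_comp _ _ _ (fun x => e * x) (fun x => expR (- x)) _ (+oo)).
  exact: gt0_cvgMry.
exact: cvgr_expR.
Qed.

(* Adding 1 to the cosine keeps the integrand nonnegative, as the fundamental
   theorem of calculus on a half-line requires. *)
Lemma integral_exp_1Dcos (e z : R) : 0 < e ->
  (\int[mu]_l (expabs e l * (1 + cos (z * l)))%:E = (2 / e + pkernel e z)%:E)%E.
Proof.
move=> e0; have ez0 : 0 < e ^+ 2 + z ^+ 2 by rewrite ltr_pwDl ?exprn_gt0 ?sqr_ge0.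
have f0 l : 0 <= expabs e l * (1 + cos (z * l)).
  by rewrite mulr_ge0 ?expR_ge0// -lerBlDl sub0r cos_geN1.
have cf : continuous (fun l => expabs e l * (1 + cos (z * l))).
  move=> x; apply: continuousM; first exact: continuous_expabs.
  by apply: continuousD; [exact: cvg_cst|exact: continuous_cosM].
rewrite ge0_symfun_integralT//; last first.
  by move=> l; rewrite /= /expabs normrN mulrN cosN.
(* The antiderivative of e^{-el} (1 + cos(zl)): the second summand is the real part of the
   antiderivative of e^{(-e + iz)l}. *)
pose F (l : R) := expR (- (e * l)) *
  (- e^-1 + (z * sin (z * l) - e * cos (z * l)) / (e ^+ 2 + z ^+ 2)).
pose f (l : R) := expR (- (e * l)) * (1 + cos (z * l)).
have dz (c x : R) : is_derive x (1 : R) (fun l => c * l) c.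
  by apply: is_derive_eq; rewrite /GRing.scale /= mulr1.
have de (x : R) : is_derive x (1 : R) (fun l => expR (- (e * l))) (- e * expR (- (e * x))).
  under eq_fun do rewrite -mulNr.
  rewrite -mulNr mulrC.
  exact: (@is_derive1_comp _ expR (fun l => - e * l) x (expR (- e * x)) (- e)).
have ds (x : R) : is_derive x (1 : R) (fun l => sin (z * l)) (z * cos (z * x)).
  rewrite mulrC.
  exact: (@is_derive1_comp _ sin (fun l => z * l) x (cos (z * x)) z).
have dc (x : R) : is_derive x (1 : R) (fun l => cos (z * l)) (z * (- sin (z * x))).
  rewrite mulrC.
  exact: (@is_derive1_comp _ cos (fun l => z * l) x (- sin (z * x)) z).
have dF (x : R) : is_derive x (1 : R) F (f x).
  rewrite /F /f; apply: is_derive_eq.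
  rewrite /GRing.scale /=.
  by field; rewrite !gt_eqF.
have -> : [set x : R | 0 <= x] = `[0, +oo[%classic.
  by apply/seteqP; split => x /=; rewrite in_itv/= andbT.
have -> : (\int[mu]_(x in `[0%R, +oo[) (expabs e x * (1 + cos (z * x)))%:E =
    \int[mu]_(x in `[0%R, +oo[) (f x)%:E)%E.
  apply: eq_integral => x.
  by rewrite inE/= in_itv/= andbT => x0; rewrite /f /expabs ger0_norm.
have cfF (x : R) : {for x, continuous f}.
  have -> : f = (fun l => expR (- (e * l)) * (1 + cos (z * l))) by [].
  apply: continuousM; last by apply: continuousD; [exact: cvg_cst|exact: continuous_cosM].
  apply: (@continuous_comp _ _ _ (fun l => - (e * l)) expR); last exact: continuous_expR.
  by apply: continuousN; exact: continuous_scale.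
have cF (x : R) : {for x, continuous F}.
  by apply: differentiable_continuous; apply/derivable1_diffP; case: (dF x).
rewrite (@ge0_continuous_FTC2y _ f F 0 0).
- rewrite -EFinB -EFinM; congr EFin.
  rewrite /F /pkernel !mulr0 oppr0 expR0 sin0 cos0; field; by rewrite !gt_eqF.
- by move=> x x0; have := f0 x; rewrite /expabs /f ger0_norm.
- by apply/continuous_within_itvcyP; split => [x x0|]; [exact: cfF|
    apply: cvg_at_right_filter; exact: cfF].
- have : (fun x => (e^-1 + (`|z| + e) / (e ^+ 2 + z ^+ 2)) * expR (- (e * x))) x @[x --> +oo] --> 0.
    by rewrite -(mulr0 (e^-1 + (`|z| + e) / (e ^+ 2 + z ^+ 2))); apply: cvgM; [exact: cvg_cst|exact: cvg_expRN].
  move=> cv; apply/norm_cvg0P.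
  apply: (squeeze_cvgr _ (@cvg_cst _ _ _ _ _) cv).
  apply: nearW => x; rewrite normr_ge0/= normrM ger0_norm ?expR_ge0// mulrC.
  rewrite ler_wpM2r ?expR_ge0// (le_trans (ler_normD _ _))//.
  rewrite normrN ger0_norm ?invr_ge0 ?(ltW e0)// lerD2l normrM.
  rewrite [X in _ * X <= _]ger0_norm ?invr_ge0 ?(ltW ez0)//.
  rewrite ler_wpM2r ?invr_ge0 ?(ltW ez0)// (le_trans (ler_normB _ _))//.
  rewrite !normrM [`|e|]ger0_norm ?(ltW e0)// lerD//.
    by rewrite ler_piMr// ler_norml sin_geN1 sin_le1.
  by rewrite ler_piMr ?(ltW e0)// ler_norml cos_geN1 cos_le1.
- by move=> x _; case: (dF x).
- by apply: cvg_at_right_filter; exact: cF.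
- by move=> x _; rewrite derive1E; case: (dF x).
Qed.

Lemma measurable_expabs e : measurable_fun setT (expabs e).
Proof. by apply: continuous_measurable_fun; exact: continuous_expabs. Qed.

(** The case z = 0 of the preceding integral, where 1 + cos is the constant 2. *)
Lemma integrable_expabs e : 0 < e -> mu.-integrable setT (EFin \o expabs e).
Proof.
move=> e0; have E : (fun l => expabs e l * (1 + cos (0 * l))) =
    (fun l => 2 * expabs e l).
  by apply/funext => l; rewrite mul0r cos0 mulrC.
have /(integrable_scale 2^-1) : mu.-integrable setT (EFin \o (fun l => 2 * expabs e l)).
  apply/integrableP; split.
    apply/measurable_EFinP; apply: measurable_funM; first exact: measurable_cst.
    exact: measurable_expabs.
  under eq_integral do rewrite /= ger0_norm ?mulr_ge0 ?expR_ge0//.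
  have := integral_exp_1Dcos 0 e0.
  rewrite -[X in X = _ -> _]/(\int[mu]_l (EFin \o (fun l => expabs e l * (1 + cos (0 * l)))%R) l)%E.
  by rewrite E => ->; rewrite ltry.
by apply: eq_integrable => // l _ /=; rewrite mulKf.
Qed.

Lemma integral_ge0_reflect (f : R -> R) : measurable_fun setT f ->
  (forall x, 0 <= f x) -> (\int[mu]_x (f (- x))%:E = \int[mu]_x (f x)%:E)%E.
Proof.
move=> mf f0.
rewrite -[RHS](_ : \int[pushforward mu (-%R : R -> measurableTypeR R)]_x (f x)%:E = _)%E; last first.
  by apply: eq_measure_integral => //= A mA AS; exact: lebesgue_measureN.
rewrite ge0_integral_pushforward//.
  exact/measurable_EFinP.
by move=> y _; rewrite lee_fin.
Qed.

Lemma exp_fourier e z : 0 < e ->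
  cintegral setT (fun l => (expabs e l)%:C * cis (z * l)) = (pkernel e z)%:C.
Proof.
move=> e0; have ie := integrable_expabs e0.
have mc : measurable_fun setT (fun l : R => cos (z * l)).
  by apply: continuous_measurable_fun; exact: continuous_cosM.
have ms : measurable_fun setT (fun l : R => sin (z * l)).
  apply: continuous_measurable_fun => x.
  apply: (@continuous_comp _ _ _ (fun l => z * l) sin).
    exact: continuous_scale.
  exact: continuous_sin.
have ib (h : R -> R) : measurable_fun setT h -> (forall x, `|h x| <= 1) ->
    mu.-integrable setT (EFin \o (fun l => expabs e l * h l)).
  move=> mh h1; apply: (integrable_dom _ ie).
    by apply: measurable_funM => //; exact: measurable_expabs.
  by apply: ae_all => l; rewrite normrM ger0_norm ?expR_ge0// ler_piMr ?expR_ge0.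
have ic : mu.-integrable setT (EFin \o (fun l => expabs e l * cos (z * l))).
  by apply: ib => // x; rewrite ler_norml cos_geN1 cos_le1.
have is_ : mu.-integrable setT (EFin \o (fun l => expabs e l * sin (z * l))).
  by apply: ib => // x; rewrite ler_norml sin_geN1 sin_le1.
have Ee : \int[mu]_l expabs e l = 2 / e.
  have /(congr1 fine) := integral_exp_1Dcos 0 e0.
  under eq_integral do rewrite mul0r cos0 mulrC.
  rewrite -[LHS]/(\int[mu]_l ((1 + 1) * expabs e l)) RintegralZl//= /pkernel => H.
  suff : (1 + 1) * \int[mu]_l expabs e l = (1 + 1) * (2 / e).
    by apply: mulfI; lra.
  by rewrite H expr0n /= addr0; field; rewrite gt_eqF.
apply: complex_eqP; rewrite /cintegral /=.
  under eq_Rintegral do rewrite mul0r subr0.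
  have /(congr1 fine) := integral_exp_1Dcos z e0.
  rewrite -[LHS]/(\int[mu]_l (expabs e l * (1 + cos (z * l)))).
  under eq_Rintegral do rewrite mulrDr mulr1.
  by rewrite RintegralD// Ee /= => /addrI.
under eq_Rintegral do rewrite mul0r addr0.
(* The sine part is odd. Adding 1 makes the integrand nonnegative, so that the reflection lemma
   applies; comparing 1 + sin with 1 - sin then forces the sine integral to vanish. *)
have mf : measurable_fun setT (fun l => expabs e l * (1 + sin (z * l))).
  apply: measurable_funM; first exact: measurable_expabs.
  by apply: measurable_funD => //; exact: measurable_cst.
have f0 l : 0 <= expabs e l * (1 + sin (z * l)).
  by rewrite mulr_ge0 ?expR_ge0// -lerBlDl sub0r sin_geN1.
have aux (a b : R) : a - b = a + b -> b = 0 by move=> H; lra.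
have /(congr1 fine) := integral_ge0_reflect mf f0.
rewrite -[LHS]/(\int[mu]_l (expabs e (- l) * (1 + sin (z * - l)))).
rewrite -[RHS]/(\int[mu]_l (expabs e l * (1 + sin (z * l)))).
under eq_Rintegral do rewrite /expabs normrN mulrN sinN mulrDr mulr1 mulrN.
under [in X in _ = X]eq_Rintegral do rewrite mulrDr mulr1.
by rewrite RintegralB// RintegralD//= => /aux.
Qed.

Lemma pkernel_ge0 (e z : R) : 0 < e -> 0 <= pkernel e z.
Proof.
by move=> e0; rewrite /pkernel divr_ge0 ?addr_ge0 ?sqr_ge0 ?mulr_ge0// ltW.
Qed.

Lemma pkernelN (e z : R) : pkernel e (- z) = pkernel e z.
Proof. by rewrite /pkernel sqrrN. Qed.

Lemma pkernel_le (e z : R) : 0 < e -> pkernel e z <= 2 / e.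
Proof.
move=> e0; rewrite /pkernel ler_pdivrMr; last by rewrite ltr_pwDl ?exprn_gt0 ?sqr_ge0.
have -> : 2 / e * (e ^+ 2 + z ^+ 2) = 2 * e + 2 / e * z ^+ 2.
  by field; rewrite gt_eqF.
by rewrite lerDl mulr_ge0 ?sqr_ge0 ?divr_ge0 ?(ltW e0).
Qed.

Lemma continuous_pkernel (e t : R) : 0 < e -> continuous (fun u => pkernel e (u - t)).
Proof.
move=> e0 x.
have c2 : {for x, continuous (fun u : R => u - t)}.
  by apply: continuousB; [exact: cvg_id|exact: cvg_cst].
have c3 : {for x, continuous (fun u : R => e ^+ 2 + (u - t) ^+ 2)}.
  by apply: continuousD; [exact: cvg_cst|exact: (continuousM c2 c2)].
have c4 : {for x, continuous (fun u : R => (e ^+ 2 + (u - t) ^+ 2)^-1)}.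
  by apply: (continuousV _ c3); rewrite gt_eqF// ltr_pwDl ?exprn_gt0 ?sqr_ge0.
have c5 : {for x, continuous (fun=> 2 * e : R)} by exact: cvg_cst.
exact: (continuousM c5 c4).
Qed.

Lemma measurable_pkernel (e t : R) : 0 < e ->
  measurable_fun setT (fun u : R => pkernel e (u - t)).
Proof. by move=> e0; apply: continuous_measurable_fun; exact: continuous_pkernel. Qed.

Lemma integrable_oneDsqr : mu.-integrable setT (EFin \o (fun z : R => (oneDsqr z)^-1)).
Proof.
have cf : continuous (fun z : R => (oneDsqr z)^-1) by move=> x; exact: continuous_oneDsqrV.
apply/integrableP; split.
  by apply/measurable_EFinP; apply: continuous_measurable_fun.
under eq_integral do rewrite /= ger0_norm ?invr_ge0//.
rewrite ge0_symfun_integralT//.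
  have -> : [set x : R | 0 <= x] = `[0, +oo[%classic.
    by apply/seteqP; split => x /=; rewrite in_itv/= andbT.
  by rewrite integral0y_oneDsqr -EFinM ltry.
by move=> x; rewrite /= /oneDsqr sqrrN.
Qed.

(** With y = u - t, the factor 1 + e^-2 comes from 1 + y^2 <= (1 + e^-2) (e^2 + y^2), and 2 (1 +
    t^2) from Peetre's inequality 1 + u^2 <= 2 (1 + t^2) (1 + y^2). *)
Lemma pkernel_le_oneDsqr (e t u : R) : 0 < e ->
  pkernel e (u - t) <= 2 * e * (1 + e ^- 2) * (2 * (1 + t ^+ 2)) * (oneDsqr u)^-1.
Proof.
move=> e0; set C := 2 * _ * _ * _.
have P0 : 0 < e ^+ 2 + (u - t) ^+ 2 by rewrite ltr_pwDl ?exprn_gt0 ?sqr_ge0.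
have Q0 : 0 < oneDsqr u by rewrite (lt_le_trans _ (oneDsqr_ge1 u)).
rewrite /pkernel ler_pdivrMr// mulrAC ler_pdivlMr//.
have -> : C = 2 * e * ((1 + e ^- 2) * (2 * (1 + t ^+ 2))) by rewrite /C !mulrA.
rewrite -[leRHS]mulrA ler_pM2l ?mulr_gt0//.
have H1 : 1 + (u - t) ^+ 2 <= (1 + e ^- 2) * (e ^+ 2 + (u - t) ^+ 2).
  have -> : (1 + e ^- 2) * (e ^+ 2 + (u - t) ^+ 2) =
      1 + (u - t) ^+ 2 + (e ^+ 2 + e ^- 2 * (u - t) ^+ 2).
    by field; rewrite gt_eqF.
  rewrite lerDl; apply: addr_ge0; first exact: sqr_ge0.
  by apply: mulr_ge0; [rewrite invr_ge0|]; exact: sqr_ge0.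
have H2 : oneDsqr u <= 2 * (1 + t ^+ 2) * (1 + (u - t) ^+ 2).
  rewrite /oneDsqr; have := sqr_ge0 (u - t - t); have := sqr_ge0 (t * (u - t)); nra.
rewrite (le_trans H2)// [X in _ <= X * _]mulrC -[leRHS]mulrA ler_wpM2l//.
by rewrite mulr_ge0// addr_ge0 ?sqr_ge0.
Qed.

Lemma integrable_pkernel (e t : R) : 0 < e ->
  mu.-integrable setT (EFin \o (fun u => pkernel e (u - t))).
Proof.
move=> e0; apply: (integrable_dom (measurable_pkernel t e0)).
  exact: (integrable_scale (2 * e * (1 + e ^- 2) * (2 * (1 + t ^+ 2))) integrable_oneDsqr).
by apply: ae_all => u; rewrite ger0_norm ?pkernel_ge0// pkernel_le_oneDsqr.
Qed.

End poisson.

(** * Fourier integrals, square integrability and truncation *)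

Section fourier_integrals.
Context {R : realType}.
Local Notation mu := (@lebesgue_measure R).
Implicit Types (x y X : R -> R[i]) (D : set R).

Definition cL2 x : Prop :=
  cmeas setT x /\ mu.-integrable setT (EFin \o (fun t => normc (x t) ^+ 2)).

Lemma sqint_cres D x : measurable D -> sqint D x = sqint setT (cres D x).
Proof.
move=> mD; rewrite /sqint integral_mkcond; apply: eq_integral => t _.
by rewrite patchE /cres; case: ifP => // _; rewrite normc0 expr0n.
Qed.

Lemma sqint_lt_integrable x : cmeas setT x ->
  (sqint setT x < +oo)%E <->
  mu.-integrable setT (EFin \o (fun t => normc (x t) ^+ 2)).
Proof.
move=> mx; have E : (\int[mu]_t `|(EFin \o (fun t => normc (x t) ^+ 2)%R) t| = sqint setT x)%E.
  by apply: eq_integral => t _ /=; rewrite ger0_norm ?sqr_ge0.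
split=> [h|/integrableP[_]]; last by rewrite E.
apply/integrableP; split; last by rewrite E.
by apply/measurable_EFinP; exact: measurable_sqr_normc.
Qed.

Lemma inL2E D x : measurable D -> inL2 D x <-> cL2 (cres D x).
Proof.
move=> mD; rewrite /inL2 /cL2 sqint_cres//; split=> -[h1 h2].
  have h3 := (cmeas_cresP x mD).1 h1.
  by split => //; exact/(sqint_lt_integrable h3).
by split; [exact/(cmeas_cresP x mD)|exact/(sqint_lt_integrable h1)].
Qed.

Lemma cresT x : cres setT x = x.
Proof. by apply/funext => t; rewrite /cres mem_set. Qed.

Lemma cL2M x y : cL2 x -> cL2 y -> cintegrable (fun t => x t * y t).
Proof.
move=> [mx ix] [my iy]; apply: (cintegrable_dom _ (integrable_add ix iy)).
  exact: cmeasM.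
apply: ae_all => t; rewrite normcM.
by have := normc_ge0 (x t); have := normc_ge0 (y t);
  have := sqr_ge0 (normc (x t) - normc (y t)); nra.
Qed.

Lemma cL2_dom x (g : R -> R) : cmeas setT x -> mu.-integrable setT (EFin \o g) ->
  {ae mu, forall t, normc (x t) ^+ 2 <= g t} -> cL2 x.
Proof.
move=> mx ig xg; split=> //; apply: (integrable_dom (measurable_sqr_normc mx) ig).
by apply: ae_impl xg => t; rewrite ger0_norm ?sqr_ge0.
Qed.

Lemma cL2D x y : cL2 x -> cL2 y -> cL2 (fun t => x t + y t).
Proof.
move=> [mx ix] [my iy].
apply: (cL2_dom _ (integrable_add (integrable_scale 2 ix) (integrable_scale 2 iy))).
  exact: cmeasD.
apply: ae_all => t; rewrite -[y t]opprK (le_trans (normc_sub_sqr _ _))//.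
by rewrite !normcN.
Qed.

Lemma cL2N x : cL2 x -> cL2 (fun t => - x t).
Proof.
move=> [mx ix]; split; first exact: cmeasN.
by under eq_fun do rewrite normcN.
Qed.

Lemma cL2_bounded (M : R) x : cintegrable x -> {ae mu, forall t, normc (x t) <= M} ->
  cL2 x.
Proof.
move=> [mx ix] xM; apply: (cL2_dom mx (integrable_scale M ix)).
by apply: ae_impl xM => t xM; rewrite expr2 ler_wpM2r ?normc_ge0.
Qed.

(** Young's inequality 2ab <= k a^2 + b^2 / k stands in for Cauchy-Schwarz: the free parameter [k]
    replaces the square roots, and the 2 of [normc_cintegral_le] is absorbed. *)
Lemma cintegral_Cauchy x y (k : R) : 0 < k -> cL2 x -> cL2 y ->
  normc (cintegral setT (fun t => x t * y t)) <=
  k * \int[mu]_t (normc (x t) ^+ 2) + k^-1 * \int[mu]_t (normc (y t) ^+ 2).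
Proof.
move=> k0 lx ly; have [mx ix] := lx; have [my iy] := ly.
have ixy := cL2M lx ly.
apply: (le_trans (normc_cintegral_le ixy)).
have ikx := integrable_scale k ix; have iky := integrable_scale k^-1 iy.
case: (ixy) => _ nxy.
rewrite -!RintegralZl// -RintegralD//; apply: le_Rintegral => //.
- exact: integrable_scale.
- exact: integrable_add.
move=> t _; rewrite normcM.
set a := normc (x t); set b := normc (y t).
rewrite -subr_ge0 (_ : _ - _ = k * (a - k^-1 * b) ^+ 2).
  by rewrite mulr_ge0 ?sqr_ge0 ?ltW.
by field; rewrite gt_eqF.
Qed.

Definition kernelT (sgn : R) x (l : R) : R[i] :=
  cintegral setT (fun u => x u * cis (sgn * u * l)).

Lemma kernel_integralE D sgn x : kernel_integral D sgn x = kernelT sgn (cres D x).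
Proof.
apply/funext => l; rewrite /kernel_integral cintegral_mkcond /kernelT.
by congr cintegral; apply/funext => u; rewrite /cres; case: ifP; rewrite ?mul0r.
Qed.

Lemma cmeas_kernel_cis (sgn : R) : cmeas setT (fun p : R * R => cis (sgn * p.2 * p.1)).
Proof.
apply: cmeas_cis; apply: measurable_funM; last exact: measurable_fst.
by apply: measurable_funM; [exact: measurable_cst|exact: measurable_snd].
Qed.

Lemma cmeas_kernelT sgn x : cmeas setT x -> cmeas setT (kernelT sgn x).
Proof.
move=> [rx jx]; apply: (cmeas_cintegral_param (F := fun p => x p.2 * cis (sgn * p.2 * p.1))).
apply: cmeasM; last exact: cmeas_kernel_cis.
by split; [exact: (measurableT_comp rx measurable_snd)|
  exact: (measurableT_comp jx measurable_snd)].
Qed.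

Lemma cmeas_scale_cis (c : R) : cmeas setT (fun u : R => cis (c * u)).
Proof.
apply: cmeas_cis; apply: measurable_funM; first exact: measurable_cst.
exact: measurable_id.
Qed.

Lemma cintegrable_kernel sgn x l : cintegrable x ->
  cintegrable (fun u => x u * cis (sgn * u * l)).
Proof.
move=> ix; apply: (cintegrableM_bounded (M := 1) ix).
  by under eq_fun do rewrite mulrAC; exact: cmeas_scale_cis.
by apply: ae_all => t; rewrite normc_cis.
Qed.

Lemma kernelT_bound sgn x l : cintegrable x ->
  normc (kernelT sgn x l) <= 2 * \int[mu]_u normc (x u).
Proof.
move=> ix; rewrite (le_trans (normc_cintegral_le (cintegrable_kernel sgn l ix)))//.
rewrite ler_wpM2l// le_eqVlt; apply/orP; left; apply/eqP.
by apply: eq_Rintegral => u _; rewrite normcM normc_cis mulr1.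
Qed.

Definition window (n : nat) : set R := `[- n%:R, n%:R]%classic.

Lemma cL2_truncate x n : cL2 x -> cintegrable (cres (window n) x).
Proof.
move=> [mx ix].
have i1 : mu.-integrable setT (EFin \o (\1_(window n) : R -> R)).
  exact: integrable_indic_itv.
apply: (cintegrable_dom _ (integrable_add ix i1)).
  apply/(cmeas_cresP x (measurable_itv _)).
  by case: mx => ? ?; split; exact: measurable_funTS.
apply: ae_all => t; rewrite /cres indicE; case: ifP => _; last first.
  by rewrite normc0 addr0 sqr_ge0.
by rewrite /=; have := sqr_ge0 (normc (x t) - 2^-1); have := normc_ge0 (x t); nra.
Qed.

Lemma cresI D E x : cres (D `&` E) x = cres E (cres D x).
Proof.
apply/funext => t; rewrite /cres in_setI.
by case: (t \in D); case: (t \in E).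
Qed.

Lemma sqint_truncated D sgn x X :
  (fun n : nat => sqint setT (fun l =>
    X l - kernel_integral (D `&` `[- n%:R, n%:R]) sgn x l)) =
  (fun n : nat => sqint setT (fun l => X l - kernelT sgn (cres (window n) (cres D x)) l)).
Proof. by apply/funext => n; rewrite kernel_integralE cresI. Qed.

Lemma cres_truncate_cvg x t :
  normc (cres (window n) x t - x t) @[n --> \oo] --> 0.
Proof.
apply: cvg_near_cst; near=> n.
rewrite /cres /window mem_set ?subrr ?normc0//= in_itv/= -ler_norml.
by near: n; exact: nbhs_infty_ger.
Unshelve. all: by end_near. Qed.

End fourier_integrals.

Section damped_inversion.
Context {R : realType}.
Local Notation mu := (@lebesgue_measure R).
Implicit Types (x y X : R -> R[i]) (D : set R).

Definition damp (e c l : R) : R[i] := (expabs e l)%:C * cis (c * l).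

Lemma normc_damp (e c l : R) : normc (damp e c l) = expabs e l.
Proof. by rewrite /damp normcM normc_cis mulr1 normc_real ger0_norm ?expR_ge0. Qed.

Lemma expabs_le1 (e l : R) : 0 <= e -> expabs e l <= 1.
Proof. by move=> e0; rewrite /expabs -[leRHS]expR0 ler_expR oppr_le0 mulr_ge0. Qed.

Lemma cmeas_damp (e c : R) : cmeas setT (damp e c).
Proof.
apply: cmeasM; last exact: cmeas_scale_cis.
by apply: cmeas_real; exact: measurable_expabs.
Qed.

Lemma cintegrable_damp (e c : R) : 0 < e -> cintegrable (damp e c).
Proof.
move=> e0; apply: (cintegrable_dom (cmeas_damp e c) (integrable_expabs e0)).
by apply: ae_all => l; rewrite normc_damp.
Qed.

Lemma cL2_damp (e c : R) : 0 < e -> cL2 (damp e c).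
Proof.
move=> e0; apply: (cL2_bounded (M := 1) (cintegrable_damp c e0)).
by apply: ae_all => l; rewrite normc_damp expabs_le1// ltW.
Qed.

Lemma cmeas_pkernel (e t : R) : 0 < e -> cmeas setT (fun u : R => (pkernel e (u - t))%:C).
Proof. by move=> e0; apply: cmeas_real; exact: measurable_pkernel. Qed.

Lemma normc_pkernel (e z : R) : 0 < e -> normc (pkernel e z)%:C = pkernel e z.
Proof. by move=> e0; rewrite normc_real ger0_norm ?pkernel_ge0. Qed.

Lemma cintegrable_pkernel (e t : R) : 0 < e -> cintegrable (fun u : R => (pkernel e (u - t))%:C).
Proof.
move=> e0; apply: (cintegrable_dom (cmeas_pkernel t e0) (integrable_pkernel t e0)).
by apply: ae_all => u; rewrite normc_pkernel.
Qed.

Lemma cL2_pkernel (e t : R) : 0 < e -> cL2 (fun u : R => (pkernel e (u - t))%:C).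
Proof.
move=> e0; apply: (cL2_bounded (M := 2 / e) (cintegrable_pkernel t e0)).
by apply: ae_all => u; rewrite normc_pkernel// pkernel_le.
Qed.

(** Fubini moves the damping onto the exponential, whose damped integral is the Poisson kernel. The
    kernel is even, so it sees [sgn] only through its square. *)
Lemma damped_inversion_L1 (sgn e t : R) x : sgn ^+ 2 = 1 -> 0 < e -> cintegrable x ->
  cintegral setT (fun l => damp e (- (sgn * t)) l * kernelT sgn x l) =
  cintegral setT (fun u => x u * (pkernel e (u - t))%:C).
Proof.
move=> s2 e0 ix; rewrite /kernelT.
rewrite (@cFubini _ x (damp e (- (sgn * t))) (fun p : R * R => cis (sgn * p.2 * p.1)) 1)//.
- congr cintegral; apply/funext => u; congr (_ * _).
  have -> : (fun l => damp e (- (sgn * t)) l * cis (sgn * u * l)) =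
      (fun l => (expabs e l)%:C * cis (sgn * (u - t) * l)).
    by apply/funext => l; rewrite /damp -mulrA -cisD; congr (_ * cis _); ring.
  rewrite exp_fourier//; congr (_%:C).
  by rewrite /pkernel exprMn s2 mul1r.
- exact: cintegrable_damp.
- exact: cmeas_kernel_cis.
- by move=> v u; rewrite normc_cis.
Qed.

Lemma sqint_cvg0 (h : nat -> R -> R[i]) : (forall n, cmeas setT (h n)) ->
  sqint setT (h n) @[n --> \oo] --> 0%E ->
  forall e, 0 < e -> \forall n \near \oo,
    cL2 (h n) /\ \int[mu]_t (normc (h n t) ^+ 2) < e.
Proof.
move=> mh /fine_cvgP[hf /cvgrPdist_lt hc] e e0.
have := hc e e0; move: hf; apply: filterS2 => n fin; rewrite sub0r normrN => he; split.
  by split => //; apply/sqint_lt_integrable => //; rewrite ltey_eq fin.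
exact: le_lt_trans (ler_norm _) he.
Qed.

(* The damping makes the inversion integral absolutely convergent even when [X]
   is only a limit in L_2. *)
Lemma damped_inversion D (sgn e t : R) x X : measurable D -> sgn ^+ 2 = 1 ->
  0 < e -> fourier D sgn x X ->
  [/\ cintegrable (fun l => damp e (- (sgn * t)) l * X l),
    cintegrable (fun u => cres D x u * (pkernel e (u - t))%:C) &
    cintegral setT (fun l => damp e (- (sgn * t)) l * X l) =
    cintegral setT (fun u => cres D x u * (pkernel e (u - t))%:C)].
Proof.
move=> mD s2 e0 [[/(inL1E _ mD) ix XE]|[/(inL2E _ mD) lx /(inL2E _ measurableT) lX hc]].
  have -> : X = kernelT sgn (cres D x).
    by apply/funext => l; rewrite XE kernel_integralE.
  split.
  - apply: (cintegrableM_bounded (cintegrable_damp _ e0)).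
      by apply: cmeas_kernelT; case: ix.
    by apply: ae_all => l; exact: kernelT_bound.
  - apply: (cintegrableM_bounded (M := 2 / e) ix (cmeas_pkernel t e0)).
    by apply: ae_all => u; rewrite normc_pkernel// pkernel_le.
  - exact: damped_inversion_L1.
rewrite cresT in lX.
set c := - (sgn * t).
pose xn n := cres (window n) (cres D x).
pose Xn n := kernelT sgn (xn n).
have ixn n : cintegrable (xn n) by exact: cL2_truncate.
have mXn n : cmeas setT (Xn n) by apply: cmeas_kernelT; case: (ixn n).
rewrite sqint_truncated in hc.
have iX : cintegrable (fun l => damp e c l * X l) by exact: cL2M (cL2_damp c e0) lX.
have ik : cintegrable (fun u => cres D x u * (pkernel e (u - t))%:C).
  exact: cL2M lx (cL2_pkernel t e0).
split=> //.
have [_ cb] : cintegrable (fun u => cres D x u * (pkernel e (u - t))%:C) /\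
    normc (cintegral setT (fun u => xn n u * (pkernel e (u - t))%:C) -
    cintegral setT (fun u => cres D x u * (pkernel e (u - t))%:C)) @[n --> \oo] --> 0.
  apply: (cdominated (x_ := fun n u => xn n u * (pkernel e (u - t))%:C) _ _ _ ik.2).
  - by move=> n; apply: cmeasM; [case: (ixn n)|exact: cmeas_pkernel].
  - by case: ik.
  - apply: ae_all => u.
    rewrite (_ : (fun n => _) = (fun n => normc (xn n u - cres D x u) * pkernel e (u - t))).
      by rewrite -(mul0r (pkernel e (u - t))); apply: cvgM; [exact: cres_truncate_cvg|exact: cvg_cst].
    by apply/funext => n; rewrite -mulrBl normcM normc_pkernel.
  - apply: ae_all => u n; rewrite /= !normcM ler_wpM2r ?normc_ge0// /xn {1}/cres.
    by case: ifP => //; rewrite normc0 normc_ge0.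
apply/eqP; rewrite -subr_eq0; apply/eqP; apply: eq0_normc; apply/eqP.
rewrite eq_le normc_ge0 andbT; apply/ler_addgt0Pr => d d0; rewrite add0r.
set S := \int[mu]_l (normc (damp e c l) ^+ 2).
have S0 : 0 <= S by apply: Rintegral_ge0 => l _; exact: sqr_ge0.
(* In [cintegral_Cauchy] this [k] brings the damping term below d / 3, while an L_2 error below
   [k * (d / 3)] brings the other term below d / 3. Adding 1 to [S] keeps the denominator
   positive. *)
pose k := (d / 3) / (S + 1).
have k0 : 0 < k by rewrite !divr_gt0// ltr_pwDr.
have mXXn n : cmeas setT (fun l => X l - Xn n l) by apply: cmeasB; [case: lX|].
have d3 : 0 < d / 3 by rewrite divr_gt0.
have [n [[lXn hXn] hbn]] : exists n, (cL2 (fun l => X l - Xn n l) /\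
    \int[mu]_l (normc (X l - Xn n l) ^+ 2) < k * (d / 3)) /\
    normc (cintegral setT (fun u => xn n u * (pkernel e (u - t))%:C) -
    cintegral setT (fun u => cres D x u * (pkernel e (u - t))%:C)) < d / 3.
  move/cvgrPdist_lt : cb => /(_ _ d3) cb.
  have [|N _ HN] := filterI (sqint_cvg0 mXXn hc (e := k * (d / 3)) _) cb.
    by rewrite mulr_gt0.
  exists N; have [H1 H2] := HN N (leqnn N); split => //.
  by move: H2; rewrite sub0r normrN ger0_norm ?normc_ge0.
rewrite -(damped_inversion_L1 t s2 e0 (ixn n)) -/c -/(Xn n) in hbn.
have iXn : cintegrable (fun l => damp e c l * Xn n l).
  apply: (cintegrableM_bounded (cintegrable_damp _ e0) (mXn n)).
  by apply: ae_all => l; exact: kernelT_bound.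
have H1 : normc (cintegral setT (fun l => damp e c l * X l) -
    cintegral setT (fun l => damp e c l * Xn n l)) <= 2 * (d / 3).
  rewrite -cintegralB//; under eq_fun do rewrite -mulrBr.
  rewrite (le_trans (cintegral_Cauchy k0 (cL2_damp c e0) lXn))// -/S.
  rewrite mulr_natl mulr2n lerD//.
    have -> : d / 3 = k * (S + 1) by rewrite /k divfK// gt_eqF// ltr_pwDr.
    by rewrite ler_wpM2l ?(ltW k0)// lerDl.
  by rewrite ler_pdivrMl// ltW.
have -> : d = 2 * (d / 3) + d / 3 by field.
set A := cintegral _ _; set B := cintegral _ _.
set C := cintegral setT (fun l => damp e c l * Xn n l) in hbn H1.
have -> : A - B = (A - C) + (C - B) by rewrite addrA subrK.
by rewrite (le_trans (ler_normcD _ _))// lerD// ltW.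
Qed.

End damped_inversion.

(** * Uniqueness of Fourier transforms in both senses *)

Section fourier_uniqueness.
Context {R : realType}.
Local Notation mu := (@lebesgue_measure R).
Implicit Types (x y X : R -> R[i]) (D : set R).

Lemma sqint_eq0 X X' : cmeas setT X -> cmeas setT X' ->
  sqint setT (fun l => X' l - X l) = 0%E -> {ae mu, forall l, X l = X' l}.
Proof.
move=> mX mX' h0; have mh := cmeasB mX' mX.
have /(ae_eq_integral_abs mu measurableT _).1 :
    (\int[mu]_l `|(EFin \o (fun l => normc (X' l - X l) ^+ 2)%R) l| = 0)%E.
  by rewrite -h0; apply: eq_integral => l _ /=; rewrite ger0_norm ?sqr_ge0.
have h : measurable_fun setT (EFin \o (fun l => normc (X' l - X l) ^+ 2)).
  by apply/measurable_EFinP; exact: measurable_sqr_normc.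
move=> /(_ h); apply: ae_impl => l /= /(_ Logic.I) [] /eqP.
rewrite sqrf_eq0 => /eqP /eq0_normc/eqP; rewrite subr_eq0 => /eqP ->//.
Qed.

(** By Fatou, the integral of the pointwise limit |X' - X|^2 is at most the lower limit of the
    integrals of |X' - Xn|^2, which is 0. *)
Lemma sqint_cvg_unique (Xn : nat -> R -> R[i]) X X' :
  (forall n, cmeas setT (Xn n)) -> cmeas setT X -> cmeas setT X' ->
  (forall l, normc (Xn n l - X l) @[n --> \oo] --> 0) ->
  sqint setT (fun l => X' l - Xn n l) @[n --> \oo] --> 0%E ->
  {ae mu, forall l, X l = X' l}.
Proof.
move=> mXn mX mX' XnX hc; apply: sqint_eq0 => //.
pose f n := EFin \o (fun l => normc (X' l - Xn n l) ^+ 2).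
have mf n : measurable_fun setT (f n).
  apply/measurable_EFinP; apply: measurable_sqr_normc.
  exact: (cmeasB mX' (mXn n)).
have f0 n l : setT l -> (0 <= f n l)%E by move=> _; rewrite lee_fin sqr_ge0.
have := fatou mu measurableT mf f0.
rewrite (cvg_limn_einf_sup hc).1.
have fl l : limn_einf (f ^~ l) = (normc (X' l - X l) ^+ 2)%:E.
  have c1 : normc (X' l - Xn n l) @[n --> \oo] --> normc (X' l - X l).
    apply/cvgrPdist_lt => e e0; have /cvgrPdist_lt/(_ e e0) := XnX l.
    apply: filterS => n; rewrite sub0r normrN ger0_norm ?normc_ge0//.
    apply: le_lt_trans.
    have h1 : normc (X' l - Xn n l) <= normc (X' l - X l) + normc (Xn n l - X l).
      have -> : X' l - Xn n l = (X' l - X l) - (Xn n l - X l) by ring.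
      exact: ler_normcB.
    have h2 : normc (X' l - X l) <= normc (X' l - Xn n l) + normc (Xn n l - X l).
      have -> : X' l - X l = (X' l - Xn n l) + (Xn n l - X l) by ring.
      exact: ler_normcD.
    by rewrite ler_norml; apply/andP; split; lra.
  have c2 : f n l @[n --> \oo] --> (normc (X' l - X l) ^+ 2)%:E.
    by apply: cvg_EFin; [exact: nearW|exact: (cvgM c1 c1)].
  exact: (cvg_limn_einf_sup c2).1.
under eq_integral do rewrite fl.
by move=> h; apply/eqP; rewrite eq_le h integral_ge0// => l _; rewrite lee_fin sqr_ge0.
Qed.

Lemma kernelT_truncate_cvg (sgn : R) x l : cintegrable x ->
  normc (kernelT sgn (cres (window n) x) l - kernelT sgn x l) @[n --> \oo] --> 0.
Proof.
move=> ix; rewrite /kernelT.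
have mc : cmeas setT (fun u => cis (sgn * u * l)).
  by under eq_fun do rewrite mulrAC; exact: cmeas_scale_cis.
apply: (proj2 (@cdominated _ (fun n u => cres (window n) x u * cis (sgn * u * l))
  (fun u => x u * cis (sgn * u * l)) (fun u => normc (x u)) _ _ _ ix.2 _)).
- move=> n; apply: cmeasM => //; apply/(cmeas_cresP x (measurable_itv _)).
  by case: ix => -[? ?] _; split; exact: measurable_funTS.
- by case: (cintegrable_kernel sgn l ix).
- apply: ae_all => u.
  rewrite (_ : (fun n => _) = (fun n => normc (cres (window n) x u - x u))).
    exact: cres_truncate_cvg.
  by apply/funext => n; rewrite -mulrBl normcM normc_cis mulr1.
- apply: ae_all => u n; rewrite /= normcM normc_cis mulr1 /cres.
  by case: ifP => //; rewrite normc0 normc_ge0.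
Qed.

Lemma fourier_cmeas D (sgn : R) x X : measurable D -> fourier D sgn x X -> cmeas setT X.
Proof.
move=> mD [[/(inL1E _ mD) [mx _] XE]|[_ [mX _] _]] //.
have -> : X = kernelT sgn (cres D x).
  by apply/funext => l; rewrite XE kernel_integralE.
exact: cmeas_kernelT.
Qed.

(** The graphs of the operators supply their own transforms, which must be identified with [A_] and
    with C. In the mixed case the truncated integrals converge pointwise to one candidate and in L_2
    to the other; two L_2 limits agree by the triangle inequality. *)
Lemma fourier_unique D (sgn : R) x X X' : measurable D ->
  fourier D sgn x X -> fourier D sgn x X' -> {ae mu, forall l, X l = X' l}.
Proof.
move=> mD FX FX'; have mX := fourier_cmeas mD FX; have mX' := fourier_cmeas mD FX'.
have mk n : cmeas setT (cres D x) -> cmeas setT (kernelT sgn (cres (window n) (cres D x))).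
  move=> mx; apply: cmeas_kernelT; apply/(cmeas_cresP _ (measurable_itv _)).
  by case: mx => ? ?; split; exact: measurable_funTS.
have L1L2 Z Z' : inL1 D x -> (forall l, Z l = kernel_integral D sgn x l) ->
    cmeas setT Z -> cmeas setT Z' ->
    sqint setT (fun l => Z' l - kernel_integral (D `&` `[- n%:R, n%:R]) sgn x l)
      @[n --> \oo] --> 0%E -> {ae mu, forall l, Z l = Z' l}.
  move=> /(inL1E _ mD) ix ZE mZ mZ' hc.
  have c1 l : normc (kernelT sgn (cres (window n) (cres D x)) l - Z l) @[n --> \oo] --> 0.
    by rewrite ZE kernel_integralE; exact: kernelT_truncate_cvg.
  have c2 : sqint setT (fun l => Z' l - kernelT sgn (cres (window n) (cres D x)) l)
      @[n --> \oo] --> 0%E.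
    by rewrite -sqint_truncated.
  exact: (sqint_cvg_unique (fun n => mk n ix.1) mZ mZ' c1 c2).
case: FX FX' => [[ix XE]|[lx lX hX]] [[ix' XE']|[lx' lX' hX']].
- by apply: ae_all => l; rewrite XE XE'.
- exact: L1L2.
- by have := L1L2 X' X ix' XE' mX' mX hX; apply: ae_impl => l ->.
have mxD : cmeas setT (cres D x) by case: ((inL2E x mD).1 lx).
have lX1 : cL2 X by move/(inL2E _ measurableT) : lX; rewrite cresT.
have lX2 : cL2 X' by move/(inL2E _ measurableT) : lX'; rewrite cresT.
pose Z n := kernelT sgn (cres (window n) (cres D x)).
have hc (W : R -> R[i]) : cmeas setT W ->
    sqint setT (fun l => W l - kernel_integral (D `&` `[- n%:R, n%:R]) sgn x l)
      @[n --> \oo] --> 0%E -> forall e, 0 < e -> \forall n \near \oo,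
    cL2 (fun l => W l - Z n l) /\ \int[mu]_t (normc (W t - Z n t) ^+ 2) < e.
  move=> mW h; apply: (sqint_cvg0 (h := fun n l => W l - Z n l)).
    by move=> n; apply: (cmeasB mW); exact: mk.
  by rewrite -sqint_truncated.
have [mXX iXX] := cL2D lX2 (cL2N lX1).
apply: sqint_eq0 => //.
suff h : \int[mu]_l (normc (X' l - X l) ^+ 2) = 0.
  rewrite -[LHS]fineK; first by rewrite -[fine _]/(\int[mu]_l (normc (X' l - X l) ^+ 2)) h.
  exact: (integrable_fin_num measurableT iXX).
apply/eqP; rewrite eq_le Rintegral_ge0 ?andbT; last by move=> l _; exact: sqr_ge0.
apply/ler_addgt0Pr => d d0; rewrite add0r.
have d4 : 0 < d / 4 by rewrite divr_gt0.
have [N _ /(_ N (leqnn N)) [[[_ i1] h1] [[_ i2] h2]]] := filterI (hc X mX hX _ d4) (hc X' mX' hX' _ d4).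
apply: (@le_trans _ _ (2 * (\int[mu]_t (normc (X' t - Z N t) ^+ 2)) +
  2 * (\int[mu]_t (normc (X t - Z N t) ^+ 2)))); last first.
  have -> : d = 2 * (d / 4) + 2 * (d / 4) by field.
  by rewrite lerD// ler_wpM2l// ltW.
rewrite -!RintegralZl// -RintegralD//; try exact: integrable_scale.
apply: le_Rintegral => //.
  by apply: integrable_add; exact: integrable_scale.
move=> l _; have -> : X' l - X l = (X' l - Z N l) - (X l - Z N l) by ring.
exact: normc_sub_sqr.
Qed.

End fourier_uniqueness.

(** * The spaces L_2^s *)

Section weighted_closure.
Context {R : realType}.
Local Notation mu := (@lebesgue_measure R).
Variables (s : nat) (N K : nat -> R) (w : R -> R).
Hypothesis w0 : forall l, 0 <= w l.
Hypothesis iw : mu.-integrable setT (EFin \o w).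
Implicit Types (h : R -> R[i]).

Lemma measurable_weight : measurable_fun setT w.
Proof. by apply/measurable_EFinP; exact: (measurable_int mu iw). Qed.

Lemma measurable_wsqint h : cmeas setT h ->
  measurable_fun setT (fun l => (normc (h l) ^+ 2 * w l)%:E).
Proof.
move=> mh; apply/measurable_EFinP; apply: measurable_funM.
  exact: measurable_sqr_normc.
exact: measurable_weight.
Qed.

Lemma wsqint_ge0 h : (0 <= wsqint w h)%E.
Proof. by apply: integral_ge0 => l _; rewrite lee_fin mulr_ge0 ?sqr_ge0. Qed.

Lemma wsqint_ae h h' : cmeas setT h -> cmeas setT h' ->
  {ae mu, forall l, h l = h' l} -> wsqint w h = wsqint w h'.
Proof.
move=> mh mh' hh'; apply: ae_eq_integral => //.
- exact: measurable_wsqint.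
- exact: measurable_wsqint.
- by apply: ae_impl hh' => l -> _.
Qed.

Lemma wsqintB h1 h2 h3 : cmeas setT h1 -> cmeas setT h2 -> cmeas setT h3 ->
  (wsqint w (fun l => (h1 l - h3 l)%R) <=
   2%:E * wsqint w (fun l => (h1 l - h2 l)%R) +
   2%:E * wsqint w (fun l => (h2 l - h3 l)%R))%E.
Proof.
move=> m1 m2 m3.
have m12 := measurable_wsqint (cmeasB m1 m2).
have m23 := measurable_wsqint (cmeasB m2 m3).
have p12 l : setT l -> (0 <= (normc (h1 l - h2 l)%R ^+ 2 * w l)%:E)%E.
  by move=> _; rewrite lee_fin mulr_ge0 ?sqr_ge0.
have p23 l : setT l -> (0 <= (normc (h2 l - h3 l)%R ^+ 2 * w l)%:E)%E.
  by move=> _; rewrite lee_fin mulr_ge0 ?sqr_ge0.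
rewrite /wsqint -!ge0_integralZl//.
rewrite -ge0_integralD//; last 4 first.
- by move=> l _; rewrite mule_ge0// p12.
- exact: emeasurable_funM.
- by move=> l _; rewrite mule_ge0// p23.
- exact: emeasurable_funM.
apply: ge0_le_integral => //.
- by move=> l _; rewrite lee_fin mulr_ge0 ?sqr_ge0.
- exact: (measurable_wsqint (cmeasB m1 m3)).
- by apply: emeasurable_funD; exact: emeasurable_funM.
- move=> l _; rewrite -!EFinM -EFinD lee_fin.
  have -> : h1 l - h3 l = (h1 l - h2 l) - (h3 l - h2 l) by ring.
  rewrite !mulrA -mulrDl ler_wpM2r// (le_trans (normc_sub_sqr _ _))//.
  by rewrite -(normcN (h3 l - h2 l)) opprB !expr2 !mulrA.
Qed.

Lemma wsqint_bounded (M : R) h : cmeas setT h ->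
  {ae mu, forall l, normc (h l) <= M} -> (wsqint w h < +oo)%E.
Proof.
move=> mh hM.
have : mu.-integrable setT (EFin \o (fun l => normc (h l) ^+ 2 * w l)).
  apply: (integrable_dom _ (integrable_scale (M ^+ 2) iw)).
    by apply/measurable_EFinP; exact: measurable_wsqint.
  apply: ae_impl hM => l hM; rewrite ger0_norm; last by rewrite mulr_ge0 ?sqr_ge0.
  apply: ler_wpM2r => //; by rewrite ler_sqr ?nnegrE ?normc_ge0// (le_trans (normc_ge0 _) hM).
by move=> /(integrable_lty measurableT).
Qed.

Lemma L2s_ae h h' : cmeas setT h' -> {ae mu, forall l, h l = h' l} ->
  L2s s N K w h -> L2s s N K w h'.
Proof.
move=> mh' hh' [mh hoo happ]; split => //.
  by rewrite -(wsqint_ae mh mh' hh').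
move=> e /happ [n [c [t [tobs hlt]]]]; exists n, c, t; split => //.
rewrite -(wsqint_ae _ _ (h := fun l => h l - \sum_(j < n) c j * cis (t j * l)))//.
- apply: (cmeasB mh); apply: cmeas_sum => j.
  by apply: cmeasM; [exact: cmeas_cst|exact: cmeas_scale_cis].
- apply: (cmeasB mh'); apply: cmeas_sum => j.
  by apply: cmeasM; [exact: cmeas_cst|exact: cmeas_scale_cis].
- by apply: ae_impl hh' => l ->.
Qed.

Lemma cmeas_trig n (c : 'I_n -> R[i]) (t : 'I_n -> R) :
  cmeas setT (fun l => \sum_(j < n) c j * cis (t j * l)).
Proof.
apply: cmeas_sum => j.
by apply: cmeasM; [exact: cmeas_cst|exact: cmeas_scale_cis].
Qed.

Lemma L2s_trig n (c : 'I_n -> R[i]) (t : 'I_n -> R) :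
  (forall j, observed s N K (t j)) ->
  L2s s N K w (fun l => \sum_(j < n) c j * cis (t j * l)).
Proof.
move=> tobs; split.
- exact: cmeas_trig.
- apply: (wsqint_bounded (M := \sum_(j < n) normc (c j)) (cmeas_trig c t)).
  apply: ae_all => l; elim/big_ind2 : _ => [|x1 x2 y1 y2 h1 h2|j _].
  + by rewrite normc0.
  + by rewrite (le_trans (ler_normcD _ _))// lerD.
  + by rewrite normcM normc_cis mulr1.
- move=> e e0; exists n, c, t; split => //.
  rewrite (_ : wsqint _ _ = 0%E) ?lte_fin//.
  rewrite /wsqint; under eq_integral do rewrite subrr normc0 expr0n mul0r.
  by rewrite integral0.
Qed.

(** Dominated convergence with majorant (2M)^2 w gives convergence in L_2(w). Nothing about [w]
    enters beyond nonnegativity and integrability, which is why the same approximants serve all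
    pairs of densities. *)
Lemma L2s_bounded_limit (M : R) (hn : nat -> R -> R[i]) h :
  (forall n, L2s s N K w (hn n)) -> cmeas setT h ->
  (forall n l, normc (hn n l) <= M) ->
  {ae mu, forall l, normc (hn n l - h l) @[n --> \oo] --> 0} -> L2s s N K w h.
Proof.
move=> Lhn mh hnM hnh.
have hM : {ae mu, forall l, normc (h l) <= M}.
  apply: ae_impl hnh => l x_x; apply/ler_addgt0Pr => e e0.
  have /cvgrPdist_lt/(_ e e0)[n _ /(_ n (leqnn n))] := x_x.
  rewrite sub0r normrN ger0_norm ?normc_ge0// => xNx.
  have -> : h l = hn n l - (hn n l - h l) by ring.
  by rewrite (le_trans (ler_normcB _ _))// lerD// ltW.
split => //; first exact: wsqint_bounded hM.
have mhn n : cmeas setT (hn n) by case: (Lhn n).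
have hc : wsqint w (fun l => h l - hn n l) @[n --> \oo] --> 0%E.
  have := @dominated_convergence _ _ R mu setT measurableT
    (fun n l => (normc (h l - hn n l) ^+ 2 * w l)%:E) (cst 0%E)
    (EFin \o (fun l => (2 * M) ^+ 2 * w l)).
  case.
  - by move=> n; apply: measurable_wsqint; exact: (cmeasB mh (mhn n)).
  - exact: measurable_cst.
  - apply: ae_impl hnh => l c _; apply: cvg_EFin; first exact: nearW.
    rewrite -(mul0r (w l)); apply: cvgM; last exact: cvg_cst.
    have {}c : normc (h l - hn n l) @[n --> \oo] --> 0.
      have -> : (fun n => normc (h l - hn n l)) = (fun n => normc (hn n l - h l)).
        by apply/funext => n; rewrite -normcN opprB.
      exact: c.
    by rewrite /= -(mul0r 0); exact: (cvgM c c).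
  - exact: integrable_scale.
  - apply: ae_impl hM => l hM n _ /=.
    rewrite lee_fin ger0_norm; last by rewrite mulr_ge0 ?sqr_ge0.
    apply: ler_wpM2r => //.
    have h2 : normc (h l - hn n l) <= 2 * M.
      by rewrite (le_trans (ler_normcB _ _))// mulr_natl mulr2n lerD.
    by rewrite ler_sqr ?nnegrE ?normc_ge0// (le_trans (normc_ge0 _) h2).
  by move=> _ _; rewrite integral0.
(* [wsqintB] doubles each of the two errors. *)
move=> e e0; have e4 : 0 < e / 4 by rewrite divr_gt0.
have [n hlt] : exists n, (wsqint w (fun l => (h l - hn n l)%R) < (e / 4)%:E)%E.
  have /fine_cvgP[hf /cvgrPdist_lt/(_ _ e4) hd] := hc.
  have [n _ /(_ n (leqnn n)) [h1 h2]] := filterI hf hd.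
  exists n; rewrite -(fineK h1) lte_fin (le_lt_trans (ler_norm _))//.
  by move: h2; rewrite sub0r normrN.
have [_ _ /(_ _ e4)[k [c [t [tobs hc2]]]]] := Lhn n.
exists k, c, t; split => //.
apply: (le_lt_trans (wsqintB mh (mhn n) (cmeas_trig c t))).
have -> : e%:E = (2%:E * (e / 4)%:E + 2%:E * (e / 4)%:E)%E.
  by rewrite -!EFinM -EFinD; congr EFin; field.
by apply: lteD; rewrite lte_pmul2l// lte_fin.
Qed.

End weighted_closure.

(** * Exponential integrals as limits of trigonometric polynomials *)

Section riemann_sums.
Context {R : realType}.
Local Notation mu := (@lebesgue_measure R).
Variables (s : nat) (N K : nat -> R) (w : R -> R).
Hypothesis w0 : forall l, 0 <= w l.
Hypothesis iw : mu.-integrable setT (EFin \o w).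

Lemma cvg_normrB (f : nat -> R) (b : R) : f n @[n --> \oo] --> b ->
  `|f n - b| @[n --> \oo] --> 0.
Proof.
move=> /cvgrPdist_lt fb; apply/cvgrPdist_lt => e e0.
by apply: filterS (fb e e0) => n; rewrite sub0r normrN normr_id distrC.
Qed.

Lemma cvg_normc_cis (u : nat -> R) (a l : R) : u n @[n --> \oo] --> a ->
  normc (cis (u n * l) - cis (a * l)) @[n --> \oo] --> 0.
Proof.
move=> ua; have ul : (u n * l) @[n --> \oo] --> a * l.
  by apply: cvgM => //; exact: cvg_cst.
have cc : cos (u n * l) @[n --> \oo] --> cos (a * l).
  by apply: (cvg_comp _ _ ul); exact: continuous_cos.
have cs : sin (u n * l) @[n --> \oo] --> sin (a * l).
  by apply: (cvg_comp _ _ ul); exact: continuous_sin.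
apply: (@squeeze_cvgr _ _ _ _ (fun=> 0) (fun n => `|cos (u n * l) - cos (a * l)| +
  `|sin (u n * l) - sin (a * l)|)).
- by apply: nearW => n; rewrite normc_ge0 andTb; exact: normc_le_ReIm.
- exact: cvg_cst.
- by rewrite -[X in _ --> X]addr0; apply: cvgD; exact: cvg_normrB.
Qed.

(** The position of [t] counted in cells of length 1/(i+1) from the left end -(i+1); its integer
    part is the index of the cell containing [t]. *)
Let pos (i : nat) (t : R) : R := (t + i.+1%:R) * i.+1%:R.

Let cell (i k : nat) : set R := [set t | k%:R <= pos i t < k.+1%:R].

Let ncell (i : nat) : nat := (2 * i.+1 * i.+1)%N.

Lemma measurable_cell i k : measurable (cell i k).
Proof.
have mp : measurable_fun setT (pos i).
  apply: measurable_funM; last exact: measurable_cst.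
  by apply: measurable_funD; [exact: measurable_id|exact: measurable_cst].
have := mp measurableT _ (measurable_itv `[k%:R, k.+1%:R[).
by rewrite setTI; congr measurable; apply/seteqP; split => t; rewrite /= in_itv.
Qed.

(** The sign condition is essential: [Num.truncn] is 0 on negative numbers and would assign every
    point to the left of the subdivision to cell 0. *)
Lemma indic_cell i k t : \1_(cell i k) t =
  ((0 <= pos i t) && (k == Num.truncn (pos i t)))%:R :> R.
Proof.
rewrite indicE; congr (nat_of_bool _)%:R; apply/idP/idP.
  rewrite inE => h; have h' := h; move: h => /= /andP[h1 h2].
  have x0 : 0 <= pos i t by rewrite (le_trans _ h1).
  by rewrite x0 eq_sym truncn_eq.
by move=> /andP[x0]; rewrite eq_sym truncn_eq// inE.
Qed.

(* Riemann sums with cells of length 1/(i+1) covering [-(i+1), i+1); the node of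
   a cell is taken in the observed set whenever the cell meets it. *)
Lemma L2s_exp_integral (rho : R -> R[i]) : cintegrable rho ->
  (forall t, ~ observed s N K t -> rho t = 0) ->
  L2s s N K w (fun l => cintegral setT (fun t => rho t * cis (t * l))).
Proof.
move=> irho rho0.
have mG : cmeas setT (fun l => cintegral setT (fun t => rho t * cis (t * l))).
  have := @cmeas_kernelT _ 1 rho irho.1; rewrite /kernelT.
  by under eq_fun do under eq_fun do rewrite mul1r.
(* Without observation times [rho] is zero and the empty sum serves. Otherwise [p0] is the default
   node of the cells that miss the observed set; [rho] vanishes there, so these nodes contribute
   nothing. *)
have [[p0 p0obs]|noobs] := pselect (exists p, observed s N K p); last first.
  have E : (fun l => cintegral setT (fun t => rho t * cis (t * l))) =
      (fun l => \sum_(j < 0) (fun=> 0 : R[i]) j * cis ((fun=> 0 : R) j * l)).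
    apply/funext => l; rewrite big_ord0.
    have -> : (fun t => rho t * cis (t * l)) = (fun t => 0 * rho t).
      by apply/funext => t; rewrite rho0 ?mul0r ?mulr0//; apply: contra_not noobs; exists t.
    by rewrite cintegralZ ?mul0r.
  by rewrite E; apply: L2s_trig => // -[].
pose tau i k := xget p0 (cell i k `&` observed s N K).
have tau_obs i k : observed s N K (tau i k).
  by rewrite /tau; case: xgetP => [x -> []|].
have tau_cell i k t : cell i k t -> observed s N K t -> cell i k (tau i k).
  move=> h1 h2; have [] // := @xgetPex _ p0 (cell i k `&` observed s N K).
  by exists t.
pose phi i t l := \sum_(k < ncell i) (\1_(cell i k) t)%:C * cis (tau i k * l).
have phiE i t l : phi i t l =
    if (0 <= pos i t) && (Num.truncn (pos i t) < ncell i)%N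
    then cis (tau i (Num.truncn (pos i t)) * l) else 0.
  rewrite /phi; have [x0|x0] /= := boolP (0 <= pos i t); last first.
    by rewrite big1// => k _; rewrite indic_cell (negbTE x0) mul0r.
  rewrite -(big_ord1_eq +%R (fun k => cis (tau i k * l))) [RHS]big_mkcond.
  apply: eq_bigr => k _; rewrite indic_cell x0/=.
  by case: ifP; rewrite ?mul1r ?mul0r.
have phi1 i t l : normc (phi i t l) <= 1.
  by rewrite phiE; case: ifP => _; rewrite ?normc_cis// normc0.
have m1 i k : cmeas setT (fun t : R => (\1_(cell i k) t : R)%:C).
  by apply: cmeas_real; apply: measurable_indic; exact: measurable_cell.
have ic i k : cintegrable (fun t : R => rho t * (\1_(cell i k) t)%:C).
  apply: (cintegrableM_bounded (M := 1) irho (m1 i k)).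
  apply: ae_all => t; rewrite normc_real indicE; case: (_ \in _) => /=.
    by rewrite normr1.
  by rewrite normr0.
pose c i k := cintegral setT (fun t => rho t * (\1_(cell i k) t)%:C).
pose Gn i l := \sum_(k < ncell i) c i k * cis (tau i k * l).
have GnE i l : Gn i l = cintegral setT (fun t => rho t * phi i t l).
  rewrite /Gn /phi.
  have ick (k : 'I_(ncell i)) : cintegrable
      (fun t => cis (tau i k * l) * (rho t * (\1_(cell i k) t)%:C)).
    exact: cintegrableZ.
  transitivity (\sum_(k < ncell i) cintegral setT
      (fun t => cis (tau i k * l) * (rho t * (\1_(cell i k) t)%:C))).
    by apply: eq_bigr => k _; rewrite cintegralZ// mulrC.
  rewrite -(cintegral_sum ick).2; congr cintegral; apply/funext => t.
  by rewrite mulr_sumr; apply: eq_bigr => k _; rewrite mulrC mulrA.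
have mphi i l : cmeas setT (fun t => phi i t l).
  by apply: cmeas_sum => k; apply: cmeasM => //; exact: cmeas_cst.
have irp i l : cintegrable (fun t => rho t * phi i t l).
  by apply: (cintegrableM_bounded (M := 1) irho) => //; exact: ae_all.
apply: (L2s_bounded_limit w0 iw (M := 2 * \int[mu]_t normc (rho t)) (hn := Gn)) => //.
- by move=> i; exact: L2s_trig.
- move=> i l; rewrite GnE (le_trans (normc_cintegral_le (irp i l)))//.
  rewrite ler_wpM2l// le_Rintegral//.
  + by case: (irp i l).
  + by case: irho.
  + by move=> t _; rewrite normcM ler_piMr ?normc_ge0.
apply: ae_all => l; under eq_fun do rewrite GnE.
apply: (proj2 (@cdominated _ (fun i t => rho t * phi i t l)
  (fun t => rho t * cis (t * l)) (fun t => normc (rho t)) _ _ _ irho.2 _)).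
- by move=> i; case: (irp i l).
- apply: cmeasM; first by case: irho.
  by under eq_fun do rewrite mulrC; exact: cmeas_scale_cis.
- apply: ae_all => t.
  have [tobs|tnobs] := pselect (observed s N K t); last first.
    rewrite rho0//; under eq_fun do rewrite !mul0r subrr normc0.
    exact: cvg_cst.
  have near_in : \forall i \near \oo,
      (0 <= pos i t) && (Num.truncn (pos i t) < ncell i)%N.
    near=> i.
    have ti : `|t| < i.+1%:R.
      rewrite (@lt_le_trans _ _ i%:R) ?ler_nat//.
      by near: i; exact: nbhs_infty_gtr.
    have i0 : 0 < i.+1%:R :> R by rewrite ltr0n.
    move: ti; rewrite ltr_norml => /andP[t1 t2].
    have x0 : 0 <= pos i t by rewrite /pos mulr_ge0 ?ltW//; lra.
    rewrite x0/= truncn_lt_nat// /pos /ncell natrM ltr_pM2r//.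
    by rewrite natrM; lra.
  (* For an observed [t] the node lies in the same cell as [t], hence at distance less than
     1/(i+1). *)
  have ctau : tau i (Num.truncn (pos i t)) @[i --> \oo] --> t.
    apply/cvgrPdist_lt => e e0; near=> i.
    have /andP[x0 xlt] : (0 <= pos i t) && (Num.truncn (pos i t) < ncell i)%N.
      by near: i.
    have i0 : 0 < i.+1%:R :> R by rewrite ltr0n.
    have ct : cell i (Num.truncn (pos i t)) t by rewrite /cell /= truncn_itv.
    have /andP[h1 h2] := tau_cell _ _ _ ct tobs.
    have /andP[h3 h4] := truncn_itv x0.
    have ie : 1 < e * i.+1%:R.
      rewrite mulrC -ltr_pdivrMr// mul1r (@lt_le_trans _ _ i%:R) ?ler_nat//.
      by near: i; exact: nbhs_infty_gtr.
    set m := Num.truncn (pos i t) in h1 h2 h3 h4 *.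
    have mS : m.+1%:R = m%:R + 1 :> R by rewrite -addn1 natrD.
    rewrite mS in h2 h4.
    rewrite -(ltr_pM2r i0) -[X in _ * X](ger0_norm (ltW i0)) -normrM.
    rewrite (lt_trans _ ie)//.
    have -> : (t - tau i m) * i.+1%:R = pos i t - pos i (tau i m).
      by rewrite /pos; ring.
    by rewrite ltr_norml; apply/andP; split; lra.
  have c1 := cvg_normc_cis l ctau.
  have c2 : normc (phi i t l - cis (t * l)) @[i --> \oo] --> 0.
    apply: cvg_trans c1; apply: near_eq_cvg.
    by apply: filterS near_in => i hi; rewrite phiE hi.
  rewrite (_ : (fun i => _) = (fun i => normc (rho t) * normc (phi i t l - cis (t * l)))).
    by rewrite -(mulr0 (normc (rho t))); apply: cvgM => //; exact: cvg_cst.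
  by apply/funext => i; rewrite -mulrBr normcM.
- by apply: ae_all => t i; rewrite normcM ler_piMr ?normc_ge0.
Unshelve. all: by end_near. Qed.

End riemann_sums.

(** * Box averages *)

Section averaged_kernel.
Context {R : realType}.
Local Notation mu := (@lebesgue_measure R).

Lemma integral_ge0_shift (f : R -> R) (c : R) : measurable_fun setT f ->
  (forall x, 0 <= f x) -> (\int[mu]_x (f (x - c))%:E = \int[mu]_x (f x)%:E)%E.
Proof.
move=> mf f0.
have mS : measurable_fun setT (fun x : R => x - c).
  by apply: measurable_funB; [exact: measurable_id|exact: measurable_cst].
rewrite -[RHS](_ : \int[pushforward mu ((fun x : R => (x - c)%R) : R -> measurableTypeR R)]_x (f x)%:E = _)%E; last first.
  apply: eq_measure_integral => //= A mA _.
  apply/esym/lebesgue_measure_unique => //= _ [[a b]] _ <-.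
  rewrite /pushforward.
  have -> : (fun x : R => x - c) @^-1` `]a, b]%classic = `](a + c), (b + c)]%classic.
    by apply/seteqP; split => x; rewrite /= !in_itv/= ltrBrDr lerBlDr.
  rewrite !lebesgue_measure_itv/= !lte_fin ltrD2r.
  by case: ifP => // _; rewrite -!EFinB; congr EFin; ring.
rewrite ge0_integral_pushforward//.
  exact/measurable_EFinP.
by move=> y _; rewrite lee_fin.
Qed.

(* The mean over [v] in [0, r] of [pkernel e (z - v) / (2 * pi)]. Unlike the
   Poisson kernel itself it is bounded by an integrable function of [z]
   uniformly in [e], which allows dominated convergence as [e] tends to 0. *)
Definition mean_pkernel (e r z : R) : R := (pi * r)^-1 * (atan (z / e) - atan ((z - r) / e)).

Lemma derive_atan_shift (e z v : R) : 0 < e ->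
  is_derive v (1 : R) (fun v => - (2 * atan ((z - v) / e))) (pkernel e (z - v)).
Proof.
move=> e0.
have d1 : is_derive v (1 : R) (fun v => (z - v) / e) (- e^-1).
  by apply: is_derive_eq; rewrite /GRing.scale /=; ring.
have := @is_derive1_comp _ (fun y => -2 * atan y) _ v _ _ _ d1.
move=> /(_ (-2 * (1 + ((z - v) / e) ^+ 2)^-1)) H.
have {}H : is_derive v (1 : R) ((fun y => -2 * atan y) \o (fun v => (z - v) / e))
    (-2 * (1 + ((z - v) / e) ^+ 2)^-1 * - e^-1).
  apply: H; apply: is_derive_eq; rewrite /GRing.scale /=; ring.
have -> : (fun v => - (2 * atan ((z - v) / e))) =
    (fun y => -2 * atan y) \o (fun v => (z - v) / e).
  by apply/funext => y /=; rewrite mulNr.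
have -> // : pkernel e (z - v) = -2 * (1 + ((z - v) / e) ^+ 2)^-1 * - e^-1.
have H1 : 0 < e ^+ 2 + (z - v) ^+ 2 by rewrite ltr_pwDl ?exprn_gt0 ?sqr_ge0.
have -> : 1 + ((z - v) / e) ^+ 2 = (e ^+ 2 + (z - v) ^+ 2) / e ^+ 2.
  by field; rewrite gt_eqF.
by rewrite /pkernel; field; rewrite !gt_eqF.
Qed.

Lemma integral_pkernel_mean_pkernel (e r z : R) : 0 < e -> 0 < r ->
  (2 * pi * r)^-1 * \int[mu]_(v in `[0, r]) pkernel e (z - v) = mean_pkernel e r z.
Proof.
move=> e0 r0; rewrite /Rintegral.
have cF (v : R) : {for v, continuous (fun v => - (2 * atan ((z - v) / e)))}.
  apply: differentiable_continuous; apply/derivable1_diffP.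
  by case: (derive_atan_shift z v e0).
rewrite (@continuous_FTC2 _ _ (fun v => - (2 * atan ((z - v) / e)))) //.
- rewrite /= subr0 /mean_pkernel; have := pi_gt0 R; move: (pi : R) => p p0.
  by field; rewrite !gt_eqF.
- apply: continuous_subspaceT => v.
  have -> : (fun v => pkernel e (z - v)) = (fun v => pkernel e (v - z)).
    by apply/funext => y; rewrite -pkernelN opprB.
  exact: continuous_pkernel.
- split.
  + by move=> v _; case: (derive_atan_shift z v e0).
  + by apply: cvg_at_right_filter; exact: cF.
  + by apply: cvg_at_left_filter; exact: cF.
- by move=> v _; rewrite derive1E; case: (derive_atan_shift z v e0).
Qed.

Lemma mean_pkernel_ge0 (e r z : R) : 0 < e -> 0 < r -> 0 <= mean_pkernel e r z.
Proof.
move=> e0 r0; rewrite /mean_pkernel mulr_ge0 ?invr_ge0 ?mulr_ge0 ?pi_ge0 ?(ltW r0)//.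
by rewrite subr_ge0 le_atan// ler_pM2r ?invr_gt0// lerBlDr lerDl ltW.
Qed.

(** One summand for each region. For |z| < r + 1 the mean is at most 1/r and 1 + z^2 at most 1 + (r
    + 1)^2. For |z| >= r + 1 every v in [0, r] has |z - v| >= 1, and the quadratic decay of the
    kernel gives 8 (1 + r^2) / (1 + z^2) when e <= 1. *)
Definition mean_pkernel_bound (r : R) : R := r^-1 * (1 + (r + 1) ^+ 2) + 8 * (1 + r ^+ 2).

Lemma mean_pkernel_bound_ge0 (r : R) : 0 < r -> 0 <= mean_pkernel_bound r.
Proof.
move=> r0; rewrite /mean_pkernel_bound addr_ge0// mulr_ge0 ?invr_ge0 ?(ltW r0) ?addr_ge0 ?sqr_ge0//.
Qed.

Lemma mean_pkernel_le (e r z : R) : 0 < e -> e <= 1 -> 0 < r ->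
  mean_pkernel e r z <= mean_pkernel_bound r * (oneDsqr z)^-1.
Proof.
move=> e0 e1 r0; have pi0 := pi_gt0 R.
have Q0 : 0 < oneDsqr z by rewrite (lt_le_trans _ (oneDsqr_ge1 z)).
have [zr|zr] := ltP `|z| (r + 1).
  apply: (@le_trans _ _ r^-1).
    rewrite /mean_pkernel invfM mulrAC ler_piMl ?invr_ge0 ?(ltW r0)//.
    rewrite mulrC ler_pdivrMr// mul1r.
    have := atan_ltpi2 (z / e); have := atan_gtNpi2 ((z - r) / e); lra.
  rewrite ler_pdivlMr// /mean_pkernel_bound (@le_trans _ _ (r^-1 * (1 + (r + 1) ^+ 2)))//.
    rewrite ler_pM2l ?invr_gt0// /oneDsqr lerD2l -(real_normK (num_real z)).
    by rewrite ler_sqr ?nnegrE ?normr_ge0 ?(ltW zr)// ltW// addr_gt0.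
  by rewrite lerDl mulr_ge0 ?addr_ge0 ?sqr_ge0.
rewrite -integral_pkernel_mean_pkernel//.
set B := mean_pkernel_bound r * _.
have pt v : v \in `[0, r] -> pkernel e (z - v) <= B.
  rewrite in_itv/= => /andP[v0 vr].
  have wz : 1 <= (z - v) ^+ 2.
    rewrite -(real_normK (num_real (z - v))) exprn_ege1//.
    by have := lerB_dist z v; rewrite (ger0_norm v0); lra.
  apply: (@le_trans _ _ (8 * (1 + r ^+ 2) * (oneDsqr z)^-1)); last first.
    rewrite /B /mean_pkernel_bound ler_wpM2r ?invr_ge0 ?(ltW Q0)// lerDr.
    by rewrite mulr_ge0 ?invr_ge0 ?(ltW r0) ?addr_ge0 ?sqr_ge0.
  rewrite /pkernel ler_pdivrMr ?ltr_pwDl ?exprn_gt0 ?sqr_ge0// mulrAC ler_pdivlMr//.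
  have vr2 : v ^+ 2 <= r ^+ 2 by rewrite ler_sqr ?nnegrE// ltW.
  have zz : z ^+ 2 <= 2 * (z - v) ^+ 2 + 2 * v ^+ 2.
    by have := sqr_ge0 (z - v - v); nra.
  apply: (@le_trans _ _ (2 * (1 + z ^+ 2))).
    by rewrite /oneDsqr ler_wpM2r ?addr_ge0 ?sqr_ge0//; lra.
  apply: (@le_trans _ _ (8 * (1 + r ^+ 2) * (z - v) ^+ 2)).
    by have := sqr_ge0 r; nra.
  rewrite ler_wpM2l ?mulr_ge0 ?addr_ge0 ?sqr_ge0// lerDr sqr_ge0//.
have B0 : 0 <= B by rewrite mulr_ge0 ?mean_pkernel_bound_ge0 ?invr_ge0 ?ltW.
have H : \int[mu]_(v in `[0, r]) pkernel e (z - v) <= \int[mu]_(v in `[0, r]) B.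
  apply: le_Rintegral => //.
  - have -> : (fun v => pkernel e (z - v)) = (fun v => pkernel e (v - z)).
      by apply/funext => y; rewrite -pkernelN opprB.
    by apply: integrableS (integrable_pkernel z e0).
  - apply: continuous_compact_integrable; first exact: segment_compact.
    by apply: continuous_subspaceT => x; exact: cvg_cst.
rewrite Rintegral_cst//= lebesgue_measure_itv/= lte_fin r0/= subr0 in H.
apply: (@le_trans _ _ ((2 * pi * r)^-1 * (B * r))).
  by rewrite ler_wpM2l// invr_ge0 !mulr_ge0// ltW.
have -> : (2 * pi * r)^-1 * (B * r) = B / (2 * pi).
  by move: (pi : R) pi0 => p p0; field; rewrite !gt_eqF.
rewrite ler_piMr// invf_le1 ?mulr_gt0//; have := pi_ge2 R; lra.
Qed.

(** The arctangents tend to pi/2 or -pi/2 according to the signs of z and z - r. At the two excluded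
    endpoints the limit would be half the height of the box. *)
Lemma mean_pkernel_cvg (r z : R) : 0 < r -> z != 0 -> z != r ->
  mean_pkernel (n.+1%:R^-1) r z @[n --> \oo] --> r^-1 * (0 < z < r)%R%:R.
Proof.
move=> r0 z0 zr; have pi0 := pi_gt0 R.
have pos_cvg (y : R) : 0 < y -> atan (y / n.+1%:R^-1) @[n --> \oo] --> pi / 2.
  move=> y0; have h : (y / n.+1%:R^-1) @[n --> \oo] --> +oo.
    under eq_fun do rewrite invrK.
    apply/cvgryPge => A; near=> n.
    rewrite mulrC -ler_pdivrMr// (@le_trans _ _ n%:R) ?ler_nat//.
    by near: n; exact: nbhs_infty_ger.
  exact: (cvg_comp _ _ h (@cvgy_atan R)).
have neg_cvg (y : R) : y < 0 -> atan (y / n.+1%:R^-1) @[n --> \oo] --> - (pi / 2).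
  move=> y0; have -> : (fun n => atan (y / n.+1%:R^-1)) =
      (fun n => - atan (- y / n.+1%:R^-1)).
    by apply/funext => n; rewrite mulNr atanN opprK.
  by apply: cvgN; apply: pos_cvg; rewrite oppr_gt0.
have fin (a b : R) : atan (z / n.+1%:R^-1) @[n --> \oo] --> a ->
    atan ((z - r) / n.+1%:R^-1) @[n --> \oo] --> b ->
    (pi * r)^-1 * (a - b) = r^-1 * (0 < z < r)%R%:R ->
    mean_pkernel (n.+1%:R^-1) r z @[n --> \oo] --> r^-1 * (0 < z < r)%R%:R.
  by move=> ca cb <-; apply: cvgM; [exact: cvg_cst|exact: cvgB].
move: z0; rewrite neq_lt => /orP[zlt0|zgt0].
  apply: (fin _ _ (neg_cvg _ zlt0) (neg_cvg _ _)); first by lra.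
  by rewrite subrr mulr0 (lt_gtF zlt0) mulr0.
move: zr; rewrite neq_lt => /orP[zltr|zgtr].
  apply: (fin _ _ (pos_cvg _ zgt0) (neg_cvg _ _)); first by rewrite subr_lt0.
  by rewrite zgt0 zltr /=; move: (pi : R) pi0 => p p0; field; rewrite !gt_eqF.
apply: (fin _ _ (pos_cvg _ zgt0) (pos_cvg _ _)); first by rewrite subr_gt0.
by rewrite subrr mulr0 (lt_gtF zgtr) andbF mulr0.
Unshelve. all: by end_near. Qed.

Lemma continuous_mean_pkernel (e r t : R) : 0 < e -> continuous (fun u => mean_pkernel e r (u - t)).
Proof.
move=> e0 x.
have c (b : R) : {for x, continuous (fun u : R => atan ((u - b) / e))}.
  apply: (@continuous_comp _ _ _ (fun u : R => (u - b) / e) atan); last exact: continuous_atan.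
  have c1 : {for x, continuous (fun u : R => u - b)}.
    by apply: continuousB; [exact: cvg_id|exact: cvg_cst].
  by apply: continuousM => //; exact: cvg_cst.
have c2 : {for x, continuous (fun u : R => atan ((u - t - r) / e))}.
  have -> : (fun u => atan ((u - t - r) / e)) = (fun u => atan ((u - (t + r)) / e)).
    by apply/funext => u; rewrite opprD addrA.
  exact: c.
have c3 : {for x, continuous (fun=> (pi * r)^-1 : R)} by exact: cvg_cst.
exact: (continuousM c3 (continuousB (c t) c2)).
Qed.

End averaged_kernel.

Section averaging.
Context {R : realType}.
Local Notation mu := (@lebesgue_measure R).

Lemma cintegral_real (f : R -> R) :
  cintegral setT (fun t => (f t)%:C) = (\int[mu]_t f t)%:C.
Proof.
apply: complex_eqP; rewrite /cintegral //=.
by rewrite /Rintegral integral0.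
Qed.

(** The factor 1/(2 pi) normalises [pkernel], so that averaging against this weight produces
    [mean_pkernel]. *)
Definition box_weight (r v : R) : R := (2 * pi * r)^-1 * \1_(`[0, r]%classic) v.

Definition box_density (r v : R) : R[i] := (box_weight r v)%:C.

Lemma cintegrable_box_density r : cintegrable (box_density r).
Proof.
have mi : measurable_fun setT (\1_(`[0, r]%classic) : R -> R).
  by apply: measurable_indic; exact: measurable_itv.
have mb : measurable_fun setT (box_weight r).
  by apply: measurable_funM => //; exact: measurable_cst.
have ii : mu.-integrable setT (EFin \o (\1_(`[0, r]%classic) : R -> R)).
  exact: integrable_indic_itv.
apply: (cintegrable_dom (cmeas_real mb) (integrable_scale `|(2 * pi * r)^-1| ii)).
apply: ae_all => v; rewrite normc_real /box_weight normrM.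
by rewrite ler_wpM2l// ger0_norm// indicE.
Qed.

(** A shift of the frequency by v multiplies the density by e^{itv}, so averaging over v multiplies
    it by a function [S] of t alone. The averaged function is again an exponential integral whose
    density vanishes wherever [rho] does. *)
Lemma average_exp_integral (rho : R -> R[i]) (r : R) : cintegrable rho ->
  exists2 S : R -> R[i], cintegrable (fun t => rho t * S t) &
  forall l, cintegral setT (fun v => box_density r v *
      cintegral setT (fun t => rho t * cis (t * (l + v)))) =
    cintegral setT (fun t => rho t * S t * cis (t * l)).
Proof.
move=> irho; have isig := cintegrable_box_density r.
have mk (l : R) : cmeas setT (fun p : R * R => cis (p.2 * (l + p.1))).
  apply: cmeas_cis; apply: measurable_funM; first exact: measurable_snd.
  by apply: measurable_funD; [exact: measurable_cst|exact: measurable_fst].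
exists (fun t => cintegral setT (fun v => box_density r v * cis (t * v))).
  apply: (cintegrableM_bounded (M := 2 * \int[mu]_v normc (box_density r v)) irho).
    apply: (cmeas_cintegral_param (F := fun p => box_density r p.2 * cis (p.1 * p.2))).
    apply: cmeasM.
      case: isig => -[h1 h2] _.
      by split; [exact: (measurableT_comp h1 measurable_snd)|
        exact: (measurableT_comp h2 measurable_snd)].
    by apply: cmeas_cis; apply: measurable_funM;
      [exact: measurable_fst|exact: measurable_snd].
  apply: ae_all => t.
  have iv : cintegrable (fun v => box_density r v * cis (t * v)).
    apply: (cintegrableM_bounded (M := 1) isig (cmeas_scale_cis t)).
    by apply: ae_all => v; rewrite normc_cis.
  rewrite (le_trans (normc_cintegral_le iv))// ler_wpM2l// le_eqVlt.
  apply/orP; left; apply/eqP; apply: eq_Rintegral => v _.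
  by rewrite normcM normc_cis mulr1.
move=> l.
rewrite (@cFubini _ rho (box_density r) (fun p => cis (p.2 * (l + p.1))) 1)//; last first.
  by move=> v t; rewrite normc_cis.
congr cintegral; apply/funext => t; rewrite -mulrA; congr (_ * _).
rewrite [RHS]mulrC -cintegralZ; last first.
  apply: (cintegrableM_bounded (M := 1) isig (cmeas_scale_cis t)).
  by apply: ae_all => v; rewrite normc_cis.
congr cintegral; apply/funext => v /=.
by rewrite mulrDr cisD; ring.
Qed.

Lemma measurable_pkernel0 (e : R) : 0 < e -> measurable_fun setT (pkernel e).
Proof.
move=> /(measurable_pkernel 0); congr measurable_fun.
by apply/funext => u; rewrite subr0.
Qed.

(** As [h0] is merely bounded, Fubini is applied after a transfer of weight: [h0] divided by
    [oneDsqr] is integrable, and the Poisson kernel multiplied by [oneDsqr] stays bounded. *)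
Lemma average_pkernel (h0 : R -> R[i]) (M e r l : R) : cmeas setT h0 ->
  (forall u, normc (h0 u) <= M) -> 0 < e -> 0 < r ->
  cintegral setT (fun v => box_density r v *
    cintegral setT (fun u => h0 u * (pkernel e (u - (l + v)))%:C)) =
  cintegral setT (fun u => h0 u * (mean_pkernel e r (u - l))%:C).
Proof.
move=> mh hM e0 r0; have isig := cintegrable_box_density r.
pose rho u := h0 u * ((oneDsqr u)^-1)%:C.
have o0 (u : R) : 0 < oneDsqr u by rewrite (lt_le_trans _ (oneDsqr_ge1 u)).
have mo : measurable_fun setT (fun u : R => (oneDsqr u)^-1).
  by apply: continuous_measurable_fun => x; exact: continuous_oneDsqrV.
have irho : cintegrable rho.
  apply: (cintegrable_dom _ (integrable_scale M integrable_oneDsqr)).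
    by apply: cmeasM => //; exact: cmeas_real.
  apply: ae_all => u; rewrite normcM normc_real ger0_norm ?invr_ge0 ?(ltW (o0 u))//.
  by rewrite ler_wpM2r ?invr_ge0 ?(ltW (o0 u)).
(* The indicator repeats the one in [box_density] and leaves the product unchanged. It confines the
   centre l + v to |l + v| <= |l| + r, which bounds [kr] by the constant [C] taken from
   [pkernel_le_oneDsqr]. *)
pose kr (p : R * R) : R := \1_(`[0, r]%classic) p.1 * (oneDsqr p.2 * pkernel e (p.2 - (l + p.1))).
have mkr : measurable_fun setT kr.
  apply: measurable_funM.
    apply: (measurableT_comp _ measurable_fst).
    by apply: measurable_indic; exact: measurable_itv.
  apply: measurable_funM.
    apply: (measurableT_comp _ measurable_snd).
    by apply: continuous_measurable_fun; exact: continuous_oneDsqr.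
  apply: (measurableT_comp (measurable_pkernel0 e0)).
  apply: measurable_funB; first exact: measurable_snd.
  by apply: measurable_funD; [exact: measurable_cst|exact: measurable_fst].
pose C := 2 * e * (1 + e ^- 2) * (2 * (1 + (`|l| + r) ^+ 2)).
have krC v u : normc (kr (v, u))%:C <= C.
  have C0 : 0 <= C.
    rewrite /C !mulr_ge0 ?addr_ge0 ?sqr_ge0 ?invr_ge0 ?sqr_ge0// ltW//.
  rewrite normc_real /kr /= indicE.
  case: (boolP (v \in _)) => /=; last by rewrite mul0r normr0.
  rewrite inE/= in_itv/= mul1r => /andP[v0 vr].
  rewrite ger0_norm; last by rewrite mulr_ge0 ?pkernel_ge0// ltW.
  rewrite mulrC -ler_pdivlMr//.
  apply: (le_trans (pkernel_le_oneDsqr (l + v) u e0)).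
  apply: ler_wpM2r; first by rewrite invr_ge0 ltW.
  rewrite /C; apply: ler_wpM2l.
    by rewrite !mulr_ge0 ?addr_ge0 ?invr_ge0 ?sqr_ge0// ltW.
  rewrite ler_wpM2l// lerD2l -(real_normK (num_real (l + v))).
  rewrite ler_sqr ?nnegrE ?addr_ge0 ?(ltW r0)// (le_trans (ler_normD _ _))//.
  by rewrite lerD2l ger0_norm.
transitivity (cintegral setT (fun v => box_density r v *
    cintegral setT (fun u => rho u * (kr (v, u))%:C))).
  congr cintegral; apply/funext => v; rewrite /box_density /box_weight indicE.
  case: (boolP (v \in _)) => /= vr; last by rewrite mulr0 !mul0r.
  congr (_ * _); congr cintegral; apply/funext => u.
  rewrite /rho -mulrA -rmorphM /kr /= indicE vr /= mul1r mulrA.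
  by rewrite mulVf ?mul1r// gt_eqF.
rewrite (cFubini irho isig (cmeas_real mkr) krC).
congr cintegral; apply/funext => u; rewrite /rho -mulrA; congr (_ * _).
have -> : (fun v => box_density r v * (kr (v, u))%:C) =
    (fun v => ((2 * pi * r)^-1 * oneDsqr u * ((fun v => pkernel e (u - l - v)) \_ `[0, r]) v)%:C).
  apply/funext => v; rewrite /box_density /box_weight -rmorphM /kr /= patchE indicE.
  case: (boolP (v \in _)) => _ /=; last by rewrite !(mulr0, mul0r).
  by rewrite mulr1 mul1r mulrA opprD addrA.
rewrite cintegral_real -rmorphM /=; congr (_%:C).
have ik : mu.-integrable `[0, r] (EFin \o (fun v => pkernel e (u - l - v))).
  have -> : (fun v => pkernel e (u - l - v)) = (fun v => pkernel e (v - (u - l))).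
    by apply/funext => y; rewrite -pkernelN opprB.
  by apply: integrableS (integrable_pkernel (u - l) e0).
rewrite RintegralZl//; last first.
  rewrite -restrict_EFin; by rewrite integrable_mkcond in ik.
rewrite -Rintegral_mkcond -integral_pkernel_mean_pkernel//.
by move: (2 * pi * r)^-1 => c; field; rewrite gt_eqF.
Qed.

End averaging.

(** * One-sided means and Lebesgue differentiation *)

Section box_averages.
Context {R : realType}.
Local Notation mu := (@lebesgue_measure R).

Lemma bounded_locally_integrable (f : R -> R) (M : R) : measurable_fun setT f ->
  (forall x, `|f x| <= M) -> locally_integrable setT f.
Proof.
move=> mf fM; split => //; first exact: openT.
move=> A _ cA; have mA := compact_measurable cA.
apply: (@le_lt_trans _ _ (\int[mu]_(x in A) M%:E)%E).
  apply: ge0_le_integral => //.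
  - apply/measurable_EFinP; apply: measurableT_comp => //; exact: measurable_funTS.
  - by move=> x _; rewrite lee_fin.
rewrite integral_cst// lte_mul_pinfty// ?lee_fin.
  exact: le_trans (normr_ge0 (f 0)) (fM 0).
exact: compact_finite_measure.
Qed.

(** The mean of [h0] over []l, l + r[], in the form in which it arises as the limit of the integrals
    of [h0] against [mean_pkernel]. *)
Definition box_average (h0 : R -> R[i]) (r l : R) : R[i] :=
  cintegral setT (fun u => h0 u * (r^-1 * \1_(`]0, r[%classic) (u - l))%:C).

Lemma real_box_average_cvg (f : R -> R) (M : R) : measurable_fun setT f ->
  (forall x, `|f x| <= M) ->
  {ae mu, forall l, \int[mu]_u (f u * (n.+1%:R * \1_(`]0, n.+1%:R^-1[%classic) (u - l)))
    @[n --> \oo] --> f l}.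
Proof.
move=> mf fM; have lf := bounded_locally_integrable mf fM.
pose E (x : R) (n : nat) : set R := `]x, x + n.+1%:R^-1[%classic.
have n0 n : 0 < n.+1%:R^-1 :> R by rewrite invr_gt0.
have muE x n : mu (E x n) = (n.+1%:R^-1)%:E.
  by rewrite /E lebesgue_measure_itv/= lte_fin ltrDl n0 -EFinB addrAC subrr add0r.
have hE x : nicely_shrinking x (E x).
  split; first by move=> n; exact: measurable_itv.
  have p n : 0 < n.+1%:R^-1 :> R by [].
  (* The interval [E x n] has length 1/(n+1) and lies in the ball of radius 1/(n+1) about x, whose
     measure is twice as large. *)
  exists (2, fun n => PosNum (p n)) => /=; split => //.
  - exact: cvg_harmonic.
  - move=> n y; rewrite /E /= in_itv/= /ball/= => /andP[xy yx].
    by rewrite distrC ger0_norm ?subr_ge0 ?ltW// ltrBlDl.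
  - move=> n; rewrite muE lebesgue_measure_ball; last exact: ltW.
    by rewrite -EFinM mulr_natl.
have := lebesgue_differentiation lf; apply: ae_impl => l hl.
have := nice_lebesgue_differentiation hE lf hl => /fine_cvgP[_].
apply: cvg_trans; apply: near_eq_cvg; apply: nearW => n /=.
rewrite muE inver gt_eqF//= invrK.
have iE : mu.-integrable (E l n) (EFin \o f).
  apply: measurable_bounded_integrable => //.
  - exact: measurable_itv.
  - have h : (mu (E l n) < +oo)%E by rewrite muE ltry.
    exact: h.
  - exact: measurable_funTS.
  - exists M; split; first exact: num_real.
    by move=> x Mx y _ /=; rewrite (le_trans (fM y))// ltW.
have mE : measurable (E l n) by exact: measurable_itv.
have fE : (\int[mu]_(y in E l n) (f y)%:E)%E \is a fin_num.
  by apply: (@integrable_fin_num _ _ R mu); [exact: mE|exact: iE].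
rewrite fineM//.
rewrite -[fine (\int[_]_(y in _) _)]/(\int[mu]_(y in E l n) f y) /=.
rewrite -RintegralZl//.
rewrite Rintegral_mkcond; apply: eq_Rintegral => u _.
rewrite patchE indicE mulrCA.
have -> : ((u - l) \in `]0, n.+1%:R^-1[%classic) = (u \in E l n).
  by apply/idP/idP; rewrite !inE /E /= !in_itv/= subr_gt0 ltrBlDl.
by case: (_ \in _); rewrite /= ?mulr1 ?mulr0.
Qed.

Lemma cmeas_box_integrand (h0 : R -> R[i]) (r : R) : cmeas setT h0 ->
  cmeas setT (fun p : R * R => h0 p.2 * (r^-1 * \1_(`]0, r[%classic) (p.2 - p.1))%:C).
Proof.
move=> [rh jh]; apply: cmeasM.
  by split; [exact: (measurableT_comp rh measurable_snd)|
    exact: (measurableT_comp jh measurable_snd)].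
apply: cmeas_real; apply: measurable_funM; first exact: measurable_cst.
have mi : measurable_fun setT (\1_(`]0, r[%classic) : R -> R).
  by apply: measurable_indic; exact: measurable_itv.
apply: (measurableT_comp mi).
by apply: measurable_funB; [exact: measurable_snd|exact: measurable_fst].
Qed.

Lemma cmeas_box_average (h0 : R -> R[i]) (r : R) : cmeas setT h0 ->
  cmeas setT (box_average h0 r).
Proof.
move=> mh; exact: (cmeas_cintegral_param (cmeas_box_integrand r mh)).
Qed.

Lemma box_integrand_integrable (h0 : R -> R[i]) (M r l : R) : cmeas setT h0 ->
  (forall u, normc (h0 u) <= M) -> 0 < r ->
  cintegrable (fun u => h0 u * (r^-1 * \1_(`]0, r[%classic) (u - l))%:C) /\
  \int[mu]_u normc (h0 u * (r^-1 * \1_(`]0, r[%classic) (u - l))%:C) <= M.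
Proof.
move=> mh hM r0.
have M0 : 0 <= M by rewrite (le_trans (normc_ge0 (h0 0)) (hM 0)).
have E u : r^-1 * \1_(`]0, r[%classic) (u - l) = r^-1 * \1_(`]l, l + r[%classic) u :> R.
  rewrite !indicE; congr (_ * (nat_of_bool _)%:R).
  by apply/idP/idP; rewrite !inE /= !in_itv/= subr_gt0 ltrBlDl.
have mi : measurable_fun setT (\1_(`]l, l + r[%classic) : R -> R).
  by apply: measurable_indic; exact: measurable_itv.
have ii : mu.-integrable setT (EFin \o (\1_(`]l, l + r[%classic) : R -> R)).
  exact: integrable_indic_itv.
have iMr := integrable_scale (M * r^-1) ii.
have bnd u : normc (h0 u * (r^-1 * \1_(`]0, r[%classic) (u - l))%:C) <=
    M * r^-1 * \1_(`]l, l + r[%classic) u.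
  rewrite E normcM normc_real ger0_norm; last by rewrite mulr_ge0 ?invr_ge0 ?(ltW r0).
  by rewrite -mulrA ler_wpM2r// mulr_ge0 ?invr_ge0 ?(ltW r0).
have ih : cintegrable (fun u => h0 u * (r^-1 * \1_(`]0, r[%classic) (u - l))%:C).
  apply: (cintegrable_dom _ iMr); last exact: ae_all.
  under eq_fun do rewrite E; apply: cmeasM => //; apply: cmeas_real.
  by apply: measurable_funM => //; exact: measurable_cst.
split => //.
have := le_Rintegral measurableT ih.2 iMr (fun u _ => bnd u).
move/le_trans; apply; rewrite RintegralZl//.
rewrite /Rintegral integral_indic//= setIT lebesgue_measure_itv/= lte_fin ltrDl r0/=.
by rewrite addrAC subrr add0r divfK// gt_eqF.
Qed.

Lemma box_average_bound (h0 : R -> R[i]) (M r l : R) : cmeas setT h0 ->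
  (forall u, normc (h0 u) <= M) -> 0 < r -> normc (box_average h0 r l) <= 2 * M.
Proof.
move=> mh hM r0; have [ih hle] := box_integrand_integrable l mh hM r0.
by rewrite (le_trans (normc_cintegral_le ih))// ler_wpM2l.
Qed.

Lemma box_average_cvg (h0 : R -> R[i]) (M : R) : cmeas setT h0 ->
  (forall u, normc (h0 u) <= M) ->
  {ae mu, forall l, normc (box_average h0 n.+1%:R^-1 l - h0 l) @[n --> \oo] --> 0}.
Proof.
move=> [rh jh] hM.
have rc := real_box_average_cvg rh (fun x => le_trans (le_Re_normc _) (hM x)).
have jc := real_box_average_cvg jh (fun x => le_trans (le_Im_normc _) (hM x)).
apply: ae_impl2 rc jc => l rc jc.
have RE n : complex.Re (box_average h0 n.+1%:R^-1 l) = \int[mu]_u (complex.Re (h0 u) *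
    (n.+1%:R * \1_(`]0, n.+1%:R^-1[%classic) (u - l))).
  by apply: eq_Rintegral => u _; rewrite ReM /= mulr0 subr0 invrK.
have IE n : complex.Im (box_average h0 n.+1%:R^-1 l) = \int[mu]_u (complex.Im (h0 u) *
    (n.+1%:R * \1_(`]0, n.+1%:R^-1[%classic) (u - l))).
  by apply: eq_Rintegral => u _; rewrite ImM /= mulr0 add0r invrK.
apply: (@squeeze_cvgr _ _ _ _ (fun=> 0)
  (fun n => `|\int[mu]_u (complex.Re (h0 u) *
      (n.+1%:R * \1_(`]0, n.+1%:R^-1[%classic) (u - l))) - complex.Re (h0 l)| +
    `|\int[mu]_u (complex.Im (h0 u) *
      (n.+1%:R * \1_(`]0, n.+1%:R^-1[%classic) (u - l))) - complex.Im (h0 l)|)).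
- apply: nearW => n; rewrite normc_ge0 andTb (le_trans (normc_le_ReIm _))//.
  by rewrite ReD ReN ImD ImN RE IE.
- exact: cvg_cst.
- by rewrite -[X in _ --> X]addr0; apply: cvgD; exact: cvg_normrB.
Qed.

End box_averages.

(** * Functions whose transform is carried by T or by its complement *)

Section index_set_facts.
Context {R : realType}.
Variables (s : nat) (N K : nat -> R).

Lemma measurable_missing : measurable (missing s N K).
Proof.
have -> : missing s N K = \bigcup_(l in [set l | (1 <= l)%N /\ (l <= s)%N])
    `[- M_ N K l - N l, - M_ N K l]%classic.
  apply/seteqP; split => t /=.
    by move=> [l [h1 h2 h3]]; exists l => //=; rewrite in_itv.
  by move=> [l /= [h1 h2]]; rewrite in_itv => h3; exists l.
by apply: bigcup_measurable => l _; exact: measurable_itv.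
Qed.

Lemma measurable_missing_plus : measurable (missing_plus s N K).
Proof.
have -> : missing_plus s N K = \bigcup_(l in [set l | (1 <= l)%N /\ (l <= s)%N])
    `[M_ N K l, M_ N K l + N l]%classic.
  apply/seteqP; split => t /=.
    by move=> [l [h1 h2 h3]]; exists l => //=; rewrite in_itv.
  by move=> [l /= [h1 h2]]; rewrite in_itv => h3; exists l.
by apply: bigcup_measurable => l _; exact: measurable_itv.
Qed.

Lemma measurable_ge0 : measurable [set t : R | 0 <= t].
Proof.
have -> : [set t : R | 0 <= t] = `[0, +oo[%classic.
  by apply/seteqP; split => t /=; rewrite in_itv/= andbT.
exact: measurable_itv.
Qed.

Lemma measurable_Rs : measurable (Rs s N K).
Proof. by apply: measurableD; [exact: measurable_ge0|exact: measurable_missing_plus]. Qed.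

Lemma measurable_Tset : measurable (Tset s N K).
Proof. by apply: measurableU; [exact: measurable_missing|exact: measurable_ge0]. Qed.

Lemma measurable_observed : measurable (observed s N K).
Proof.
apply: measurableD; last exact: measurable_missing.
have -> : [set t : R | t < 0] = `]-oo, 0[%classic.
  by apply/seteqP; split => t /=; rewrite in_itv.
exact: measurable_itv.
Qed.

Lemma not_observed t : ~ observed s N K t -> Tset s N K t.
Proof.
move=> nobs; have [t0|t0] := leP 0 t; first by right.
by left; apply: contrapT => nm; apply: nobs; split.
Qed.

(** T is a finite union of closed intervals and a closed half-line, so it is closed; the induction
    takes the minimum of finitely many positive distances, and [- t] is the distance to the
    half-line. *)
Lemma observed_distance t : observed s N K t ->
  exists2 delta, 0 < delta & forall u, Tset s N K u -> delta <= `|u - t|.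
Proof.
move=> [/= t0 nm].
have [d d0 dm] : exists2 d, 0 < d & forall u, missing s N K u -> d <= `|u - t|.
  have nml l : (1 <= l)%N -> (l <= s)%N -> ~ (- M_ N K l - N l <= t <= - M_ N K l).
    by move=> l1 l2 h; apply: nm; exists l.
  have : forall n, (n <= s)%N -> exists2 d, 0 < d & forall u l, (1 <= l)%N -> (l <= n)%N ->
      - M_ N K l - N l <= u <= - M_ N K l -> d <= `|u - t|.
    elim => [_|n ih ns]; first by exists 1 => // u l h1 h2; case: l h1 h2.
    have [d d0 hd] := ih (ltnW ns).
    have [d' d'0 hd'] : exists2 d', 0 < d' & forall u,
        - M_ N K n.+1 - N n.+1 <= u <= - M_ N K n.+1 -> d' <= `|u - t|.
      have [h|h] := ltP t (- M_ N K n.+1 - N n.+1).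
        exists (- M_ N K n.+1 - N n.+1 - t); first by rewrite subr_gt0.
        by move=> u /andP[h1 h2]; rewrite (le_trans _ (ler_norm _))// lerD2r.
      have [h'|h'] := ltP (- M_ N K n.+1) t; last first.
        by exfalso; apply: (nml n.+1) => //; rewrite h h'.
      exists (t - - M_ N K n.+1); first by rewrite subr_gt0.
      by move=> u /andP[h1 h2]; rewrite distrC (le_trans _ (ler_norm _))// lerD2l lerN2.
    exists (Num.min d d'); first by rewrite lt_min d0.
    move=> u l l1; rewrite leq_eqVlt => /orP[/eqP ->|ln] hu.
      by rewrite ge_min hd' ?orbT.
    by rewrite ge_min (hd u l).
  move=> /(_ s (leqnn s))[d d0 hd]; exists d => // u [l [h1 h2 h3]].
  exact: (hd u l).
exists (Num.min d (- t)); first by rewrite lt_min d0 oppr_gt0.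
move=> u [um|/= u0]; first by rewrite ge_min dm.
have h : - t <= `|u - t| by rewrite (le_trans _ (ler_norm _))// lerDr.
by rewrite ge_min h orbT.
Qed.

End index_set_facts.

(** * Transforms carried by T are orthogonal to the observed exponentials *)

Section spectral_support.
Context {R : realType}.
Local Notation mu := (@lebesgue_measure R).
Variables (s : nat) (N K : nat -> R).

Lemma cvg_normc_unique (a : nat -> R[i]) (b c : R[i]) :
  normc (a n - b) @[n --> \oo] --> 0 -> normc (a n - c) @[n --> \oo] --> 0 -> b = c.
Proof.
move=> /cvgrPdist_lt hb /cvgrPdist_lt hc.
apply/eqP; rewrite -subr_eq0; apply/eqP; apply: eq0_normc; apply/eqP.
rewrite eq_le normc_ge0 andbT; apply/ler_addgt0Pr => d d0; rewrite add0r.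
have d2 : 0 < d / 2 by rewrite divr_gt0.
have [n _ /(_ n (leqnn n))[h1 h2]] := filterI (hb _ d2) (hc _ d2).
move: h1 h2; rewrite !sub0r !normrN !ger0_norm ?normc_ge0// => h1 h2.
have -> : b - c = (a n - c) - (a n - b) by ring.
by rewrite (le_trans (ler_normcB _ _))//; lra.
Qed.

Lemma invnS_gt0 n : 0 < n.+1%:R^-1 :> R.
Proof. by rewrite invr_gt0. Qed.

Lemma invnS_le1 n : n.+1%:R^-1 <= 1 :> R.
Proof. by rewrite invf_le1// ler1n. Qed.

(** Damped inversion at [t] equates a damped integral of [C] with the Poisson integral of [x]
    centred at [t]. As e -> 0 the former tends to the integral claimed, because [C] is integrable,
    and the latter to 0, because [x] is carried at positive distance from [t]. *)
Lemma fourier_orthogonal (x C : R -> R[i]) (t : R) : inL2 (Tset s N K) x ->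
  fourier (Tset s N K) 1 x C -> cintegrable C -> observed s N K t ->
  cintegral setT (fun l => cis (- t * l) * C l) = 0.
Proof.
move=> lx FC iC tobs; have mT := measurable_Tset s N K.
have [d d0 hd] := observed_distance tobs.
have lxT := (inL2E x mT).1 lx.
pose xT := cres (Tset s N K) x.
have inv n := damped_inversion (e := n.+1%:R^-1) t mT (expr1n R 2) (invnS_gt0 n) FC.
have mc : cmeas setT (fun l => cis (- t * l) * C l).
  by apply: cmeasM; [exact: cmeas_scale_cis|case: iC].
have c1 : normc (cintegral setT (fun l => damp n.+1%:R^-1 (- (1 * t)) l * C l) -
    cintegral setT (fun l => cis (- t * l) * C l)) @[n --> \oo] --> 0.
  apply: (proj2 (@cdominated _ (fun n l => damp n.+1%:R^-1 (- (1 * t)) l * C l)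
    (fun l => cis (- t * l) * C l) (fun l => normc (C l)) _ mc _ iC.2 _)).
  - by move=> n; apply: cmeasM; [exact: cmeas_damp|case: iC].
  - apply: ae_all => l.
    have c0 : expabs n.+1%:R^-1 l @[n --> \oo] --> (1 : R).
      have a0 : - (n.+1%:R^-1 * `|l|) @[n --> \oo] --> (0 : R).
        rewrite -oppr0; apply: cvgN; rewrite -(mul0r `|l|).
        by apply: cvgM; [exact: cvg_harmonic|exact: cvg_cst].
      by have := cvg_comp _ _ a0 (@continuous_expR R 0); rewrite expR0.
    have := cvg_normrB c0 => {}c0.
    rewrite (_ : (fun n => _) = (fun n => `|expabs n.+1%:R^-1 l - 1| * normc (C l))).
      by rewrite -(mul0r (normc (C l))); apply: cvgM => //; exact: cvg_cst.
    apply/funext => n; rewrite /damp mul1r.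
    rewrite (_ : _ - _ = ((expabs n.+1%:R^-1 l)%:C - 1) * cis (- t * l) * C l); last by ring.
    by rewrite !normcM normc_cis mulr1 -(rmorph1 (real_complex R)) -rmorphB normc_real.
  - apply: ae_all => l n; rewrite normcM normc_damp ler_piMl ?normc_ge0//.
    by rewrite expabs_le1// ltW// invnS_gt0.
have c2 : normc (cintegral setT (fun l => damp n.+1%:R^-1 (- (1 * t)) l * C l) - 0)
    @[n --> \oo] --> 0.
  have c0 : cintegral setT (fun=> 0 : R[i]) = 0.
    by rewrite /cintegral /Rintegral /= integral0.
  rewrite (_ : (fun n => _) = (fun n =>
      normc (cintegral setT (fun u => xT u * (pkernel n.+1%:R^-1 (u - t))%:C) -
        cintegral setT (fun=> 0)))); last first.
    by apply/funext => n; have [_ _ ->] := inv n; rewrite c0.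
  (* The majorant uniform in e <= 1: with z = (u - t)^2 >= d^2 one has 2e / (e^2 + z) <= 2 / z <= (1
     + d^-2) 2 / (1 + z), and the last quotient is the Poisson kernel at e = 1. *)
  have ig : mu.-integrable setT (EFin \o (fun u => (1 + d ^- 2) *
      normc (xT u * (pkernel 1 (u - t))%:C))).
    by apply: integrable_scale; case: (cL2M lxT (cL2_pkernel t ltr01)).
  have xd u : (1 : R) * d ^+ 2 <= (u - t) ^+ 2 \/ xT u = 0.
    rewrite /xT /cres; case: ifPn => [/set_mem uT|_]; last by right.
    left; rewrite mul1r -(real_normK (num_real (u - t))) ler_sqr ?nnegrE ?(ltW d0)//.
    exact: hd.
  apply: (proj2 (@cdominated _ (fun n u => xT u * (pkernel n.+1%:R^-1 (u - t))%:C)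
    (fun=> 0) _ _ _ _ ig _)).
  - by move=> n; have [_ [? _] _] := inv n.
  - exact: cmeas_cst.
  - apply: ae_all => u; case: (xd u) => [hu|->]; last first.
      by under eq_fun do rewrite mul0r subr0 normc0; exact: cvg_cst.
    have u0 : 0 < (u - t) ^+ 2 by rewrite (lt_le_trans _ hu)// mul1r exprn_gt0.
    have ch : normc (xT u) * (2 * n.+1%:R^-1 / (u - t) ^+ 2) @[n --> \oo] --> (0 : R).
      rewrite -(mulr0 (normc (xT u))); apply: cvgM; first exact: cvg_cst.
      rewrite -(mul0r ((u - t) ^+ 2)^-1); apply: cvgM; last exact: cvg_cst.
      by rewrite -(mulr0 (2 : R)); apply: cvgM; [exact: cvg_cst|exact: cvg_harmonic].
    apply: (@squeeze_cvgr _ _ _ _ (fun=> 0) (fun n => normc (xT u) * (2 * n.+1%:R^-1 / (u - t) ^+ 2))).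
    + apply: nearW => n; rewrite normc_ge0 andTb subr0 normcM normc_pkernel ?invnS_gt0//.
      rewrite ler_wpM2l ?normc_ge0// /pkernel ler_wpM2l//.
      have P0 : 0 < n.+1%:R^-1 ^+ 2 + (u - t) ^+ 2.
        by rewrite addr_gt0// exprn_gt0// invnS_gt0.
      by rewrite lef_pV2 ?posrE// lerDr sqr_ge0.
    + exact: cvg_cst.
    + exact: ch.
  - apply: ae_all => u n; rewrite !normcM normc_pkernel ?invnS_gt0// normc_pkernel//.
    case: (xd u) => [hu|->]; last by rewrite normc0 !mul0r mulr0.
    apply: (@le_trans _ _ (normc (xT u) * ((1 + d ^- 2) * pkernel 1 (u - t)))); last first.
      by rewrite mulrCA.
    apply: ler_wpM2l; first exact: normc_ge0.
    have z0 : 0 < (u - t) ^+ 2 by rewrite (lt_le_trans _ hu)// mul1r exprn_gt0.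
    rewrite /pkernel; move: hu z0; rewrite mul1r; move: ((u - t) ^+ 2) => z hu z0.
    have e0 := invnS_gt0 n; have e1 := invnS_le1 n.
    move: (n.+1%:R^-1) e0 e1 => e e0 e1.
    apply: (@le_trans _ _ (2 / z)).
      rewrite -!mulrA ler_pM2l//.
      rewrite ler_pdivrMr ?addr_gt0 ?exprn_gt0//.
      rewrite mulrC ler_pdivlMr//.
      by have := exprn_gt0 2 e0; nra.
    have H : 1 <= d ^- 2 * z by rewrite mulrC ler_pdivlMr ?exprn_gt0// mul1r.
    rewrite mulr1 expr1n mulrCA ler_pM2l// ler_pdivlMr ?addr_gt0//.
    by rewrite mulrC ler_pdivrMr// mulrDl mul1r addrC lerD2l.
exact: cvg_normc_unique c1 c2.
Qed.

End spectral_support.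

(** * Bounded functions whose transform vanishes on T *)

Section synthesis.
Context {R : realType}.
Local Notation mu := (@lebesgue_measure R).
Variables (s : nat) (N K : nat -> R) (w : R -> R).
Hypothesis w0 : forall l, 0 <= w l.
Hypothesis iw : mu.-integrable setT (EFin \o w).

(** With [r] fixed, the integrals of [h0] against [mean_pkernel] are averaged Poisson integrals,
    hence exponential integrals over observation times. As e -> 0 they converge boundedly to the box
    average, the majorant being a translate of a multiple of 1 / (1 + u^2), whose integral does not
    depend on [l]. *)
Lemma L2s_box_average (h0 : R -> R[i]) (M r : R) : cmeas setT h0 ->
  (forall u, normc (h0 u) <= M) -> 0 < r ->
  (forall e, 0 < e -> exists2 rho : R -> R[i], cintegrable rho &
    (forall t, ~ observed s N K t -> rho t = 0) /\
    forall l, cintegral setT (fun u => h0 u * (pkernel e (u - l))%:C) =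
      cintegral setT (fun t => rho t * cis (t * l))) ->
  L2s s N K w (box_average h0 r).
Proof.
move=> mh hM r0 hrho.
have M0 : 0 <= M by rewrite (le_trans (normc_ge0 (h0 0)) (hM 0)).
have B0 := mean_pkernel_bound_ge0 r0.
pose g (u : R) : R := M * mean_pkernel_bound r * (oneDsqr u)^-1.
have mo : measurable_fun setT (fun u : R => (oneDsqr u)^-1).
  by apply: continuous_measurable_fun => x; exact: continuous_oneDsqrV.
have mg : measurable_fun setT g.
  by apply: measurable_funM => //; exact: measurable_cst.
have g0 u : 0 <= g u by rewrite mulr_ge0 ?mulr_ge0 ?invr_ge0.
have ig0 : mu.-integrable setT (EFin \o g) by exact: (integrable_scale _ integrable_oneDsqr).
have Eg l : (\int[mu]_u (g (u - l))%:E = \int[mu]_u (g u)%:E)%E.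
  exact: integral_ge0_shift.
have mgl l : measurable_fun setT (fun u : R => g (u - l)).
  by apply: (measurableT_comp mg); apply: measurable_funB;
    [exact: measurable_id|exact: measurable_cst].
have ig l : mu.-integrable setT (EFin \o (fun u => g (u - l))).
  apply/integrableP; split; first by apply/measurable_EFinP; exact: (mgl l).
  under eq_integral do rewrite /= ger0_norm//.
  by rewrite Eg; exact: (integrable_lty measurableT ig0).
have mavk n l : cmeas setT (fun u : R => (mean_pkernel n.+1%:R^-1 r (u - l))%:C).
  apply: cmeas_real.
  have c := continuous_mean_pkernel (r := r) (t := l) (invnS_gt0 n).
  by apply: continuous_measurable_fun => x; exact: c.
have bnd n l u : normc (h0 u * (mean_pkernel n.+1%:R^-1 r (u - l))%:C) <= g (u - l).
  rewrite normcM normc_real ger0_norm ?mean_pkernel_ge0 ?invnS_gt0//.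
  rewrite /g -mulrA; apply: ler_pM; rewrite ?normc_ge0 ?mean_pkernel_ge0 ?invnS_gt0//.
  by rewrite mean_pkernel_le ?invnS_gt0 ?invnS_le1.
have ih n l : cintegrable (fun u => h0 u * (mean_pkernel n.+1%:R^-1 r (u - l))%:C).
  by apply: (cintegrable_dom _ (ig l)); [exact: (cmeasM mh (mavk n l))|exact: ae_all].
pose hn n l := cintegral setT (fun u => h0 u * (mean_pkernel n.+1%:R^-1 r (u - l))%:C).
apply: (L2s_bounded_limit w0 iw (M := 2 * \int[mu]_u g u) (hn := hn)).
- move=> n; have [rho irho [rho0 hE]] := hrho _ (invnS_gt0 n).
  have [S irS hS] := average_exp_integral r irho.
  have -> : hn n = (fun l => cintegral setT (fun t => rho t * S t * cis (t * l))).
    apply/funext => l; rewrite /hn -(average_pkernel l mh hM (invnS_gt0 n) r0) -hS.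
    by congr cintegral; apply/funext => v; rewrite hE.
  apply: L2s_exp_integral => // t nobs.
  by rewrite rho0 ?mul0r.
- exact: cmeas_box_average.
- move=> n l; rewrite (le_trans (normc_cintegral_le (ih n l)))// ler_wpM2l//.
  have -> : \int[mu]_u g u = \int[mu]_u g (u - l) by rewrite /Rintegral Eg.
  by apply: le_Rintegral => //; case: (ih n l).
- apply: ae_all => l; rewrite /box_average.
  apply: (proj2 (@cdominated _ (fun n u => h0 u * (mean_pkernel n.+1%:R^-1 r (u - l))%:C)
    (fun u => h0 u * (r^-1 * \1_(`]0, r[%classic) (u - l))%:C) (fun u => g (u - l)) _ _ _ (ig l) _)).
  + by move=> n; case: (ih n l).
  + by case: (box_integrand_integrable l mh hM r0) => -[].
  (* The endpoints u = l and u = l + r, where the limit is not the box function, form a null set. *)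
  + have nl (x : R) : {ae mu, forall u, u != x}.
      exists [set x]; split; [exact: measurable_set1|exact: lebesgue_measure_set1|].
      by move=> u /= /negP; rewrite negbK => /eqP.
    apply: ae_impl2 (nl l) (nl (l + r)) => u ul ulr.
    have z0 : u - l != 0 by rewrite subr_eq0.
    have zr : u - l != r by rewrite subr_eq addrC.
    have := cvg_normrB (mean_pkernel_cvg r0 z0 zr) => c0.
    rewrite (_ : (fun n => _) = (fun n => normc (h0 u) *
        `|mean_pkernel n.+1%:R^-1 r (u - l) - r^-1 * (0 < u - l < r)%R%:R|)).
      by rewrite -[X in _ --> X](mulr0 (normc (h0 u))); apply: cvgM; [exact: cvg_cst|exact: c0].
    apply/funext => n; rewrite -mulrBr normcM -rmorphB normc_real indicE.
    have -> // : ((u - l) \in `]0, r[%classic) = (0 < u - l < r)%R.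
    by apply/idP/idP; rewrite inE /= in_itv.
  + by apply: ae_all => u n; exact: bnd.
Qed.

Lemma L2s_bounded_synthesis (h0 : R -> R[i]) (M : R) : cmeas setT h0 ->
  {ae mu, forall u, normc (h0 u) <= M} ->
  (forall e, 0 < e -> exists2 rho : R -> R[i], cintegrable rho &
    (forall t, ~ observed s N K t -> rho t = 0) /\
    forall l, cintegral setT (fun u => h0 u * (pkernel e (u - l))%:C) =
      cintegral setT (fun t => rho t * cis (t * l))) ->
  L2s s N K w h0.
Proof.
move=> mh hM hrho.
(* The lemmas on box averages ask for a bound everywhere. Setting [h0] to zero where its bound fails
   changes it on a null set only. *)
pose h1 := cres [set u | normc (h0 u) <= M] h0.
have mset : measurable [set u | normc (h0 u) <= M].
  have := measurable_normc mh measurableT (measurable_itv `]-oo, M]).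
  by rewrite setTI; congr measurable; apply/seteqP; split => u; rewrite /= in_itv.
have h01 : {ae mu, forall u, h0 u = h1 u}.
  by apply: ae_impl hM => u hu; rewrite /h1 /cres mem_set.
have mh1 : cmeas setT h1.
  apply/(cmeas_cresP h0 mset).
  by case: mh => ? ?; split; exact: measurable_funTS.
have h1M u : normc (h1 u) <= `|M|.
  rewrite /h1 /cres; case: ifPn => [/set_mem /= h|_].
    exact: le_trans h (ler_norm _).
  by rewrite normc0.
suff L1 : L2s s N K w h1 by apply: (L2s_ae iw mh _ L1); apply: ae_impl h01 => u ->.
apply: (L2s_bounded_limit w0 iw (M := 2 * `|M|) (hn := fun n => box_average h1 n.+1%:R^-1)) => //.
- move=> n; apply: (L2s_box_average mh1 h1M (invnS_gt0 n)) => e e0.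
  have [rho irho [rho0 hE]] := hrho e e0; exists rho => //; split => // l.
  rewrite -hE; apply: cintegral_ae.
  + by apply: cmeasM => //; exact: cmeas_pkernel.
  + by apply: cmeasM => //; exact: cmeas_pkernel.
  + by apply: ae_impl h01 => u ->.
- by move=> n l; apply: box_average_bound => //; exact: invnS_gt0.
- exact: box_average_cvg.
Qed.

Lemma fourier_cmeas_arg (sgn : R) x X : fourier setT sgn x X -> cmeas setT x.
Proof. by case=> [[[]]|[[]]]. Qed.

(** The density is e^{-e|t|} (Y1 - Y2)(t), and cutting it to the observation times removes only a
    null set. Two functions [x1] and [x2] appear because one transform may be absolutely convergent
    and the other an L_2 limit, so their difference need not fall under either case of [fourier]. *)
Lemma L2s_fourier_support (h0 x1 x2 Y1 Y2 : R -> R[i]) (M : R) : cmeas setT h0 ->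
  {ae mu, forall u, normc (h0 u) <= M} ->
  fourier setT (-1) x1 Y1 -> fourier setT (-1) x2 Y2 ->
  {ae mu, forall t, Tset s N K t -> Y1 t = Y2 t} ->
  {ae mu, forall u, h0 u = x1 u - x2 u} ->
  L2s s N K w h0.
Proof.
move=> mh hM F1 F2 Y12 h0E; apply: (L2s_bounded_synthesis mh hM) => e e0.
have s2 : (-1 : R) ^+ 2 = 1 by rewrite sqrrN expr1n.
have mO := measurable_observed s N K.
have mY1 := fourier_cmeas measurableT F1; have mY2 := fourier_cmeas measurableT F2.
have mx1 := fourier_cmeas_arg F1; have mx2 := fourier_cmeas_arg F2.
pose D (t : R) : R[i] := damp e 0 t * (Y1 t - Y2 t).
have dampE c t : damp e c t = damp e 0 t * cis (c * t).
  by rewrite /damp mul0r cis0 mulr1.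
have I1 l := damped_inversion l measurableT s2 e0 F1.
have I2 l := damped_inversion l measurableT s2 e0 F2.
have mD : cmeas setT D by apply: cmeasM; [exact: cmeas_damp|exact: cmeasB].
have iD : cintegrable D.
  have [h1 _ _] := I1 0; have [h2 _ _] := I2 0.
  have := cintegrableD h1 (cintegrableZ (-1) h2).
  have -> // : (fun l => damp e (- (-1 * 0)) l * Y1 l + -1 * (damp e (- (-1 * 0)) l * Y2 l)) = D.
  by apply/funext => t; rewrite /D mulr0 oppr0; ring.
have mrho : cmeas setT (cres (observed s N K) D).
  by apply/(cmeas_cresP D mO); case: mD => ? ?; split; exact: measurable_funTS.
have rhoD : {ae mu, forall t, cres (observed s N K) D t = D t}.
  apply: ae_impl Y12 => t hY; rewrite /cres; case: ifPn => // /negP nobs.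
  rewrite /D hY ?subrr ?mulr0//; apply: not_observed => obs.
  by apply: nobs; rewrite inE.
exists (cres (observed s N K) D).
  by apply: (cintegrable_ae iD mrho); apply: ae_impl rhoD => t ->.
split=> [t nobs|l]; first by rewrite /cres memNset.
have [h1 k1 e1] := I1 l; have [h2 k2 e2] := I2 l.
rewrite cresT in k1 e1; rewrite cresT in k2 e2.
transitivity (cintegral setT (fun u => x1 u * (pkernel e (u - l))%:C - x2 u * (pkernel e (u - l))%:C)).
  apply: cintegral_ae.
  - by apply: cmeasM => //; exact: cmeas_pkernel.
  - by apply: cmeasB; [case: k1|case: k2].
  - by apply: ae_impl h0E => u ->; rewrite mulrBl.
rewrite cintegralB// -e1 -e2 -cintegralB//.
apply: cintegral_ae.
- by apply: cmeasB; [case: h1|case: h2].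
- apply: cmeasM => //; under eq_fun do rewrite mulrC; exact: cmeas_scale_cis.
- apply: ae_impl rhoD => t ->; rewrite /D dampE mulN1r opprK (mulrC t); ring.
Qed.

End synthesis.

(** * Optimality and the saddle point *)

Section optimality.
Context {R : realType}.
Local Notation mu := (@lebesgue_measure R).
Variables (s : nat) (N K : nat -> R).

(** The bound |C| <= L w makes the pairing with [C] continuous on L_2(w), so orthogonality passes
    from the observed exponentials to their closure. Continuity is used through b <= d + b^2 / d
    with b = |h - p| and p a trigonometric polynomial. *)
Lemma cintegral_conj_orthogonal (C h : R -> R[i]) (w : R -> R) (L : R) :
  (forall l, 0 <= w l) -> mu.-integrable setT (EFin \o w) -> cintegrable C ->
  {ae mu, forall l, normc (C l) <= L * w l} -> 0 <= L ->
  (forall t, observed s N K t -> cintegral setT (fun l => cis (- t * l) * C l) = 0) ->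
  L2s s N K w h ->
  cintegrable (fun l => C l * (h l)^*) /\ cintegral setT (fun l => C l * (h l)^*) = 0.
Proof.
move=> w0 iw iC CL L0 Corth [mh hfin happ].
have mC : cmeas setT C by case: iC.
have wint (x : R -> R[i]) : cmeas setT x -> (wsqint w x < +oo)%E ->
    mu.-integrable setT (EFin \o (fun l => normc (x l) ^+ 2 * w l)).
  move=> mx xfin; apply/integrableP; split; first exact: measurable_wsqint.
  rewrite (_ : (\int[mu]_l _)%E = wsqint w x)//; apply: eq_integral => l _ /=.
  by rewrite ger0_norm// mulr_ge0 ?sqr_ge0.
have young (x : R -> R[i]) (d : R) : 0 < d -> {ae mu, forall l,
    normc (C l * (x l)^*) <= L * (d * w l + d^-1 * (normc (x l) ^+ 2 * w l))}.
  move=> d0; apply: ae_impl CL => l hl; rewrite normcM normc_conj.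
  apply: (@le_trans _ _ (L * w l * normc (x l))).
    by rewrite ler_wpM2r ?normc_ge0.
  rewrite -mulrA ler_wpM2l//; set b := normc (x l).
  have -> : d * w l + d^-1 * (b ^+ 2 * w l) = w l * (d + d^-1 * b ^+ 2) by ring.
  rewrite ler_wpM2l//.
  rewrite -subr_ge0; have -> : d + d^-1 * b ^+ 2 - b = d^-1 * ((b - d / 2) ^+ 2 + 3 / 4 * d ^+ 2).
    by field; rewrite gt_eqF.
  apply: mulr_ge0; first by rewrite invr_ge0 ltW.
  by apply: addr_ge0; [exact: sqr_ge0|apply: mulr_ge0; [lra|exact: sqr_ge0]].
have iCx (x : R -> R[i]) : cmeas setT x -> (wsqint w x < +oo)%E ->
    cintegrable (fun l => C l * (x l)^*).
  move=> mx xfin; have := young x 1 ltr01.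
  apply: cintegrable_dom; first by apply: cmeasM => //; exact: cmeas_conj.
  by apply: integrable_scale; apply: integrable_add; apply: integrable_scale => //; exact: wint.
have iCh := iCx h mh hfin; split=> //.
apply: eq0_normc; apply/eqP; rewrite eq_le normc_ge0 andbT.
apply/ler_addgt0Pr => e e0; rewrite add0r.
set W := \int[mu]_l w l.
have W0 : 0 <= W by apply: Rintegral_ge0.
(* An approximation of squared error below d^2 bounds the pairing by 2 L (d W + d) = d (2 L (W +
   1)), which is at most e. The final 1 keeps the denominator positive when [L] is 0. *)
pose d := e / (2 * L * (W + 1) + 1).
have P0 : 0 < 2 * L * (W + 1) + 1 by rewrite ltr_pwDr// !mulr_ge0// addr_ge0.
have d0 : 0 < d by rewrite divr_gt0.
have [n [c [t [tobs hp]]]] := happ (d * d) (mulr_gt0 d0 d0).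
pose p l := \sum_(j < n) c j * cis (t j * l).
have mp : cmeas setT p by exact: cmeas_trig.
have mhp : cmeas setT (fun l => h l - p l) by exact: cmeasB.
have hpfin : (wsqint w (fun l => (h l - p l)%R) < +oo)%E by rewrite (lt_trans hp)// ltry.
have [_ pfin _] := L2s_trig w0 iw c tobs.
have iCp := iCx p mp pfin.
have icis (t0 : R) : cintegrable (fun l => cis (- t0 * l) * C l).
  have -> : (fun l => cis (- t0 * l) * C l) = (fun l => C l * cis (- t0 * l)).
    by apply/funext => l; rewrite mulrC.
  apply: (cintegrableM_bounded (M := 1) iC (cmeas_scale_cis _)).
  by apply: ae_all => l; rewrite normc_cis.
have Cp0 : cintegral setT (fun l => C l * (p l)^*) = 0.
  have E : (fun l => C l * (p l)^*) =
      (fun l => \sum_(j < n) (c j)^* * (cis (- t j * l) * C l)).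
    apply/funext => l; rewrite /p rmorph_sum mulr_sumr; apply: eq_bigr => j _.
    by rewrite rmorphM /= -/(conjc _) conj_cis mulNr mulrC -mulrA.
  have ij (j : 'I_n) : cintegrable (fun l => (c j)^* * (cis (- t j * l) * C l)).
    exact/cintegrableZ/icis.
  rewrite E (cintegral_sum ij).2 big1// => j _.
  by rewrite (cintegralZ _ (icis (t j))) (Corth _ (tobs j)) mulr0.
have -> : cintegral setT (fun l => C l * (h l)^*) =
    cintegral setT (fun l => C l * (h l - p l)^*).
  rewrite -[LHS]subr0 -Cp0 -cintegralB//; congr cintegral; apply/funext => l.
  by rewrite -mulrBr -rmorphB.
have iCd := iCx _ mhp hpfin.
rewrite (le_trans (normc_cintegral_le iCd))//.
have iwd := wint _ mhp hpfin.
have iw1 := integrable_scale d iw.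
have iw2 := integrable_scale d^-1 iwd.
have iw3 := integrable_scale L (integrable_add iw1 iw2).
have le1 : \int[mu]_l normc (C l * (h l - p l)^*) <=
    \int[mu]_l (L * (d * w l + d^-1 * (normc (h l - p l) ^+ 2 * w l))).
  rewrite /Rintegral fine_le//.
  - exact: (integrable_fin_num measurableT iCd.2).
  - exact: (integrable_fin_num measurableT iw3).
  - apply: ae_ge0_le_integral => //.
    + by move=> l _; rewrite lee_fin normc_ge0.
    + by case: iCd => ? /integrableP[].
    + move=> l _; rewrite lee_fin mulr_ge0// addr_ge0// mulr_ge0 ?invr_ge0 ?(ltW d0)//.
      by rewrite mulr_ge0 ?sqr_ge0.
    + by case/integrableP : iw3.
    + by apply: ae_impl (young (fun l => h l - p l) d d0) => l hl _; rewrite lee_fin.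
rewrite RintegralZl// in le1; last exact: integrable_add.
rewrite RintegralD// !RintegralZl// -/W in le1.
have hp' : \int[mu]_l (normc (h l - p l) ^+ 2 * w l) <= d * d.
  by rewrite -lee_fin fineK ?(ltW hp)//; exact: (integrable_fin_num measurableT iwd).
apply: (@le_trans _ _ (2 * (L * (d * W + d)))).
  rewrite ler_wpM2l// (le_trans le1)// ler_wpM2l// lerD2l.
  by rewrite ler_pdivrMl.
have -> : 2 * (L * (d * W + d)) = d * (2 * L * (W + 1)) by ring.
rewrite /d mulrAC ler_pdivrMr// ler_wpM2l ?(ltW e0)// lerDl ler01//.
Qed.

(** A Lagrange multiplier argument: as u = alpha (f0 - f1), the concave functional sending f to the
    integral of u f - (alpha / 2) |f - f1|^2 is maximal at f0, and over the ball the subtracted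
    integral is largest at f0. In [\bar R] only this quadratic term has to be finite, which the
    boundary condition ensures. *)
Lemma saddle_inequality (u f f0 f1 : R -> R) (alpha eps : R) :
  measurable_fun setT u -> (forall l, 0 <= u l) -> 0 <= alpha ->
  spectral_density f0 -> spectral_density f1 ->
  {ae mu, forall l, u l = (f0 l - f1 l) * alpha} ->
  (((2 * pi)^-1)%:E * \int[mu]_l (`|f0 l - f1 l| ^+ 2)%:E = eps%:E)%E ->
  L2ball f1 eps f ->
  (\int[mu]_l (u l * f l)%:E <= \int[mu]_l (u l * f0 l)%:E)%E.
Proof.
move=> mu_ u0 a0 [f00 if0] [_ if1] uE ball0 [[fge0 iff] ball].
have mf := measurable_weight iff.
have mf0 := measurable_weight if0; have mf1 := measurable_weight if1.
have msq (g : R -> R) : measurable_fun setT g ->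
    measurable_fun setT (fun l => (alpha / 2 * `|g l - f1 l| ^+ 2)%:E).
  move=> mg; apply/measurable_EFinP; apply: measurable_funM => //.
  by apply: measurable_funX; apply: measurableT_comp => //; exact: measurable_funB.
have muf (g : R -> R) : measurable_fun setT g -> measurable_fun setT (fun l => (u l * g l)%:E).
  by move=> mg; apply/measurable_EFinP; exact: measurable_funM.
have c0 : (0 < (2 * pi : R)^-1) by rewrite invr_gt0 mulr_gt0// pi_gt0.
have k0 : 0 <= alpha / 2 by rewrite divr_ge0.
have sq0 (g : R -> R) l : 0 <= alpha / 2 * `|g l - f1 l| ^+ 2 by rewrite mulr_ge0 ?sqr_ge0.
have hball : (\int[mu]_l (`|f l - f1 l| ^+ 2)%:E <= \int[mu]_l (`|f0 l - f1 l| ^+ 2)%:E)%E.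
  by rewrite -(@lee_pmul2l _ ((2 * pi)^-1)%:E) ?lte_fin// ball0.
have fin0 : (\int[mu]_l (`|f0 l - f1 l| ^+ 2)%:E)%E \is a fin_num.
  have : (0 <= \int[mu]_l (`|f0 l - f1 l| ^+ 2)%:E)%E.
    by apply: integral_ge0 => l _; rewrite lee_fin sqr_ge0.
  move: ball0; case: (\int[mu]_l _)%E => [r|//|//] //.
  by rewrite gt0_muley// lte_fin.
have Isq (g : R -> R) : measurable_fun setT g -> (\int[mu]_l (alpha / 2 * `|g l - f1 l| ^+ 2)%:E =
    (alpha / 2)%:E * \int[mu]_l (`|g l - f1 l| ^+ 2)%:E)%E.
  move=> mg; under eq_integral do rewrite EFinM.
  rewrite ge0_integralZl//.
  apply/measurable_EFinP; apply: measurable_funX; apply: measurableT_comp => //.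
  exact: measurable_funB.
(* The two sides differ pointwise by [alpha / 2 * (f0 - f) ^+ 2]. *)
have main : (\int[mu]_l (u l * f l)%:E + \int[mu]_l (alpha / 2 * `|f0 l - f1 l| ^+ 2)%:E <=
    \int[mu]_l (u l * f0 l)%:E + \int[mu]_l (alpha / 2 * `|f l - f1 l| ^+ 2)%:E)%E.
  rewrite -!ge0_integralD//; try by [exact: muf|exact: msq|
    move=> l _; rewrite lee_fin ?sq0// mulr_ge0].
  apply: ae_ge0_le_integral => //.
  - by move=> l _; rewrite -EFinD lee_fin addr_ge0// mulr_ge0.
  - by apply: emeasurable_funD; [exact: muf|exact: msq].
  - by move=> l _; rewrite -EFinD lee_fin addr_ge0// mulr_ge0.
  - by apply: emeasurable_funD; [exact: muf|exact: msq].
  - apply: ae_impl uE => l uE _; rewrite -!EFinD lee_fin !real_normK ?num_real// uE -subr_ge0.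
    rewrite (_ : _ - _ = alpha / 2 * (f0 l - f l) ^+ 2); last by field.
    by rewrite mulr_ge0 ?sqr_ge0.
move: main; rewrite !Isq// => main.
have fk : ((alpha / 2)%:E * \int[mu]_l (`|f0 l - f1 l| ^+ 2)%:E)%E \is a fin_num.
  exact: fin_numM.
rewrite -(leeD2rE _ _ fk) (le_trans main)// leeD2l// lee_wpmul2l// lee_fin.
Qed.

End optimality.

(** * The Pythagorean identity for the mean-square error *)

Section projection.
Context {R : realType}.
Local Notation mu := (@lebesgue_measure R).
Variables (s : nat) (N K : nat -> R).

(** Completing the square pointwise: the factor of the conjugate of h - h0 in the cross term is A f
    - h0 (f + g), the value of C. *)
Lemma sqr_error_expansion (A h h0 : R[i]) (f g : R) :
  normc (A - h0) ^+ 2 * f + normc h0 ^+ 2 * g + normc (h - h0) ^+ 2 * (f + g) =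
  normc (A - h) ^+ 2 * f + normc h ^+ 2 * g +
  2 * complex.Re ((A * f%:C - h0 * (f + g)%:C) * (h - h0)^*).
Proof.
rewrite !sqr_normcE; case: A => a1 a2; case: h => b1 b2; case: h0 => c1 c2 /=.
ring.
Qed.

(** The cross term integrates to 0 because [C] is orthogonal to both [h] and [h0], so the excess
    error of [h] is the squared distance from [h0] in L_2(f + g). The bound on [A] makes the
    individual error integrals finite. *)
Lemma orthogonal_le_error (A h h0 C : R -> R[i]) (f g : R -> R) (B L : R) :
  (forall l, 0 <= f l) -> (forall l, 0 <= g l) ->
  mu.-integrable setT (EFin \o f) -> mu.-integrable setT (EFin \o g) ->
  cmeas setT A -> (forall l, normc (A l) <= B) ->
  cintegrable C -> {ae mu, forall l, normc (C l) <= L * (f l + g l)} -> 0 <= L ->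
  (forall t, observed s N K t -> cintegral setT (fun l => cis (- t * l) * C l) = 0) ->
  {ae mu, forall l, C l = A l * (f l)%:C - h0 l * (f l + g l)%:C} ->
  L2s s N K (f \+ g) h0 -> L2s s N K (f \+ g) h ->
  (wsqint f (fun l => A l - h0 l)%R + wsqint g h0 <=
   wsqint f (fun l => A l - h l)%R + wsqint g h)%E.
Proof.
move=> f0 g0 jf jg mA AB iC CL L0 Corth CE Lh0 Lh.
have w0 l : 0 <= (f \+ g) l by rewrite addr_ge0.
have iw : mu.-integrable setT (EFin \o (f \+ g)) by exact: integrable_add.
have [iCh0 Ch0] := cintegral_conj_orthogonal w0 iw iC CL L0 Corth Lh0.
have [iCh Ch] := cintegral_conj_orthogonal w0 iw iC CL L0 Corth Lh.
have [mh0 _ _] := Lh0; have [mh _ _] := Lh.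
have iwh (x : R -> R[i]) : L2s s N K (f \+ g) x ->
    mu.-integrable setT (EFin \o (fun l => normc (x l) ^+ 2 * (f l + g l))).
  move=> [mx xfin _]; apply/integrableP; split; first exact: measurable_wsqint.
  rewrite (_ : (\int[mu]_l _)%E = wsqint (f \+ g) x)//; apply: eq_integral => l _ /=.
  by rewrite ger0_norm// mulr_ge0 ?sqr_ge0 ?w0.
have igx (x : R -> R[i]) : L2s s N K (f \+ g) x ->
    mu.-integrable setT (EFin \o (fun l => normc (x l) ^+ 2 * g l)).
  move=> Lx; have [mx _ _] := Lx; apply: (integrable_dom _ (iwh _ Lx)).
    by apply/measurable_EFinP; exact: measurable_wsqint.
  apply: ae_all => l; rewrite ger0_norm; last by rewrite mulr_ge0 ?sqr_ge0.
  by rewrite ler_wpM2l ?sqr_ge0// lerDr.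
have ifx (x : R -> R[i]) : L2s s N K (f \+ g) x ->
    mu.-integrable setT (EFin \o (fun l => normc (A l - x l) ^+ 2 * f l)).
  move=> Lx; have [mx _ _] := Lx.
  apply: (integrable_dom _ (integrable_add (integrable_scale (2 * B ^+ 2) jf)
    (integrable_scale 2 (iwh _ Lx)))).
    by apply/measurable_EFinP; apply: measurable_wsqint => //; exact: cmeasB.
  apply: ae_all => l; rewrite ger0_norm; last by rewrite mulr_ge0 ?sqr_ge0.
  apply: (@le_trans _ _ ((2 * normc (A l) ^+ 2 + 2 * normc (x l) ^+ 2) * f l)).
    by rewrite ler_wpM2r// normc_sub_sqr.
  rewrite mulrDl lerD// ?ler_wpM2r//.
    by rewrite ler_wpM2l// ler_sqr ?nnegrE ?normc_ge0// (le_trans (normc_ge0 _) (AB l)).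
  by rewrite -mulrA ler_wpM2l// ler_wpM2l ?sqr_ge0// lerDl.
have mhh0 : cmeas setT (fun l => h l - h0 l) by exact: cmeasB.
have ihh0 : mu.-integrable setT (EFin \o (fun l => normc (h l - h0 l) ^+ 2 * (f l + g l))).
  apply: (integrable_dom _ (integrable_add (integrable_scale 2 (iwh _ Lh)) (integrable_scale 2 (iwh _ Lh0)))).
    by apply/measurable_EFinP; exact: measurable_wsqint.
  apply: ae_all => l; rewrite ger0_norm; last by rewrite mulr_ge0 ?sqr_ge0 ?w0.
  rewrite -mulrDr -mulrDl mulrA ler_wpM2r ?w0// mulrDr.
  exact: normc_sub_sqr.
have iD : cintegrable (fun l => C l * (h l - h0 l)^*).
  have -> : (fun l => C l * (h l - h0 l)^*) = (fun l => C l * (h l)^* + -1 * (C l * (h0 l)^*)).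
    by apply/funext => l; rewrite rmorphB; ring.
  by apply: cintegrableD => //; exact: cintegrableZ.
have D0 : (\int[mu]_l (complex.Re (C l * (h l - h0 l)^*)))%R = 0.
  have : cintegral setT (fun l => C l * (h l - h0 l)^*) = 0.
    have -> : (fun l => C l * (h l - h0 l)^*) = (fun l => C l * (h l)^* - C l * (h0 l)^*).
      by apply/funext => l; rewrite rmorphB mulrBr.
    by rewrite cintegralB// Ch Ch0 subrr.
  by case.
have iDr := integrable_scale 2 (cintegrable_Re iD).
have D0' : (\int[mu]_l (2 * complex.Re (C l * (h l - h0 l)^*))%:E = 0)%E.
  rewrite -[LHS]fineK; last exact: (integrable_fin_num measurableT iDr).
  rewrite -[fine _]/(\int[mu]_l (2 * complex.Re (C l * (h l - h0 l)^*)))%R.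
  by rewrite RintegralZl// ?D0 ?mulr0//; exact: cintegrable_Re.
have -> : (wsqint f (fun l => A l - h l)%R + wsqint g h =
    wsqint f (fun l => A l - h0 l)%R + wsqint g h0 + wsqint (f \+ g)%R (fun l => h l - h0 l)%R)%E.
  have i0 := integrable_add (ifx _ Lh0) (igx _ Lh0).
  have i1 := integrable_add (ifx _ Lh) (igx _ Lh).
  (* The vanishing cross term is inserted so that both sides become integrals of the two members of
     the pointwise identity. *)
  rewrite -[LHS]adde0 -D0' /wsqint.
  rewrite -!integralD//; try by [exact: (ifx _ Lh0)|exact: (igx _ Lh0)|exact: (ifx _ Lh)|exact: (igx _ Lh)].
  apply: ae_eq_integral => //.
  - by case/integrableP: (integrable_add i1 iDr).
  - by case/integrableP: (integrable_add i0 ihh0).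
  apply: ae_impl CE => l CE _; rewrite -!EFinD; congr EFin.
  by rewrite CE sqr_error_expansion.
by rewrite leeDl// wsqint_ge0.
Qed.

End projection.

(** * From a saddle point to the minimax statement *)

Section saddle_point.
Context {R : realType}.
Local Notation mu := (@lebesgue_measure R).
Variables (s : nat) (N K : nat -> R) (a : R -> R[i]).

(** Membership in [H_] makes h0 admissible for every (f, g), whence Delta(f, g) <= Delta(h0; f, g)
    <= Delta(h0; f0, g0). For h in [H_], optimality at (f0, g0) gives Delta(h0; f0, g0) <= Delta(h;
    f0, g0), which is at most the worst error of h. *)
Lemma saddle_minimax (D : set ((R -> R) * (R -> R))) (f0 g0 : R -> R) (h0 : R -> R[i]) :
  D (f0, g0) -> optimal s N K a f0 g0 h0 -> H_ s N K D h0 ->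
  (forall f g, D (f, g) -> (mse s N K a h0 f g <= mse s N K a h0 f0 g0)%E) ->
  [/\ least_favorable s N K a D f0 g0, optimal s N K a f0 g0 h0 &
    minimax_robust s N K a D h0].
Proof.
move=> D0 opt0 Hh0 sad.
have worst0 : worst_mse s N K a D h0 = mse s N K a h0 f0 g0.
  apply/eqP; rewrite eq_le; apply/andP; split.
    by apply: ge_ereal_sup => _ [[f g] /= Dfg <-]; exact: sad.
  by apply: ereal_sup_ubound; exists (f0, g0).
split=> //; split=> //.
- exists (mse s N K a h0 f0 g0); first by exists h0.
  move=> f g _ Dfg [h [_ hopt] ->].
  by rewrite (le_trans (hopt _ (Hh0 _ _ Dfg)))// sad.
- by exists (f0, g0).
- move=> h Hh; rewrite worst0 (le_trans (opt0.2 _ (Hh _ _ D0)))//.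
  by apply: ereal_sup_ubound; exists (f0, g0).
Qed.

Lemma fourier_A : inL1 (Rs s N K) a ->
  fourier (Tset s N K) (-1) (zero_ext s N K a) (A_ s N K a).
Proof.
move=> /(inL1E _ (measurable_Rs s N K)) ia.
have E : cres (Tset s N K) (zero_ext s N K a) = cres (Rs s N K) a.
  apply/funext => t; rewrite /cres; case: ifPn => // /negP tT.
  case: ifPn => // /set_mem [t0 _]; exfalso; apply: tT; rewrite inE; by right.
left; split; first by apply/inL1E; [exact: measurable_Tset|rewrite E].
move=> l; rewrite kernel_integralE E -kernel_integralE.
congr cintegral; apply/funext => t; congr (_ * cis _); ring.
Qed.

Lemma A_bound l : inL1 (Rs s N K) a ->
  normc (A_ s N K a l) <= 2 * \int[mu]_u normc (cres (Rs s N K) a u).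
Proof.
move=> /(inL1E _ (measurable_Rs s N K)) ia.
have -> : A_ s N K a l = kernelT (-1) (cres (Rs s N K) a) l.
  rewrite -kernel_integralE; congr cintegral; apply/funext => t; congr (_ * cis _); ring.
exact: kernelT_bound.
Qed.

Lemma sqr_normc_div (z : R[i]) (r : R) : normc (z / r%:C) ^+ 2 = normc z ^+ 2 / r ^+ 2.
Proof.
by rewrite -fmorphV normcM normc_real exprMn real_normK ?num_real// exprVn.
Qed.

Lemma measurable_weightV (w : R -> R) : (forall l, 0 <= w l) ->
  measurable_fun setT w -> measurable_fun setT (fun l => (w l)^-1).
Proof.
move=> w0 mw; have -> : (fun l => (w l)^-1) = (fun l => (w l) `^ (-1)).
  by apply/funext => l; rewrite powR_inv1.
have h := measurableT_comp (@measurable_powR R (-1)) mw; exact: h.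
Qed.

End saddle_point.

(** * The spectral characteristic h0 and its optimality *)

Section spectral_characteristic.
Context {R : realType}.
Local Notation mu := (@lebesgue_measure R).
Variables (s : nat) (N K : nat -> R) (a : R -> R[i]).
Variables (f0 g0 : R -> R) (C0 : R -> R[i]) (M : R).
Hypothesis a_L1 : inL1 (Rs s N K) a.
Hypothesis f0_density : spectral_density f0.
Hypothesis g0_density : spectral_density g0.
Hypothesis C0_def : is_C s N K a f0 g0 C0.
Hypothesis h_bounded : {ae mu, forall l,
  normc (A_ s N K a l * (f0 l)%:C - C0 l) ^+ 2 / (f0 l + g0 l) ^+ 2 <= M}.

Let h0 l := (A_ s N K a l * (f0 l)%:C - C0 l) / (f0 l + g0 l)%:C.

Let w0 l : 0 <= (f0 \+ g0) l.
Proof. by rewrite addr_ge0 ?f0_density.1 ?g0_density.1. Qed.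

Let iw : mu.-integrable setT (EFin \o (f0 \+ g0)).
Proof. by apply: integrable_add; [exact: f0_density.2|exact: g0_density.2]. Qed.

Let mA : cmeas setT (A_ s N K a).
Proof. by apply: (fourier_cmeas (measurable_Tset s N K)); exact: fourier_A. Qed.

Let mC0 : cmeas setT C0.
Proof.
by case: C0_def => y [x [_ _ F]]; exact: (fourier_cmeas (measurable_Tset s N K) F).
Qed.

Let mf0 : measurable_fun setT f0.
Proof. exact: (measurable_weight f0_density.2). Qed.

Lemma density_neq0 : {ae mu, forall l, f0 l + g0 l != 0}.
Proof. by case: C0_def => y [x [_ [_ [_ ? _]] _]]. Qed.

Lemma cmeas_characteristic : cmeas setT h0.
Proof.
have -> : h0 = (fun l => (A_ s N K a l * (f0 l)%:C - C0 l) * ((f0 l + g0 l)^-1)%:C).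
  by apply/funext => l; rewrite /h0 fmorphV.
apply: cmeasM; last first.
  by apply: cmeas_real; apply: measurable_weightV => //; exact: (measurable_weight iw).
by apply: cmeasB => //; apply: cmeasM => //; exact: cmeas_real.
Qed.

Lemma characteristic_bounded : {ae mu, forall l, normc (h0 l) <= 1 + `|M|}.
Proof.
apply: ae_impl h_bounded => l; rewrite -sqr_normc_div -/(h0 l) => hM.
by have := normc_ge0 (h0 l); have := ler_norm M; have := normr_ge0 M; nra.
Qed.

(** The graph of R exhibits [Y1] as the transform of A f0 / (f0 + g0), that of B exhibits [Y2] as
    the transform of C / (f0 + g0), and on T both are 2 pi times the same image [y]. The weight is
    arbitrary because [H_] ranges over all pairs of the class. *)
Lemma characteristic_L2s (w : R -> R) : (forall l, 0 <= w l) ->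
  mu.-integrable setT (EFin \o w) -> L2s s N K w h0.
Proof.
move=> wge0 jw.
have [y [x [[_ [X1 [Y1 [FX1 FY1 [_ yY1]]]]] [_ [_ _ [X2 [Y2 [FX2 _ FY2 [_ yY2]]]]]] FC]]] := C0_def.
have mT := measurable_Tset s N K.
apply: (L2s_fourier_support wge0 jw cmeas_characteristic characteristic_bounded FY1 FY2).
  move: yY1 yY2; apply: ae_impl2 => t h1 h2 tT.
  have c0 : ((2 * pi)^-1)%:C != 0 :> R[i].
    by rewrite (inj_eq (@complexI R)) invr_eq0 gt_eqF// mulr_gt0// pi_gt0.
  by apply: (mulfI c0); rewrite -(h1 tT) -(h2 tT).
move: (fourier_unique mT (fourier_A a_L1) FX1) (fourier_unique mT FC FX2).
apply: ae_impl2 => l h1 h2; rewrite /h0 h1 h2 !rmorphM /= fmorphV; ring.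
Qed.

Let characteristicE : {ae mu, forall l,
  C0 l = A_ s N K a l * (f0 l)%:C - h0 l * (f0 l + g0 l)%:C}.
Proof.
apply: ae_impl density_neq0 => l wn0; rewrite /h0 mulfVK ?(inj_eq (@complexI R))//.
by ring.
Qed.

Lemma characteristic_optimal : optimal s N K a f0 g0 h0.
Proof.
split; first exact: characteristic_L2s.
move=> h Lh; set B := 2 * \int[mu]_u normc (cres (Rs s N K) a u).
have AB l : normc (A_ s N K a l) <= B by exact: A_bound.
have B0 : 0 <= B := le_trans (normc_ge0 _) (AB 0).
(* From C = A f0 - h0 (f0 + g0) and f0 <= f0 + g0: the summands bound |A| and |h0|. The resulting
   bound on [C] also makes it integrable. *)
pose L := B + (1 + `|M|).
have L0 : 0 <= L by rewrite !addr_ge0.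
have CL : {ae mu, forall l, normc (C0 l) <= L * (f0 l + g0 l)}.
  move: characteristicE characteristic_bounded; apply: ae_impl2 => l -> hM.
  rewrite (le_trans (ler_normcB _ _))// normcM (normcM (h0 l)) !normc_real.
  rewrite (ger0_norm (w0 l)) (ger0_norm (f0_density.1 l)) mulrDl lerD//.
    by rewrite ler_pM ?normc_ge0// ?f0_density.1// lerDl g0_density.1.
  by apply: ler_wpM2r => //; exact: (w0 l).
have iC : cintegrable C0 := cintegrable_dom mC0 (integrable_scale L iw) CL.
have [y [x [_ [_ [lx _ _]] FC]]] := C0_def.
have Corth t : observed s N K t -> cintegral setT (fun l => cis (- t * l) * C0 l) = 0.
  exact: (fourier_orthogonal lx FC iC).
rewrite /mse -!ge0_muleDr; try by apply: wsqint_ge0 => ?; rewrite ?f0_density.1 ?g0_density.1.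
rewrite lee_wpmul2l//; first by rewrite lee_fin invr_ge0 mulr_ge0// pi_ge0.
by apply: (orthogonal_le_error f0_density.1 g0_density.1 f0_density.2 g0_density.2
  mA AB iC CL L0 Corth characteristicE _ Lh); exact: characteristic_L2s.
Qed.

End spectral_characteristic.

Theorem theorem4p2 (R : realType) (s : nat) (N K : nat -> R) (a : R -> R[i])
  (f1 g1 f0 g0 : R -> R) (eps1 eps2 alpha1 alpha2 : R) (C0 : R -> R[i])
  (s_ge1 : (1 <= s)%N) (N0 : N 0%N = 0) (K0 : K 0%N = 0)
  (N_ge0 : forall l, (1 <= l)%N -> (l <= s)%N -> 0 <= N l)
  (K_ge0 : forall l, (1 <= l)%N -> (l <= s)%N -> 0 <= K l)
  (a_L1 : inL1 (Rs s N K) a)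
  (a_tL2 : (\int[@lebesgue_measure R]_(t in Rs s N K)
              (t * normc (a t) ^+ 2)%:E < +oo)%E)
  (a_L2 : inL2 (Tset s N K) (zero_ext s N K a))
  (f1_density : spectral_density f1) (g1_density : spectral_density g1)
  (f0_class : L2ball f1 eps1 f0) (g0_class : L2ball g1 eps2 g0)
  (fg0_minimal : minimality f0 g0)
  (C0_def : is_C s N K a f0 g0 C0)
  (hf_bounded : exists M : R, {ae @lebesgue_measure R, forall l,
     normc (A_ s N K a l * (g0 l)%:C + C0 l) ^+ 2 / (f0 l + g0 l) ^+ 2 <= M})
  (hg_bounded : exists M : R, {ae @lebesgue_measure R, forall l,
     normc (A_ s N K a l * (f0 l)%:C - C0 l) ^+ 2 / (f0 l + g0 l) ^+ 2 <= M})
  (alpha1_ge0 : 0 <= alpha1) (alpha2_ge0 : 0 <= alpha2)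
  (eq_f : {ae @lebesgue_measure R, forall l,
     normc (A_ s N K a l * (g0 l)%:C + C0 l) ^+ 2 =
     (f0 l + g0 l) ^+ 2 * (f0 l - f1 l) * alpha1})
  (eq_g : {ae @lebesgue_measure R, forall l,
     normc (A_ s N K a l * (f0 l)%:C - C0 l) ^+ 2 =
     (f0 l + g0 l) ^+ 2 * (g0 l - g1 l) * alpha2})
  (f0_boundary : (((2 * pi)^-1)%:E *
     \int[@lebesgue_measure R]_l (`|f0 l - f1 l| ^+ 2)%:E = eps1%:E)%E)
  (g0_boundary : (((2 * pi)^-1)%:E *
     \int[@lebesgue_measure R]_l (`|g0 l - g1 l| ^+ 2)%:E = eps2%:E)%E)
  (fg0_extremal :
     solves_extremal s N K a (L2ball f1 eps1 `*` L2ball g1 eps2) f0 g0) :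
  let h0 := fun l => (A_ s N K a l * (f0 l)%:C - C0 l) / (f0 l + g0 l)%:C in
  [/\ least_favorable s N K a (L2ball f1 eps1 `*` L2ball g1 eps2) f0 g0,
      optimal s N K a f0 g0 h0 &
      minimax_robust s N K a (L2ball f1 eps1 `*` L2ball g1 eps2) h0].
Proof.
move=> h0.
have [M hM] := hg_bounded; have [f0d _] := f0_class; have [g0d _] := g0_class.
have opt0 : optimal s N K a f0 g0 h0 := characteristic_optimal a_L1 f0d g0d C0_def hM.
have mh0 : cmeas setT h0 by case: opt0 => -[].
have mA : cmeas setT (A_ s N K a).
  by apply: (fourier_cmeas (measurable_Tset s N K)); exact: fourier_A.
have wn0 := density_neq0 C0_def.
apply: saddle_minimax => // [f g [[[f_ge0 jf] _] [[g_ge0 jg] _]]|f g [/= Df Dg]].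
  apply: (characteristic_L2s a_L1 f0d g0d C0_def hM); last exact: integrable_add.
  by move=> l; rewrite addr_ge0.
have c0 : (0 <= ((2 * pi : R)^-1)%:E)%E by rewrite lee_fin invr_ge0 mulr_ge0// pi_ge0.
(* The error is a term in f plus a term in g and the class is a product, so each term is maximised
   over its own ball. *)
rewrite /mse leeD// lee_wpmul2l//.
  apply: (saddle_inequality _ _ alpha1_ge0 f0d f1_density _ f0_boundary Df).
  - by apply: measurable_sqr_normc; exact: cmeasB.
  - by move=> l; exact: sqr_ge0.
  move: wn0 eq_f; apply: ae_impl2 => l wl fE.
  (* This form of A - h0 identifies |A - h0|^2 with h_f, to which the equation for f0 applies. *)
  have -> : A_ s N K a l - h0 l = (A_ s N K a l * (g0 l)%:C + C0 l) / (f0 l + g0 l)%:C.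
    have : (f0 l + g0 l)%:C != 0 :> R[i] by rewrite (inj_eq (@complexI R)).
    by rewrite /h0 rmorphD /= => ?; field.
  by rewrite sqr_normc_div fE; field.
apply: (saddle_inequality _ _ alpha2_ge0 g0d g1_density _ g0_boundary Dg).
- exact: measurable_sqr_normc.
- by move=> l; exact: sqr_ge0.
by move: wn0 eq_g; apply: ae_impl2 => l wl gE; rewrite sqr_normc_div gE; field.
Qed.
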